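(* Let $\theta\in\mathbb{R}$ be such that $\sqrt{4+4\theta}\in\mathbb{R}\setminus\mathbb{Z}$. Then there exists a conformal $\mathcal{H}^1$-reducible CMC-$1$ immersion $f\colon\mathbb{C}\setminus\{0\}\to H^3$ of type $\mathbf{O}(-2,-3)$ with $\mathrm{TA}(f^{\#})=8\pi$ whose hyperbolic Gauss map and Hopf differential are $$G=\left(\frac{z-1}{z}\right)^2,\qquad Q=\frac{\theta(z-1)\,dz^2}{z^2}.$$ Moreover, all $\mathcal{H}^1$-reducible surfaces of type $\mathbf{O}(-2,-3)$ with $(\mu_1^{\#},\mu_2^{\#})=(1,0)$ and $\mathrm{TA}(f^{\#})=8\pi$ are given in this manner.
   Context: CMC-$1$ means constant mean curvature $1$; all CMC-$1$ immersions are conformal and complete. $H^3$ is hyperbolic $3$-space of constant curvature $-1$, identified with $\{aa^*: a\in \mathrm{SL}(2,\mathbb{C})\}$, $a^*$ the conjugate transpose. For a conformal CMC-$1$ immersion $f\colon M\to H^3$ of a Riemann surface $M$ with universal cover $\widetilde M$, there is (Bryant) a holomorphic null immersion $F=(F_{ij})\colon\widetilde M\to \mathrm{SL}(2,\mathbb{C})$ (null: $\det(F^{-1}dF)=0$) with $f=FF^*$. The hyperbolic Gauss map is $G=dF_{11}/dF_{21}=dF_{12}/dF_{22}$ (meromorphic on $M$); the secondary Gauss map is $g=-dF_{12}/dF_{11}=-dF_{22}/dF_{21}$ (meromorphic on $\widetilde M$); the Hopf differential $Q$ is the holomorphic $2$-differential on $M$ with $F^{-1}dF=\begin{pmatrix}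 g&-g^2\\1&-g\end{pmatrix}\dfrac{Q}{dg}$. The metric $ds^{2\,\#}=(1+|G|^2)^2|Q/dG|^2$ is well defined on $M$; with Gaussian curvature $K^{\#}$ and area element $dA^{\#}$, the dual total absolute curvature is $\mathrm{TA}(f^{\#})=\int_M(-K^{\#})\,dA^{\#}$. If $f$ is complete and $\mathrm{TA}(f^{\#})<\infty$, then $M=\overline M_\gamma\setminus\{p_1,\dots,p_n\}$ with $\overline M_\gamma$ compact of genus $\gamma$ (the $p_j$ are the ends), $G$ and $Q$ extend meromorphically to $\overline M_\gamma$, and $\mathrm{TA}(f^{\#})=4\pi\deg G$. The surface is of type $\mathbf{O}(d_1,\dots,d_n)$ if $\gamma=0$, it has $n$ ends, and $\operatorname{ord}_{p_j}Q=d_j$; $\mu_j^{\#}$ denotes the branching order of $G$ at $p_j$ (so $G$ is $(\mu_j^{\#}+1)$-to-one near $p_j$); for type $\mathbf{O}(-2,-3)$, $p_1$ is the end with $d_1=-2$ and $p_2$ the end with $d_2=-3$. The representation $\rho_g\colon\pi_1(M)\to \mathrm{PSL}(2,\mathbb{C})$ is defined by $g\circ\tau^{-1}=\rho_g(\tau)\star g$ ($\star$ = Möbius action) for covering transformations $\tau$. $f$ is reducible if the $\rho_g(\tau)$, $\tau\in\pi_1(M)$, are simultaneously diagonalizable; $\mathcal{H}^3$-reducible if all $\rho_g(\tau)$ are the identity; $\mathcal{H}^1$-reducible if reducible but not $\mathcal{H}^3$-reducible. ''Given in this manner'' is understood up to isometries of $H^3$ (which change $G$ by a Möbius transformation and fix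 $Q$) and conformal changes of the coordinate $z$. *)

(* Defs.v *)
From HB Require Import structures.
From mathcomp Require Import all_boot all_order all_algebra.
From mathcomp Require Import complex.
From mathcomp Require Import all_classical all_reals all_analysis.

Set Implicit Arguments.
Unset Strict Implicit.
Unset Printing Implicit Defensive.

Import Order.TTheory GRing.Theory Num.Theory.
Import numFieldNormedType.Exports.
Local Open Scope ring_scope.
Local Open Scope complex_scope.
Local Open Scope classical_set_scope.

(* [R[i]] as a one-dimensional normed space over itself; hence [derivable] and
   [derive1] are complex differentiability and the complex derivative for functions
   [R[i] -> R[i]], and their real counterparts for functions [R -> R]. *)
HB.instance Definition _ (R : realType) := GRing.ComAlgebra.copy R[i] R[i]^o.
HB.instance Definition _ (R : realType) := Vector.copy R[i] R[i]^o.
HB.instance Definition _ (R : realType) := NormedModule.copy R[i] R[i]^o.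

Section Defs.
Variable R : realType.
Local Notation C := R[i].
Local Notation M2 := 'M[C]_2.
Local Notation Ci := (@Complex R 0 1).
Local Notation Re := (@complex.Re R).
Local Notation Im := (@complex.Im R).

Definition Cstar : set C := [set z | z != 0].

(* [cexp : C -> Cstar] is the universal covering of [Cstar]; its covering
   transformations are the [deck n], [n : int]. *)
Definition cexp (w : C) : C :=
  (expR (Re w))%:C * (cos (Im w) +i* sin (Im w)).

Definition deck (n : int) (w : C) : C := w + (0 +i* (2 * pi * n%:~R)).

Definition mx2 (a b c d : C) : M2 :=
  \matrix_(i, j) if i == 0 then if j == 0 then a else b
                 else if j == 0 then c else d.

Definition adjoint (A : M2) : M2 := (map_mx (@conjc R) A)^T.

(* The Riemann sphere is [option C], with [None] the point at infinity. *)

Definition ratio (a b : C) : option C := if b == 0 then None else Some (a / b).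

Definition mobius (A : M2) (p : option C) : option C :=
  if p is Some z then ratio (A 0 0 * z + A 0 1) (A 1 0 * z + A 1 1)
  else ratio (A 0 0) (A 1 0).

(* The two affine coordinates of the sphere, around 0 and around infinity. *)
Definition aff (p : option C) : C := if p is Some z then z else 0.
Definition aff_infty (p : option C) : C := if p is Some z then z^-1 else 0.

(* [z |-> mobius A z] maps 0 to [p1] and infinity to [p2]; its inverse is a
   conformal coordinate on the sphere minus [p1] and [p2], with values in
   [Cstar]. *)
Definition end_coordinate (p1 p2 : option C) (A : M2) : Prop :=
  [/\ \det A != 0, mobius A (Some 0) = p1 & mobius A None = p2].

(* Minkowski 4-space is the space of Hermitian matrices, with [- \det] as the
   quadratic form; [lprod] is its polarization. *)
Definition lprod (X Y : M2) : R := - Re (\tr (X *m \adj Y)) / 2.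

Definition hyperbolic_space : set M2 :=
  [set X | exists a : M2, \det a = 1 /\ X = a *m adjoint a].

(* Real directional derivative; [pd 1 f] is f_x and [pd Ci f], with [Ci] the
   imaginary unit, is f_y. *)
Definition pd (v : C) (f : C -> M2) (z : C) : M2 :=
  \matrix_(i, j)
    (derive1 (fun s : R => Re (f (z + s%:C * v) i j)) 0 +i*
     derive1 (fun s : R => Im (f (z + s%:C * v) i j)) 0).

Definition smooth_on (D : set C) (f : C -> M2) : Prop :=
  forall (s : seq C) (z : C) (i j : 'I_2), D z ->
  let h := fun u => foldr pd f s u i j in
  {for z, continuous h} /\
  forall v : C, derivable (fun t : R => Re (h (z + t%:C * v))) 0 1 /\
                derivable (fun t : R => Im (h (z + t%:C * v))) 0 1.

(* For a conformal [f], the induced metric is [conf_factor f z |dz|^2]. *)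
Definition conf_factor (f : C -> M2) (z : C) : R :=
  lprod (pd 1 f z) (pd 1 f z).

Definition conformal_immersion_on (D : set C) (f : C -> M2) : Prop :=
  forall z, D z ->
  [/\ 0 < conf_factor f z,
      lprod (pd Ci f z) (pd Ci f z) = conf_factor f z &
      lprod (pd 1 f z) (pd Ci f z) = 0].

Definition unit_normal (f : C -> M2) (z : C) (N : M2) : Prop :=
  [/\ adjoint N = N, lprod N N = 1, lprod N (f z) = 0,
      lprod N (pd 1 f z) = 0 & lprod N (pd Ci f z) = 0].

(* Half the trace of the second fundamental form, for a conformal [f]. The
   second derivatives may be taken in Minkowski space: those of hyperbolic
   space differ from them by multiples of [f], which is orthogonal to [N]. *)
Definition mean_curvature (f : C -> M2) (z : C) (N : M2) : R :=
  (lprod (pd 1 (pd 1 f) z) N + lprod (pd Ci (pd Ci f) z) N)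
  / (2 * conf_factor f z).

(* C^1 paths defined on [0, 1). They need not be regular, so that C^1 and
   piecewise C^1 paths have the same images and lengths; the values of [c]
   outside [0, 1) play no role beyond making [c] two-sided C^1 at 0. *)
Definition path_in (D : set C) (c : R -> C) : Prop :=
  forall t : R, 0 <= t < 1 ->
  [/\ D (c t), derivable (Re \o c) t 1, derivable (Im \o c) t 1,
      {for t, continuous (derive1 (Re \o c))} &
      {for t, continuous (derive1 (Im \o c))}].

Definition divergent_in (D : set C) (c : R -> C) : Prop :=
  forall K : set C, compact K -> K `<=` D -> \forall t \near (1 : R)^'-, ~ K (c t).

Definition speed (c : R -> C) (t : R) : R :=
  Num.sqrt (derive1 (Re \o c) t ^+ 2 + derive1 (Im \o c) t ^+ 2).

Definition path_length (f : C -> M2) (c : R -> C) : \bar R :=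
  (\int[lebesgue_measure]_(t in `[0%R, 1%R[)
    (Num.sqrt (conf_factor f (c t)) * speed c t)%:E)%E.

(* Every path which leaves all compact sets has infinite length. *)
Definition complete_on (D : set C) (f : C -> M2) : Prop :=
  forall c : R -> C, path_in D c -> divergent_in D c -> path_length f c = +oo%E.

Definition cmc1_immersion (f : C -> M2) : Prop :=
  [/\ forall z, Cstar z -> hyperbolic_space (f z),
      smooth_on Cstar f,
      conformal_immersion_on Cstar f,
      forall z, Cstar z ->
        exists N, unit_normal f z N /\ mean_curvature f z N = 1 &
      complete_on Cstar f].

Definition dmx (F : C -> M2) (w : C) : M2 :=
  \matrix_(i, j) derive1 (fun u => F u i j) w.

(* F^-1 dF *)
Definition mc_form (F : C -> M2) (w : C) : M2 := invmx (F w) *m dmx F w.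

Definition bryant_lift (f : C -> M2) (F : C -> M2) : Prop :=
  [/\ forall w i j, derivable (fun u => F u i j) w 1,
      forall w, \det (F w) = 1,
      forall w, dmx F w != 0 /\ \det (mc_form F w) = 0 &
      forall w, f (cexp w) = F w *m adjoint (F w)].

(* dF11/dF21 = dF12/dF22: as dF is nonzero and singular, at least one of the two
   quotients is not 0/0, and they agree if neither is. *)
Definition hyp_gauss (F : C -> M2) (w : C) : option C :=
  let D := dmx F w in
  if (D 0 0 != 0) || (D 1 0 != 0) then ratio (D 0 0) (D 1 0)
  else ratio (D 0 1) (D 1 1).

(* - dF12/dF11 = - dF22/dF21 *)
Definition sec_gauss (F : C -> M2) (w : C) : option C :=
  let D := dmx F w in
  if (D 0 0 != 0) || (D 0 1 != 0) then ratio (- D 0 1) (D 0 0)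
  else ratio (- D 1 1) (D 1 0).

(* [q dz^2] is the Hopf differential. Pulled back by z = cexp w it is
   [q (cexp w) (cexp w)^2 dw^2]. In terms of k = 1/g the defining relation is
   F^-1 dF = (-k, 1; -k^2, k) Q/dk, which is used at the poles of g. *)
Definition hopf_differential (F : C -> M2) (q : C -> C) : Prop :=
  (forall z, Cstar z -> derivable q z 1) /\
  forall w,
    let g := sec_gauss F in
    let Q := q (cexp w) * cexp w ^+ 2 in
    if g w is Some a
    then derive1 (aff \o g) w *: mc_form F w = Q *: mx2 a (- a ^+ 2) 1 (- a)
    else derive1 (aff_infty \o g) w *: mc_form F w = Q *: mx2 0 1 0 0.

(* [F] is a lift of [f], whose hyperbolic Gauss map is [G] and whose Hopf
   differential is [q dz^2]. *)
Definition bryant_data (f F : C -> M2) (G : C -> option C) (q : C -> C) : Prop :=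
  [/\ bryant_lift f F, forall w, hyp_gauss F w = G (cexp w) &
      hopf_differential F q].

(* [rho n] is a representative in SL(2, C) of the image of [deck n] in
   PSL(2, C). *)
Definition represents_rho_g (F : C -> M2) (rho : int -> M2) : Prop :=
  forall n, \det (rho n) = 1 /\
    forall w, sec_gauss F (deck (- n) w) = mobius (rho n) (sec_gauss F w).

Definition reducible (rho : int -> M2) : Prop :=
  exists P : M2, P \in unitmx /\
    forall n, is_diag_mx (P *m rho n *m invmx P).

(* Scalar matrices of determinant 1 are those of trivial class in PSL(2, C). *)
Definition H3_reducible (rho : int -> M2) : Prop :=
  forall n, is_scalar_mx (rho n).

Definition H1_reducible (F : C -> M2) : Prop :=
  exists rho, [/\ represents_rho_g F rho, reducible rho & ~ H3_reducible rho].

(* [h] is meromorphic at 0, of order [d]. *)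
Definition order_at0 (h : C -> C) (d : int) : Prop :=
  exists u : C -> C,
    [/\ \forall t \near (0 : C), derivable u t 1, u 0 != 0 &
        \forall t \near (0 : C)^', h t = t ^ d * u t].

(* Genus 0, with the two ends at z = 0 and z = infinity, where [q dz^2] has
   order [d1] and [d2]; with z = 1/t, [q dz^2 = q (1/t) t^-4 dt^2]. *)
Definition type_O (d1 d2 : int) (q : C -> C) : Prop :=
  order_at0 q d1 /\ order_at0 (fun t => q t^-1 / t ^+ 4) d2.

(* [G] is meromorphic at 0 and takes its value there with multiplicity
   [mu.+1]: this is a zero of order [mu.+1] in a coordinate of the target sphere
   which vanishes at that value. *)
Definition branching_order_at0 (G : C -> option C) (mu : nat) : Prop :=
  exists (A : M2) (h : C -> C),
    [/\ \det A != 0, order_at0 h mu.+1%:Z &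
        \forall t \near (0 : C)^', mobius A (G t) = Some (h t)].

Definition branching_orders (G : C -> option C) (mu1 mu2 : nat) : Prop :=
  branching_order_at0 G mu1 /\ branching_order_at0 (fun t => G t^-1) mu2.

(* The metric ds^2# = [dual_factor G q z |dz|^2]. This is correct outside the
   poles and the branch points of [G], a discrete subset of [Cstar]. *)
Definition dual_factor (G : C -> option C) (q : C -> C) (z : C) : R :=
  Re ((1 + `|aff (G z)| ^+ 2) ^+ 2 * `|q z / derive1 (aff \o G) z| ^+ 2).

Definition laplacian (h : C -> R) (z : C) : R :=
  derive1n 2 (fun s : R => h (z + s%:C)) 0 +
  derive1n 2 (fun s : R => h (z + s%:C * Ci)) 0.

(* Gaussian curvature of the conformal metric [sigma z |dz|^2]. *)
Definition gauss_curvature (sigma : C -> R) (z : C) : R :=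
  - laplacian (fun u => ln (sigma u)) z / (2 * sigma z).

Definition dual_TA (G : C -> option C) (q : C -> C) : \bar R :=
  let sigma := dual_factor G q in
  (\int[lebesgue_measure \x lebesgue_measure]_(p in
      [set p : R * R | Cstar (p.1 +i* p.2)])
    (- gauss_curvature sigma (p.1 +i* p.2) * sigma (p.1 +i* p.2))%:E)%E.

Definition H1_reducible_cmc1 (d1 d2 : int) (f : C -> M2)
    (G : C -> option C) (q : C -> C) : Prop :=
  exists F : C -> M2,
    [/\ cmc1_immersion f, bryant_data f F G q, H1_reducible F & type_O d1 d2 q].

End Defs.

(* Main.v *)
Require Import Defs.
From HB Require Import structures.
From mathcomp Require Import all_boot all_order all_algebra.
From mathcomp Require Import complex.
From mathcomp Require Import all_classical all_reals all_analysis.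
From mathcomp Require Import measurable_realfun.
From mathcomp Require Import ring lra.

Set Implicit Arguments.
Unset Strict Implicit.
Unset Printing Implicit Defensive.

Import Order.TTheory GRing.Theory Num.Theory.
Import numFieldNormedType.Exports.
Local Open Scope ring_scope.
Local Open Scope complex_scope.
Local Open Scope classical_set_scope.

(* With z = e^w, a lift F is determined by the connection dF F^-1 up to right
   multiplication by constants, and this connection is determined by G and Q.

   Existence. For the given G and Q, with 1 + theta = nu^2, the linear system for F
   has a regular singular point at z = 0 with exponents 1 + nu and 1 - nu. As 2 nu is
   real and not an integer, the Frobenius method gives two solutions, which diagonalize
   the monodromy, with eigenvalues e^(2 pi i nu) and e^(- 2 pi i nu); it is unitary, so
   that F F^* descends to the punctured plane. The surface is complete because
   ln tr (F F^* ) is Lipschitz for its metric: on a path of finite length it is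
   bounded, and there the metric dominates a multiple of |dw|. The total curvature is
   the integral of the Laplacian of ln (|z|^4 + |z - 1|^4), computed as the limit of the
   flux through large squares.

   Uniqueness. The orders of Q at the ends give Q = (a z + b) dz^2 / z^2. The connection
   descends to the punctured plane since the monodromy acts on F from the right. The
   branching orders of G control its entries at 0 and infinity; after composing G with
   a Moebius transformation, one of them is k z^2 by Liouville's theorem, and the Hopf
   differential then determines the others up to a shear. The monodromy is unitary and
   has the eigenvalue e^(2 pi i nu), so that nu is real; if 2 nu were an integer, the
   monodromy would be scalar, hence rho_g trivial. *)

(** * Complex differentiation *)

(** The Hopf condition is used in the form dF F^(-1) d^2F = Q dF. It involves neither Gauss map,
    hence needs no distinction at the poles of g. The Gauss map G is a relation between the two rows
    of dF: isometries of hyperbolic space multiply F from the left and act on G by Moebius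
    transformations, while the monodromy multiplies F from the right and is invisible in dF F^(-1).
    Integrals over circles are replaced by integrals over a period of the exponential, so that only
    segments have to be parametrized. In the statement 4 + 4 theta = (2 nu)^2, where 2 nu is the
    difference of the two exponents. That 2 nu is not an integer serves twice: the denominators k (k
    + 2 nu) and k (k - 2 nu) of the Frobenius recursions do not vanish, and e^(2 pi i nu) differs
    from its inverse, so that rho_g is not trivial. It also excludes theta = 0, where Q vanishes,
    and theta = -1, where the exponents coincide. The converse cannot assume this; it uses only the
    exponent 1 + nu with Re nu >= 0, whose Frobenius series always exists and gives an eigenvector
    of the monodromy. *)

Section HasDerivative.
Variable K : numFieldType.
Implicit Types (f g : K -> K) (x a b : K).

Lemma HDD f g x a b : is_derive x 1 f a -> is_derive x 1 g b ->
  is_derive x 1 (fun u => f u + g u) (a + b).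
Proof. exact: is_deriveD. Qed.

Lemma HDB f g x a b : is_derive x 1 f a -> is_derive x 1 g b ->
  is_derive x 1 (fun u => f u - g u) (a - b).
Proof. exact: is_deriveB. Qed.

Lemma HDN f x a : is_derive x 1 f a -> is_derive x 1 (fun u => - f u) (- a).
Proof. exact: is_deriveN. Qed.

Lemma HDM f g x a b : is_derive x 1 f a -> is_derive x 1 g b ->
  is_derive x 1 (fun u => f u * g u) (a * g x + f x * b).
Proof.
move=> fa gb; apply: (is_derive_eq (is_deriveM fa gb)).
by rewrite addrC /GRing.scale /= (mulrC a).
Qed.

Lemma HDid x : is_derive x 1 (fun u : K => u) 1.
Proof. exact: is_derive_id. Qed.

Lemma HDc (c : K) x : is_derive x 1 (fun=> c) 0.
Proof. exact: is_derive_cst. Qed.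

Lemma HDZ (c : K) f x a : is_derive x 1 f a -> is_derive x 1 (fun u => c * f u) (c * a).
Proof. by move=> fa; apply: is_derive_eq (HDM (HDc c x) fa) _; rewrite mul0r add0r. Qed.

Lemma HDV f x a : f x != 0 -> is_derive x 1 f a ->
  is_derive x 1 (fun u => (f u)^-1) (- a / f x ^+ 2).
Proof.
move=> fx0 [df fa]; apply: DeriveDef; first exact: derivableV.
by rewrite deriveV// fa /GRing.scale /= mulrC mulNr mulrN.
Qed.

Lemma HDX f n x a : is_derive x 1 f a ->
  is_derive x 1 (fun u => f u ^+ n) (n%:R * f x ^+ n.-1 * a).
Proof.
move=> fa; elim: n => [|n IH].
  by apply: is_derive_eq (HDc _ _) _; rewrite !mul0r.
under eq_fun do rewrite exprS.
apply: is_derive_eq (HDM fa IH) _; rewrite /= -[n.+1%:R]natr1.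
by case: n {IH} => [|n]; rewrite ?exprS /=; ring.
Qed.

(* Carathéodory's form of differentiability. *)
Lemma HDP f x a :
  is_derive x 1 f a <->
  exists k : K -> K, [/\ forall u, f u - f x = (u - x) * k u, k x = a & {for x, continuous k}].
Proof.
split=> [[df fa]|[k [fk <- ck]]].
  exists (fun u => if u == x then a else (f u - f x) / (u - x)); split.
  - move=> u; case: eqP => [->|/eqP ux]; first by rewrite !subrr mul0r.
    by rewrite mulrC divfK// subr_eq0.
  - by rewrite eqxx.
  have : h^-1 *: (f (h *: (1:K) + x) - f x) @[h --> 0^'] --> a.
    by rewrite -fa; exact: df.
  move=> /cvgrPdistC_lt H; apply/(@cvgrPdistC_lt _ _ _ _ (nbhs_filter x)) => e e0; rewrite eqxx.
  have /nbhs_normP[d d0 Hd] := H _ e0; apply/nbhs_normP; exists d => // u /= ud.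
  case: eqP => [_|/eqP ux]; first by rewrite subrr normr0.
  have := Hd (u - x); rewrite /= sub0r normrN distrC subr_eq0 => /(_ ud ux).
  by rewrite /GRing.scale /= mulr1 subrK mulrC.
have H : h^-1 *: (f (h *: (1:K) + x) - f x) @[h --> 0^'] --> k x.
  apply/cvgrPdistC_lt => e e0.
  move/cvgrPdistC_lt : ck => /(_ _ e0)/nbhs_normP[d d0 Hd].
  apply/nbhs_normP; exists d => // u /=; rewrite sub0r normrN => ud u0.
  rewrite fk /GRing.scale /= mulr1 addrK mulKf//.
  by apply: Hd => /=; rewrite opprD addrCA subrr addr0 normrN.
by split; [apply/cvg_ex; exists (k x) | apply/cvg_lim].
Qed.

Lemma HDcont f x a : is_derive x 1 f a -> {for x, continuous f}.
Proof. by case=> /derivable1_diffP/differentiable_continuous. Qed.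

Lemma HDcomp f g x a b : is_derive (g x) 1 f a -> is_derive x 1 g b ->
  is_derive x 1 (fun u => f (g u)) (a * b).
Proof.
move=> /HDP[k [fk <- ck]] gb; have cg := HDcont gb.
move/HDP : gb => [l [gl <- cl]]; apply/HDP.
exists (fun u => k (g u) * l u); split; [|by []|].
  by move=> u; rewrite fk gl -mulrA (mulrC (l u)).
have kg : {for x, continuous (k \o g)} by apply: continuous_comp.
exact: (cvgM kg cl).
Qed.

Lemma HD_near f g x a : (\forall u \near x, f u = g u) ->
  is_derive x 1 f a -> is_derive x 1 g a.
Proof. by move=> fg; apply: near_eq_is_derive => //; exact: oner_neq0. Qed.

Lemma HD_eq f x a b : is_derive x 1 f a -> a = b -> is_derive x 1 f b.
Proof. exact: is_derive_eq. Qed.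

Lemma HDder f x : derivable f x 1 -> is_derive x 1 f (derive1 f x).
Proof. by move=> df; apply: DeriveDef => //; rewrite derive1E. Qed.

Lemma HD1 f x a : is_derive x 1 f a -> derive1 f x = a.
Proof. by move=> [_ <-]; rewrite derive1E. Qed.

Lemma HDd f x a : is_derive x 1 f a -> derivable f x 1.
Proof. by case. Qed.

End HasDerivative.

(* The same rules with [R[i]] in place of [K], so that no canonical structure on
   [R[i]] has to be inferred when they are applied. *)
Section ComplexDerivative.
Variable R : realType.
Local Notation C := R[i].
Implicit Types (f g : C -> C) (x a b : C).

Lemma cHDD f g x a b : is_derive x 1 f a -> is_derive x 1 g b ->
  is_derive x 1 (fun u => f u + g u) (a + b).
Proof. exact: HDD. Qed.

Lemma cHDB f g x a b : is_derive x 1 f a -> is_derive x 1 g b ->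
  is_derive x 1 (fun u => f u - g u) (a - b).
Proof. exact: HDB. Qed.

Lemma cHDN f x a : is_derive x 1 f a -> is_derive x 1 (fun u => - f u) (- a).
Proof. exact: HDN. Qed.

Lemma cHDM f g x a b : is_derive x 1 f a -> is_derive x 1 g b ->
  is_derive x 1 (fun u => f u * g u) (a * g x + f x * b).
Proof. exact: HDM. Qed.

Lemma cHDid x : is_derive x 1 (fun u : C => u) 1.
Proof. exact: HDid. Qed.

Lemma cHDc (c : C) x : is_derive x 1 (fun=> c) 0.
Proof. exact: HDc. Qed.

Lemma cHDZ (c : C) f x a : is_derive x 1 f a -> is_derive x 1 (fun u => c * f u) (c * a).
Proof. exact: HDZ. Qed.

Lemma cHDV f x a : f x != 0 -> is_derive x 1 f a ->
  is_derive x 1 (fun u => (f u)^-1) (- a / f x ^+ 2).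
Proof. exact: HDV. Qed.

Lemma cHDX f n x a : is_derive x 1 f a ->
  is_derive x 1 (fun u => f u ^+ n) (n%:R * f x ^+ n.-1 * a).
Proof. exact: HDX. Qed.

Lemma cHDP f x a :
  is_derive x 1 f a <->
  exists k : C -> C, [/\ forall u, f u - f x = (u - x) * k u, k x = a & {for x, continuous k}].
Proof. exact: HDP. Qed.

Lemma cHDcont f x a : is_derive x 1 f a -> {for x, continuous f}.
Proof. exact: HDcont. Qed.

Lemma cHDcomp f g x a b : is_derive (g x) 1 f a -> is_derive x 1 g b ->
  is_derive x 1 (fun u => f (g u)) (a * b).
Proof. exact: HDcomp. Qed.

Lemma cHD_near f g x a : (\forall u \near x, f u = g u) ->
  is_derive x 1 f a -> is_derive x 1 g a.
Proof. exact: HD_near. Qed.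

Lemma cHD_eq f x a b : is_derive x 1 f a -> a = b -> is_derive x 1 f b.
Proof. exact: HD_eq. Qed.

Lemma cHDder f x : derivable f x 1 -> is_derive x 1 f (derive1 f x).
Proof. exact: HDder. Qed.

Lemma cHD1 f x a : is_derive x 1 f a -> derive1 f x = a.
Proof. exact: HD1. Qed.

Lemma cHDd f x a : is_derive x 1 f a -> derivable f x 1.
Proof. exact: HDd. Qed.

End ComplexDerivative.

(** * The modulus with real values, and differentiable paths in the complex plane *)

Section ComplexNorm.
Variable R : realType.
Local Notation C := R[i].
Local Notation Re := (@complex.Re R).
Local Notation Im := (@complex.Im R).

(** The norm of [R[i]] has its values in [R[i]]; here they are taken in [R], where the order is
    total and [lra] applies. *)
Definition nm (z : C) : R := Num.sqrt (Re z ^+ 2 + Im z ^+ 2).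

Lemma nmE (z : C) : `|z| = (nm z)%:C.
Proof. exact: normc_def. Qed.

Lemma nm_ge0 z : 0 <= nm z. Proof. exact: sqrtr_ge0. Qed.

Lemma nm2 z : nm z ^+ 2 = Re z ^+ 2 + Im z ^+ 2.
Proof. by rewrite sqr_sqrtr// addr_ge0// sqr_ge0. Qed.

Lemma nmM z w : nm (z * w) = nm z * nm w.
Proof. by apply: complexI; rewrite rmorphM/= -!nmE normrM. Qed.

Lemma nmD z w : nm (z + w) <= nm z + nm w.
Proof. by rewrite -lecR rmorphD/= -!nmE ler_normD. Qed.

Lemma nmN z : nm (- z) = nm z.
Proof. by apply: complexI; rewrite -!nmE normrN. Qed.

Lemma nmB z w : nm (z - w) <= nm z + nm w.
Proof. by rewrite -(nmN w) nmD. Qed.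

Lemma nm_sym z w : nm (z - w) = nm (w - z).
Proof. by rewrite -nmN opprB. Qed.

Lemma nmV z : nm z^-1 = (nm z)^-1.
Proof. by apply: complexI; rewrite fmorphV/= -!nmE normfV. Qed.

Lemma nmX z n : nm (z ^+ n) = nm z ^+ n.
Proof. by apply: complexI; rewrite rmorphXn/= -!nmE normrX. Qed.

Lemma nm0 : nm 0 = 0.
Proof. by apply: complexI; rewrite -nmE normr0. Qed.

Lemma nm1 : nm 1 = 1.
Proof. by apply: complexI; rewrite -nmE normr1. Qed.

Lemma nm_eq0 z : (nm z == 0) = (z == 0).
Proof.
by rewrite -[RHS]normr_eq0 nmE -(inj_eq (@complexI R)).
Qed.

Lemma nm_gt0 z : (0 < nm z) = (z != 0).
Proof. by rewrite lt_def nm_eq0 nm_ge0 andbT. Qed.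

Lemma nmR (x : R) : nm x%:C = `|x|.
Proof. by rewrite /nm /= expr0n/= addr0 sqrtr_sqr. Qed.

Lemma nm_Re z : `|Re z| <= nm z.
Proof. by rewrite -sqrtr_sqr ler_wsqrtr// lerDl sqr_ge0. Qed.

Lemma nm_Im z : `|Im z| <= nm z.
Proof. by rewrite -sqrtr_sqr ler_wsqrtr// lerDr sqr_ge0. Qed.

Lemma nm_le z : nm z <= `|Re z| + `|Im z|.
Proof.
rewrite {1}(complexE z) (le_trans (nmD _ _))// nmM !nmR lerD2l.
by rewrite {1}/nm /= expr0n add0r expr1n sqrtr1 mul1r.
Qed.

Lemma nmJ (z : C) : nm z^*%C = nm z.
Proof. by case: z => x y; rewrite /nm /= sqrrN. Qed.

Lemma ReD (z w : C) : Re (z + w) = Re z + Re w. Proof. by case: z; case: w. Qed.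
Lemma ImD (z w : C) : Im (z + w) = Im z + Im w. Proof. by case: z; case: w. Qed.
Lemma ReN (z : C) : Re (- z) = - Re z. Proof. by case: z. Qed.
Lemma ImN (z : C) : Im (- z) = - Im z. Proof. by case: z. Qed.
Lemma ReB (z w : C) : Re (z - w) = Re z - Re w. Proof. by rewrite ReD ReN. Qed.
Lemma ImB (z w : C) : Im (z - w) = Im z - Im w. Proof. by rewrite ImD ImN. Qed.
Lemma ReM (z w : C) : Re (z * w) = Re z * Re w - Im z * Im w.
Proof. by case: z; case: w. Qed.
Lemma ImM (z w : C) : Im (z * w) = Re z * Im w + Im z * Re w.
Proof. by case: z => a b; case: w => c d /=; rewrite (mulrC b) addrC addrC. Qed.
Lemma complexRI (z : C) : z = Re z +i* Im z. Proof. by case: z. Qed.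

(** Radii of balls in [R[i]] are themselves elements of [R[i]], but a positive one is real, so real
    radii suffice. *)
Lemma nearCP (z : C) (P : C -> Prop) :
  (\forall u \near z, P u) <-> exists2 e : R, 0 < e & forall u, nm (u - z) < e -> P u.
Proof.
split=> [/nbhs_normP[e /= e0 eP]|[e e0 eP]].
  move: e0; rewrite ltcE /= => /andP[/eqP e1 e0]; exists (Re e) => // u ue.
  apply: eP; rewrite /ball_ /= distrC nmE ltcE /= e1 eqxx /=.
  by rewrite /nm /=.
apply/nbhs_normP; exists e%:C => /=; first by rewrite ltcR.
by move=> u; rewrite /ball_ /= distrC nmE ltcR; exact: eP.
Qed.

Lemma near'CP (z : C) (P : C -> Prop) :
  (\forall u \near z^', P u) <->
  exists2 e : R, 0 < e & forall u, u != z -> nm (u - z) < e -> P u.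
Proof.
rewrite /dnbhs; split=> [/nearCP[e e0 eP]|[e e0 eP]].
  by exists e => // u uz /eP; exact.
by apply/nearCP; exists e => // u ue uz; exact: eP.
Qed.

Section Limits.
Context {T : Type} {F : set_system T} {FF : Filter F}.

Lemma cvgC_P (f : T -> C) (l : C) :
  f x @[x --> F] --> l <-> forall e : R, 0 < e -> \forall x \near F, nm (f x - l) < e.
Proof.
rewrite cvgrPdist_lt; split=> H e.
  move=> e0; have := H e%:C; rewrite ltcR => /(_ e0).
  by apply: filterS => x; rewrite distrC nmE ltcR.
rewrite ltcE /= => /andP[/eqP e1 e0]; have := H _ e0.
by apply: filterS => x; rewrite distrC nmE ltcE /= e1 eqxx.
Qed.

Lemma cvg_Re (f : T -> C) l : f x @[x --> F] --> l -> Re (f x) @[x --> F] --> Re l.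
Proof.
move=> /cvgC_P H; apply/cvgrPdistC_lt => e /H; apply: filterS => x.
by apply: le_lt_trans; rewrite -ReB nm_Re.
Qed.

Lemma cvg_Im (f : T -> C) l : f x @[x --> F] --> l -> Im (f x) @[x --> F] --> Im l.
Proof.
move=> /cvgC_P H; apply/cvgrPdistC_lt => e /H; apply: filterS => x.
by apply: le_lt_trans; rewrite -ImB nm_Im.
Qed.

Lemma cvg_ReIm (f : T -> C) l : Re (f x) @[x --> F] --> Re l ->
  Im (f x) @[x --> F] --> Im l -> f x @[x --> F] --> l.
Proof.
move=> /cvgrPdistC_lt H1 /cvgrPdistC_lt H2; apply/cvgC_P => e e0.
near=> x; rewrite (le_lt_trans (nm_le _))// ReB ImB (splitr e) ltrD//.
  by near: x; apply: H1; rewrite divr_gt0.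
by near: x; apply: H2; rewrite divr_gt0.
Unshelve. all: by end_near. Qed.
End Limits.

Lemma contC_P (f : C -> C) (x : C) :
  {for x, continuous f} <->
  forall e : R, 0 < e -> exists2 d : R, 0 < d & forall u, nm (u - x) < d -> nm (f u - f x) < e.
Proof.
split=> [/(cvgC_P (FF := nbhs_filter x)) H e /H /nearCP//|H].
by apply/(cvgC_P (FF := nbhs_filter x)) => e /H ?; apply/nearCP.
Qed.

(** The derivative of a path is taken by components because [R[i]] is regarded as a normed space
    over itself and not over [R]. *)
Definition CD (g : R -> C) (t : R) (d : C) :=
  is_derive t 1 (fun s => Re (g s)) (Re d) /\ is_derive t 1 (fun s => Im (g s)) (Im d).

Lemma CDP (g : R -> C) (t : R) (d : C) :
  CD g t d <->
  exists k : R -> C, [/\ forall u, g u - g t = (u - t)%:C * k u, k t = d & {for t, continuous k}].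
Proof.
split.
  move=> [/HDP[k1 [g1 e1 c1]] /HDP[k2 [g2 e2 c2]]].
  exists (fun u => k1 u +i* k2 u); split.
  - move=> u; apply/eqP; rewrite eq_complex ReB ImB g1 g2 /=.
    by rewrite !mul0r subr0 addr0 !eqxx.
  - by rewrite e1 e2 -complexRI.
  - by apply: cvg_ReIm.
move=> [k [gk <- ck]]; split; apply/HDP.
  exists (Re \o k); split => //=; last exact: cvg_Re.
  by move=> u; rewrite -ReB gk ReM /= mul0r subr0.
exists (Im \o k); split => //=; last exact: cvg_Im.
by move=> u; rewrite -ImB gk ImM /= mul0r addr0.
Qed.

Lemma CDcont g t d : CD g t d -> {for t, continuous g}.
Proof. by move=> [g1 g2]; apply: cvg_ReIm; [apply: HDcont g1 | apply: HDcont g2]. Qed.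

Lemma CDcomp (h : C -> C) (g : R -> C) t a d :
  is_derive (g t) 1 h a -> CD g t d -> CD (fun s => h (g s)) t (a * d).
Proof.
move=> /HDP[k [hk <- ck]] gd; have cg := CDcont gd.
move/CDP : gd => [l [gl <- cl]]; apply/CDP.
exists (fun u => k (g u) * l u); split; [|by []|].
  by move=> u; rewrite hk gl -mulrA (mulrC (l u)).
have kg : {for t, continuous (k \o g)} := @continuous_comp _ _ _ g k t cg ck.
exact: (cvgM kg cl).
Qed.

Lemma CD_eq g t d d' : CD g t d -> d = d' -> CD g t d'.
Proof. by move=> ? <-. Qed.

Lemma CDline (a v : C) t : CD (fun s => a + s%:C * v) t v.
Proof.
apply/CDP; exists (fun=> v); split => //; last exact: cvg_cst.
by move=> u; rewrite rmorphB /=; ring.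
Qed.

Lemma CD_near g g' t d : (\forall u \near t, g u = g' u) -> CD g t d -> CD g' t d.
Proof.
by move=> gg' [g1 g2]; split; [apply: HD_near g1 | apply: HD_near g2];
  apply: filterS gg' => u ->.
Qed.

Lemma CDD f g t a b : CD f t a -> CD g t b -> CD (fun s => f s + g s) t (a + b).
Proof.
move=> [f1 f2] [g1 g2]; split; rewrite ?ReD ?ImD.
  by under eq_fun do rewrite ReD; exact: HDD.
by under eq_fun do rewrite ImD; exact: HDD.
Qed.

Lemma CDJ f t a : CD f t a -> CD (fun s => (f s)^*%C) t (a^*%C).
Proof.
have RJ (z : C) : Re z^*%C = Re z by case: z.
have IJ (z : C) : Im z^*%C = - Im z by case: z.
move=> [f1 f2]; split; rewrite ?RJ ?IJ.
  by under eq_fun do rewrite RJ.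
by under eq_fun do rewrite IJ; exact: HDN.
Qed.

Lemma CDM f g t a b : CD f t a -> CD g t b ->
  CD (fun s => f s * g s) t (a * g t + f t * b).
Proof.
move=> fa gb; have cg := CDcont gb.
move/CDP : fa => [k [fk <- ck]]; move/CDP : gb => [l [gl <- cl]]; apply/CDP.
exists (fun u => k u * g u + f t * l u); split; [|by []|].
  move=> u.
  have -> : f u = (u - t)%:C * k u + f t by rewrite -fk subrK.
  have -> : g u = (u - t)%:C * l u + g t by rewrite -gl subrK.
  by ring.
exact: (cvgD (cvgM ck cg) (cvgM (cvg_cst (f t)) cl)).
Qed.

(** The real mean value theorem is applied to the real and the imaginary part separately, whence the
    factor 2. It recurs in all later estimates, where sharp constants do not matter. *)
Lemma CD_bound (g dg : R -> C) (M : R) :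
  (forall t, 0 <= t <= 1 -> CD g t (dg t)) ->
  (forall t, 0 <= t <= 1 -> nm (dg t) <= M) -> nm (g 1 - g 0) <= 2 * M.
Proof.
move=> gd gM.
have MV (p : C -> R) (dp := fun t => p (dg t)) :
    (forall t : R, 0 <= t <= 1 -> is_derive t 1 (fun s => p (g s)) (dp t)) ->
    (forall z, `|p z| <= nm z) -> `|p (g 1) - p (g 0)| <= M.
  move=> pd pz.
  have [||x x01 ->] := @MVT _ (fun s => p (g s)) dp 0 1 ltr01.
  - move=> x; rewrite in_itv /= => /andP[x0 x1]; apply: pd.
    by rewrite !ltW.
  - apply: continuous_in_subspaceT => x; rewrite inE /= in_itv /= => x01.
    exact: HDcont (pd _ x01).
  move: x01; rewrite in_itv /= => /andP[x0 x1].
  by rewrite subr0 mulr1 (le_trans (pz _))// gM// !ltW.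
rewrite (le_trans (nm_le _))// ReB ImB mulr_natl mulr2n lerD//.
  by apply: MV => [t /gd[]//|]; exact: nm_Re.
by apply: MV => [t /gd[]//|]; exact: nm_Im.
Qed.

Lemma holo_bound (f : C -> C) (df : C -> C) (a b : C) (M : R) :
  (forall t : R, 0 <= t <= 1 -> is_derive (a + t%:C * (b - a)) 1 f (df (a + t%:C * (b - a)))) ->
  (forall t : R, 0 <= t <= 1 -> nm (df (a + t%:C * (b - a))) <= M) ->
  nm (f b - f a) <= 2 * (M * nm (b - a)).
Proof.
move=> fd fM.
have := @CD_bound (fun t => f (a + t%:C * (b - a))) (fun t => df (a + t%:C * (b - a)) * (b - a))
  (M * nm (b - a)).
rewrite mul0r addr0 mul1r addrCA subrr addr0; apply.
  by move=> t /fd ft; apply: (CDcomp ft); exact: CDline.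
by move=> t /fM ft; rewrite nmM ler_wpM2r// nm_ge0.
Qed.

Lemma holo_const (f : C -> C) : (forall z : C, is_derive z 1 f 0) -> forall z w, f z = f w.
Proof.
move=> fd z w; apply/eqP; rewrite -subr_eq0 -nm_eq0.
have := @holo_bound f (fun=> 0) w z 0.
rewrite mul0r mulr0 => H; rewrite eq_le nm_ge0 andbT; apply: H => t _ //.
by rewrite nm0.
Qed.

Lemma CDaff (P : R -> C) (c0 c1 s : R) d :
  CD P (c0 + c1 * s) d -> CD (fun u => P (c0 + c1 * u)) s (c1%:C * d).
Proof.
have H : is_derive s 1 (fun u => c0 + c1 * u) c1.
  by apply: is_derive_eq (HDD (HDc c0 s) (HDZ c1 (HDid s))) _; rewrite add0r mulr1.
move=> [P1 P2]; split.
  by have D1 := HDcomp (f := fun u => Re (P u)) (g := fun u => c0 + c1 * u) P1 H; apply: (HD_eq D1); rewrite ReM /= mul0r subr0 mulrC.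
by have D2 := HDcomp (f := fun u => Im (P u)) (g := fun u => c0 + c1 * u) P2 H; apply: (HD_eq D2); rewrite ImM /= mul0r addr0 mulrC.
Qed.

Lemma cauchy_cvgC {T : Type} {F : set_system T} {FF : ProperFilter F} (f : T -> C) :
  (forall e : R, 0 < e -> exists l : C, \forall x \near F, nm (f x - l) < e) ->
  exists l : C, f x @[x --> F] --> l.
Proof.
move=> H.
have cR : cvg (Re (f x) @[x --> F]).
  apply: cauchy_cvg; apply/cauchy_exP => e /= e0.
  have [l Hl] := H _ e0; exists (Re l); apply: filterS Hl => x.
  by rewrite /ball /= distrC -ReB; apply: le_lt_trans (nm_Re _).
have cI : cvg (Im (f x) @[x --> F]).
  apply: cauchy_cvg; apply/cauchy_exP => e /= e0.
  have [l Hl] := H _ e0; exists (Im l); apply: filterS Hl => x.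
  by rewrite /ball /= distrC -ImB; apply: le_lt_trans (nm_Im _).
by exists (lim (Re (f x) @[x --> F]) +i* lim (Im (f x) @[x --> F])); exact: cvg_ReIm.
Qed.
End ComplexNorm.

(** * Cauchy's theorem *)

Section Segments.
Variable R : realType.
Local Notation C := R[i].
Local Notation Re := (@complex.Re R).
Local Notation Im := (@complex.Im R).

Lemma real_primitive (f : R -> R) (b : R) : 0 <= b ->
  (forall t : R, 0 <= t <= b -> {for t, continuous f}) ->
  exists P : R -> R, forall t : R, 0 <= t <= b -> is_derive t 1 P (f t).
Proof.
(* [cl] retracts the line onto [[0, b]]. Then [f \o cl] is continuous everywhere, and its integral
   from -1 has a two-sided derivative also at the ends 0 and [b]. *)
move=> b0 fc; pose cl (t : R) := (`|t| + b - `|t - b|) / 2.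
have cl01 t : 0 <= cl t <= b.
  by rewrite /cl; case: (ger0P t) => t0; case: (ger0P (t - b)) => t1; lra.
have clE t : 0 <= t <= b -> cl t = t.
  by move=> /andP[t0 t1]; rewrite /cl ger0_norm// ler0_norm ?subr_le0//; field.
have clc : continuous cl.
  move=> t; apply: cvgMl; apply: cvgB.
    by apply: cvgD; [exact: norm_continuous | exact: cvg_cst].
  by apply: cvg_norm; apply: cvgB; [exact: cvg_id | exact: cvg_cst].
pose h := f \o cl.
have hc : continuous h by move=> t; apply: continuous_comp; [exact: clc | exact: fc].
have ih : lebesgue_measure.-integrable `[(-1 : R), b + 1] (EFin \o h).
  apply: continuous_compact_integrable; first exact: segment_compact.
  exact: continuous_subspaceT.
exists (fun x => (\int[lebesgue_measure]_(t in [set` `[(-1 : R), x]]) (h t))%R) => t t01.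
have /andP[t0 t1] := t01.
have t2 : t < b + 1 by rewrite (le_lt_trans t1)// ltrDl.
have tm : -1 < t by rewrite (lt_le_trans _ t0)// ltrN10.
have [d1 d2] := continuous_FTC1_closed t2 ih tm (hc t).
apply: DeriveDef => //.
by rewrite -derive1E d2 /h /= clE.
Qed.

Lemma complex_primitive (f : R -> C) :
  (forall t : R, 0 <= t <= 1 -> {for t, continuous f}) ->
  exists P : R -> C, forall t : R, 0 <= t <= 1 -> CD P t (f t).
Proof.
move=> fc.
have [P1 H1] : exists P : R -> R, forall t : R, 0 <= t <= 1 -> is_derive t 1 P (Re (f t)).
  by apply: real_primitive => // t /fc; exact: cvg_Re.
have [P2 H2] : exists P : R -> R, forall t : R, 0 <= t <= 1 -> is_derive t 1 P (Im (f t)).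
  by apply: real_primitive => // t /fc; exact: cvg_Im.
by exists (fun t => P1 t +i* P2 t) => t t01; split; [exact: H1 | exact: H2].
Qed.

Definition seg (a b : C) (t : R) : C := a + t%:C * (b - a).

(** The integral along a segment is the increment of a primitive of the pulled back form. Reversal,
    bisection and translation of segments then only require the chain rule for an affine change of
    parameter. *)
Definition is_segint (f : C -> C) (a b v : C) := exists2 P : R -> C,
  forall t : R, 0 <= t <= 1 -> CD P t (f (seg a b t) * (b - a)) & P 1 - P 0 = v.

Definition segint (f : C -> C) (a b : C) : C := xget 0 [set v | is_segint f a b v].

Lemma seg0 a b : seg a b 0 = a. Proof. by rewrite /seg mul0r addr0. Qed.
Lemma seg1 a b : seg a b 1 = b. Proof. by rewrite /seg mul1r addrC subrK. Qed.

Lemma nm_seg a b t : 0 <= t <= 1 -> nm (seg a b t - a) <= nm (b - a).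
Proof.
move=> /andP[t0 t1]; rewrite /seg addrC addKr nmM nmR ger0_norm//.
by rewrite ler_piMl// nm_ge0.
Qed.

Lemma segc a b t : {for t, continuous (seg a b)}.
Proof. exact: CDcont (CDline a (b - a) t). Qed.

Lemma segint_ex (f : C -> C) a b :
  (forall t : R, 0 <= t <= 1 -> {for seg a b t, continuous f}) ->
  is_segint f a b (segint f a b).
Proof.
move=> fc; rewrite /segint; case: xgetP => [v -> //|/= H].
have [|P PP] := @complex_primitive (fun t => f (seg a b t) * (b - a)).
  move=> t /fc ft; apply: (@cvgM _ _ _ _ (fun t => f (seg a b t)) (fun=> b - a)).
    exact: (@continuous_comp _ _ _ (seg a b) f t (@segc a b t) ft).
  exact: cvg_cst.
by case: (H (P 1 - P 0)); exists P.
Qed.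

(* The integral of the affine function [c0 + c1 (z - p)] is explicit. *)
Lemma segint_bound (f : C -> C) (a b v c0 c1 p : C) (M : R) :
  is_segint f a b v ->
  (forall t : R, 0 <= t <= 1 -> nm (f (seg a b t) - (c0 + c1 * (seg a b t - p))) <= M) ->
  nm (v - (c0 * (b - a) + c1 / 2 * ((b - p) ^+ 2 - (a - p) ^+ 2))) <= 2 * (M * nm (b - a)).
Proof.
move=> [P PP <-] fM.
pose L z := c0 * z + c1 / 2 * (z - p) ^+ 2.
have dL (z : C) : is_derive z 1 L (c0 + c1 * (z - p)).
  have := cHDD (cHDZ c0 (cHDid z)) (cHDZ (c1 / 2) (cHDX 2 (cHDB (cHDid z) (cHDc p z)))).
  by move/is_derive_eq; apply; rewrite /= expr1; field.
have := @CD_bound R (fun t => P t + - L (seg a b t))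
  (fun t => f (seg a b t) * (b - a) + - ((c0 + c1 * (seg a b t - p)) * (b - a))) (M * nm (b - a)).
rewrite seg0 seg1 (_ : P 1 - L b - _ = P 1 - P 0 - (c0 * (b - a) + c1 / 2 * ((b - p) ^+ 2 - (a - p) ^+ 2))).
  apply.
    move=> t t01; apply: CDD; first exact: PP.
    have := CDcomp (cHDN (dL (seg a b t))) (CDline a (b - a) t).
    by rewrite mulNr.
  by move=> t t01; rewrite -mulrBl nmM ler_wpM2r ?nm_ge0// fM.
by rewrite /L; ring.
Qed.

Lemma segint_uniq (f : C -> C) a b v w : is_segint f a b v -> is_segint f a b w -> v = w.
Proof.
move=> [P PP <-] [Q QQ <-]; apply/eqP; rewrite -subr_eq0 -nm_eq0 eq_le nm_ge0 andbT.
have := @CD_bound R (fun t => P t + - Q t) (fun=> 0) 0; rewrite mulr0.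
rewrite (_ : P 1 - Q 1 - _ = P 1 - P 0 - (Q 1 - Q 0)); last by ring.
apply => t t01; last by rewrite nm0.
rewrite -(subrr (f (seg a b t) * (b - a))); apply: CDD; first exact: PP.
have [Q1 Q2] := QQ t t01; split; rewrite ?ReN ?ImN.
  by under eq_fun do rewrite ReN; exact: HDN.
by under eq_fun do rewrite ImN; exact: HDN.
Qed.

Lemma segintE (f : C -> C) a b v : is_segint f a b v -> segint f a b = v.
Proof.
move=> H; apply: (segint_uniq _ H); rewrite /segint.
by case: xgetP => [w -> //|/= /(_ v) []].
Qed.

Lemma is_segint_rev (f : C -> C) a b v : is_segint f a b v -> is_segint f b a (- v).
Proof.
move=> [P PP <-]; exists (fun t => P (1 + (-1) * t)); last first.
  by rewrite mulr0 mulr1 subrr addr0 opprB.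
move=> t /andP[t0 t1].
have t01 : 0 <= 1 + -1 * t <= 1 by rewrite mulN1r subr_ge0 t1 gerBl.
apply: (CD_eq (CDaff (PP _ t01))).
rewrite (_ : seg a b _ = seg b a t); last by rewrite /seg mulN1r rmorphB /= rmorph1; ring.
by rewrite rmorphN1; ring.
Qed.

Lemma is_segint_mid (f : C -> C) a b v (m := (a + b) / 2) : is_segint f a b v ->
  exists v1 v2, [/\ is_segint f a m v1, is_segint f m b v2 & v = v1 + v2].
Proof.
move=> [P PP <-]; exists (P (2^-1) - P 0), (P 1 - P (2^-1)); split; last by ring.
  exists (fun t => P (0 + 2^-1 * t)); last by rewrite mulr0 mulr1 !add0r.
  move=> t /andP[t0 t1].
  have t01 : 0 <= 0 + 2^-1 * t <= 1 by lra.
  apply: (CD_eq (CDaff (PP _ t01))).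
  rewrite (_ : seg a b _ = seg a m t); first by rewrite /m fmorphV /= rmorph_nat; field.
  by rewrite /seg /m add0r rmorphM fmorphV /= rmorph_nat; field.
exists (fun t => P (2^-1 + 2^-1 * t)); last first.
  by rewrite mulr0 mulr1 addr0 (_ : 2^-1 + 2^-1 = 1 :> R) //; field.
move=> t /andP[t0 t1].
have t01 : 0 <= 2^-1 + 2^-1 * t <= 1 by lra.
apply: (CD_eq (CDaff (PP _ t01))).
rewrite (_ : seg a b _ = seg m b t); first by rewrite /m fmorphV /= rmorph_nat; field.
by rewrite /seg /m rmorphD rmorphM fmorphV /= rmorph_nat; field.
Qed.

Lemma is_segint_shift (f : C -> C) w a b v : (forall z, f (z + w) = f z) ->
  is_segint f a b v -> is_segint f (a + w) (b + w) v.
Proof.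
move=> fw [P PP <-]; exists P => // t t01.
rewrite (_ : seg _ _ t = seg a b t + w) ?fw; last by rewrite /seg; ring.
by apply: (CD_eq (PP _ t01)); ring.
Qed.

End Segments.

(** * Goursat's lemma for triangles in a closed convex set *)

Section Goursat.
Variable R : realType.
Local Notation C := R[i].
Variables (D : set C) (f : C -> C).
Hypothesis Dconv : forall a b (t : R), D a -> D b -> 0 <= t <= 1 -> D (seg a b t).
Hypothesis Dclosed : forall p, (forall e : R, 0 < e -> exists2 z, D z & nm (z - p) < e) -> D p.
Hypothesis fD : forall z : C, D z -> derivable f z 1.

Let fc z : D z -> {for z, continuous f}.
Proof. by move=> /fD /cHDder; exact: cHDcont. Qed.

Lemma segintP a b : D a -> D b -> is_segint f a b (segint f a b).
Proof. by move=> Da Db; apply: segint_ex => t t01; apply: fc; exact: Dconv. Qed.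

Let mid (a b : C) := (a + b) / 2.

Let Dmid a b : D a -> D b -> D (mid a b).
Proof.
move=> Da Db; rewrite (_ : mid a b = seg a b (2^-1)); first by apply: Dconv => //; lra.
by rewrite /mid /seg fmorphV /= rmorph_nat; field.
Qed.

Let segint_mid a b : D a -> D b ->
  segint f a b = segint f a (mid a b) + segint f (mid a b) b.
Proof.
move=> Da Db; have [v1 [v2 [H1 H2 ->]]] := is_segint_mid (segintP Da Db).
by rewrite (segintE H1) (segintE H2).
Qed.

Lemma segint_rev a b : D a -> D b -> segint f b a = - segint f a b.
Proof. by move=> Da Db; apply/segintE/is_segint_rev/segintP. Qed.

Let tri (t : C * C * C) : C :=
  segint f t.1.1 t.1.2 + segint f t.1.2 t.2 + segint f t.2 t.1.1.

Let inD (t : C * C * C) := [/\ D t.1.1, D t.1.2 & D t.2].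

Let per (t : C * C * C) : R := nm (t.1.2 - t.1.1) + nm (t.2 - t.1.2) + nm (t.1.1 - t.2).

(** [t'] stands for one of the four triangles cut out by the midpoints, one that carries at least a
    quarter of the integral. The bound on the displacement of the first vertex makes the successive
    first vertices a Cauchy sequence. *)
Let child (t t' : C * C * C) :=
  [/\ inD t', per t' = per t / 2, nm (t'.1.1 - t.1.1) <= per t & nm (tri t) <= 4 * nm (tri t')].

Let half (z : C) : nm (z / 2) = nm z / 2.
Proof. by rewrite nmM nmV -(rmorph_nat (real_complex R) 2) nmR ger0_norm. Qed.

Let child_ex t : inD t -> exists t', child t t'.
Proof.
case: t => [[a b] c] [/= Da Db Dc].
have [[Dx Dy] Dz] := (Dmid Da Db, Dmid Db Dc, Dmid Da Dc).
set x := mid a b in Dx *; set y := mid b c in Dy *; set z := mid a c in Dz *.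
(* The inner edges are traversed once in each direction and cancel. *)
have E : tri (a, b, c) = tri (a, x, z) + tri (x, b, y) + tri (z, y, c) + tri (y, z, x).
  rewrite /tri /= (segint_mid Da Db) (segint_mid Db Dc) (segint_rev Da Dc) (segint_mid Da Dc).
  rewrite -/x -/y -/z (segint_rev Dx Dz) (segint_rev Dx Dy) (segint_rev Dy Dz).
  by rewrite (segint_rev Da Dz) (segint_rev Dz Dc); ring.
have h2 (u v : C) : u = v / 2 -> nm u = nm v / 2 by move=> ->; rewrite half.
have [] : [\/ nm (tri (a, b, c)) <= 4 * nm (tri (a, x, z)),
             nm (tri (a, b, c)) <= 4 * nm (tri (x, b, y)),
             nm (tri (a, b, c)) <= 4 * nm (tri (z, y, c)) |
             nm (tri (a, b, c)) <= 4 * nm (tri (y, z, x))].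
  have := nmD (tri (a, x, z) + tri (x, b, y) + tri (z, y, c)) (tri (y, z, x)).
  have := nmD (tri (a, x, z) + tri (x, b, y)) (tri (z, y, c)).
  have := nmD (tri (a, x, z)) (tri (x, b, y)).
  rewrite -E => h1 h3 h4.
  case: (lerP (nm (tri (a, b, c))) (4 * nm (tri (a, x, z)))) => k1; first by constructor 1.
  case: (lerP (nm (tri (a, b, c))) (4 * nm (tri (x, b, y)))) => k2; first by constructor 2.
  case: (lerP (nm (tri (a, b, c))) (4 * nm (tri (z, y, c)))) => k3; first by constructor 3.
  by constructor 4; lra.
- move=> H; exists (a, x, z); split => //; rewrite /per /=.
    rewrite (h2 (x - a) (b - a)) ?(h2 (z - x) (c - b)) ?(h2 (a - z) (a - c)); [by field|..];
      by rewrite /x /y /z /mid; field.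
  by rewrite subrr nm0 !addr_ge0// nm_ge0.
- move=> H; exists (x, b, y); split => //; rewrite /per /=.
    rewrite (h2 (b - x) (b - a)) ?(h2 (y - b) (c - b)) ?(h2 (x - y) (a - c)); [by field|..];
      by rewrite /x /y /z /mid; field.
  rewrite (h2 (x - a) (b - a)); last by rewrite /x /mid; field.
  by have := (nm_ge0 (b - a), nm_ge0 (c - b), nm_ge0 (a - c)); move=> [[]]; lra.
- move=> H; exists (z, y, c); split => //; rewrite /per /=.
    rewrite (h2 (y - z) (b - a)) ?(h2 (c - y) (c - b)) ?(h2 (z - c) (a - c)); [by field|..];
      by rewrite /x /y /z /mid; field.
  rewrite (nm_sym z) (h2 (a - z) (a - c)); last by rewrite /z /mid; field.
  by have := (nm_ge0 (b - a), nm_ge0 (c - b), nm_ge0 (a - c)); move=> [[]]; lra.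
- move=> H; exists (y, z, x); split => //; rewrite /per /=.
    rewrite (h2 (z - y) (a - b)) ?(h2 (x - z) (b - c)) ?(h2 (y - x) (c - a));
      [|by rewrite /x /y /z /mid; field..].
    by rewrite (nm_sym a b) (nm_sym b c) (nm_sym c a); field.
  rewrite (_ : y - a = (b - a) / 2 - (a - c) / 2); last by rewrite /y /mid; field.
  have := nmB ((b - a) / 2) ((a - c) / 2); rewrite !half.
  by have := (nm_ge0 (b - a), nm_ge0 (c - b), nm_ge0 (a - c)); move=> [[]]; lra.
Qed.

Let next t : C * C * C := xget t [set t' | child t t'].

Let nextP t : inD t -> child t (next t).
Proof.
move=> /child_ex[t' tt']; rewrite /next; case: xgetP => [? -> //|/(_ t') []//].
Qed.

(** The bisected triangles shrink to a point [p], which lies in [D] because [D] is closed. An affine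
    function has integral 0 around a triangle, so near [p] the integral is only that of the error of
    differentiability: small compared with the squared perimeter, which loses a factor 4 at each
    step, exactly as the bound for the integral does. *)
Lemma goursat a b c : D a -> D b -> D c ->
  segint f a b + segint f b c + segint f c a = 0.
Proof.
move=> Da Db Dc; pose T n := iter n next (a, b, c).
have TD n : inD (T n) by elim: n => [//|n /nextP[]].
have Tc n : child (T n) (T n.+1) by apply: nextP.
pose d := per (a, b, c); pose tau := nm (tri (a, b, c)).
have d0 : 0 <= d by rewrite !addr_ge0 ?nm_ge0.
have perT n : per (T n) = d / 2 ^+ n.
  elim: n => [|n IH]; first by rewrite expr0 divr1.
  by have [_ -> _ _] := Tc n; rewrite IH exprS invfM mulrA mulrAC.
have tauT n : tau <= 4 ^+ n * nm (tri (T n)).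
  elim: n => [|n IH]; first by rewrite mul1r.
  have [_ _ _ H] := Tc n; apply: (le_trans IH).
  by rewrite exprSr -mulrA ler_wpM2l// exprn_ge0.
pose A n := (T n).1.1.
have AS n k : nm (A (n + k)%N - A n) <= 2 * (d / 2 ^+ n) - 2 * (d / 2 ^+ (n + k)).
  elim: k => [|k IH]; first by rewrite addn0 !subrr nm0.
  rewrite addnS (_ : A _ - A n = A (n + k).+1 - A (n + k)%N + (A (n + k)%N - A n)); last by ring.
  apply: (le_trans (nmD _ _)).
  have [_ _ H _] := Tc (n + k)%N; rewrite perT in H.
  apply: (le_trans (lerD H IH)).
  have -> : d / 2 ^+ (n + k).+1 = d / 2 ^+ (n + k) / 2 by rewrite exprSr invfM mulrA.
  lra.
have small (e : R) : 0 < e -> exists n, 2 * (d / 2 ^+ n) < e.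
  move=> e0; have [n Hn] : exists n, 2 * d / e < n%:R.
    exists (Num.bound (2 * d / e)).+1; apply: lt_trans (archi_boundP _) _.
      by rewrite divr_ge0 ?mulr_ge0// ltW.
    by rewrite ltr_nat.
  exists n; rewrite mulrA ltr_pdivrMr ?exprn_gt0// (mulrC e) -ltr_pdivrMr//.
  by apply: (lt_le_trans Hn); rewrite -natrX ler_nat ltnW// ltn_expl.
have [p Ap] : exists p : C, A n @[n --> \oo] --> p.
  apply: cauchy_cvgC => e /small[n ne]; exists (A n).
  exists n => // m /= nm'; rewrite -(subnKC nm').
  apply: le_lt_trans (AS _ _) (le_lt_trans _ ne).
  by rewrite gerBl mulr_ge0// divr_ge0// exprn_ge0.
have Anp n : nm (A n - p) <= 2 * (d / 2 ^+ n).
  apply/ler_addgt0Pr => e e0.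
  have [N _ HN] := (cvgC_P _ _).1 Ap e e0.
  have HN' := HN (n + N)%N (leq_addl _ _).
  rewrite (_ : A n - p = A (n + N)%N - p - (A (n + N)%N - A n)); last by ring.
  apply: (le_trans (nmB _ _)); rewrite addrC lerD ?(ltW HN')//.
  by apply: (le_trans (AS n N)); rewrite gerBl mulr_ge0// divr_ge0// exprn_ge0.
have Dp : D p.
  apply: Dclosed => e /small[n ne]; exists (A n); first by case: (TD n).
  exact: le_lt_trans (Anp n) ne.
have [k [fk ka /contC_P ck]] := (cHDP _ _ _).1 (cHDder (fD Dp)).
set a0 := derive1 f p in ka.
apply/eqP; rewrite -nm_eq0 eq_le nm_ge0 andbT -/(tri (a, b, c)) -/tau leNgt; apply/negP => tau0.
(* Chosen so that [8 * d ^+ 2 * e < tau], which contradicts the final estimate; the summand 1 covers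
   the case [d = 0]. *)
pose e := tau / (8 * d ^+ 2 + 1).
have q0 : 0 < 8 * d ^+ 2 + 1 by rewrite ltr_wpDl// mulr_ge0// sqr_ge0.
have e0 : 0 < e by rewrite divr_gt0.
have [dl dl0 kd] := ck _ e0.
(* The vertices of the n-th triangle are within [3 * dn] of [p] and its edges within [4 * dn], which
   has to be less than [dl]. *)
have [n ndl] := small (dl / 2) (divr_gt0 dl0 (ltr0Sn R 1)).
set dn := d / 2 ^+ n in ndl; have dn0 : 0 <= dn by rewrite divr_ge0// exprn_ge0.
have [Ta Tb Tc'] := TD n; have := perT n; rewrite -/dn => perTn.
have := Anp n; rewrite -/dn /A => An.
have edge x y : D x -> D y -> nm (y - x) <= dn -> nm (x - p) <= 3 * dn ->
    nm (segint f x y - (f p * (y - x) + a0 / 2 * ((y - p) ^+ 2 - (x - p) ^+ 2))) <=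
    2 * (e * (4 * dn) * nm (y - x)).
  move=> Dx Dy xy xp; apply: (segint_bound (segintP Dx Dy)) => t t01.
  have zp : nm (seg x y t - p) <= 4 * dn.
    rewrite (_ : seg x y t - p = seg x y t - x + (x - p)); last by ring.
    by apply: (le_trans (nmD _ _)); have := nm_seg x y t01; lra.
  rewrite opprD addrA fk (mulrC a0) -mulrBr -ka nmM mulrC ler_pM ?nm_ge0// ltW// kd//.
  by apply: (le_lt_trans zp); lra.
have [[p1 p2] p3] := (nm_ge0 ((T n).1.2 - (T n).1.1), nm_ge0 ((T n).2 - (T n).1.2), nm_ge0 ((T n).1.1 - (T n).2)).
rewrite /per in perTn.
have b2 : nm ((T n).1.2 - p) <= 3 * dn.
  rewrite (_ : _ - p = (T n).1.2 - (T n).1.1 + ((T n).1.1 - p)); last by ring.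
  by apply: (le_trans (nmD _ _)); lra.
have b3 : nm ((T n).2 - p) <= 3 * dn.
  rewrite (_ : _ - p = (T n).1.1 - p - ((T n).1.1 - (T n).2)); last by ring.
  by apply: (le_trans (nmB _ _)); lra.
have e1 := edge _ _ Ta Tb; have e2 := edge _ _ Tb Tc'; have e3 := edge _ _ Tc' Ta.
have b1 : nm ((T n).1.1 - p) <= 3 * dn by rewrite (le_trans An)// ler_wpM2r// ler_nat.
have {}e1 : _ := e1 _ b1; have {}e2 : _ := e2 _ b2; have {}e3 : _ := e3 _ b3.
have {}e1 := e1 ltac:(by rewrite -perTn -addrA lerDl addr_ge0).
have {}e2 := e2 ltac:(by rewrite -perTn addrAC lerDr addr_ge0).
have {}e3 := e3 ltac:(by rewrite -perTn lerDr addr_ge0).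
have : nm (tri (T n)) <= 8 * e * dn ^+ 2.
  set u1 := segint f _ _ - _ in e1; set u2 := segint f _ _ - _ in e2; set u3 := segint f _ _ - _ in e3.
  have -> : tri (T n) = u1 + u2 + u3 by rewrite /tri /u1 /u2 /u3; ring.
  apply: (le_trans (nmD _ _)); have := nmD u1 u2.
  have -> : 8 * e * dn ^+ 2 = 2 * (e * (4 * dn) * nm ((T n).1.2 - (T n).1.1)) +
    2 * (e * (4 * dn) * nm ((T n).2 - (T n).1.2)) + 2 * (e * (4 * dn) * nm ((T n).1.1 - (T n).2)).
    by rewrite expr2 mulrA -[X in _ * X = _]perTn; ring.
  by lra.
move=> H; have := le_trans (tauT n) (ler_wpM2l (exprn_ge0 n (ler0n R 4)) H).
have -> : 4 ^+ n * (8 * e * dn ^+ 2) = 8 * d ^+ 2 * e.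
  rewrite /dn expr_div_n -exprM mulnC exprM (_ : 2 ^+ 2 = 4 :> R); last by ring.
  by field; rewrite expf_neq0.
by rewrite /e mulrA ler_pdivlMr// mulrDr mulr1 (mulrC tau) gerDl leNgt tau0.
Qed.

End Goursat.

Section Periodic.
Variable R : realType.
Local Notation C := R[i].
Local Notation Re := (@complex.Re R).
Local Notation Im := (@complex.Im R).

Lemma Re_seg (a b : C) (t : R) : Re (seg a b t) = Re a + t * (Re b - Re a).
Proof. by rewrite /seg ReD ReM ReB /= mul0r subr0. Qed.

(* Cauchy's theorem on a parallelogram with a side of length the period. *)
Lemma segint_period (f : C -> C) (s : R) (p : C) :
  Re p = 0 -> (forall z, f (z + p) = f z) ->
  (forall z : C, Re z <= s -> derivable f z 1) ->
  forall a b, Re a <= s -> Re b <= s -> segint f a (a + p) = segint f b (b + p).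
Proof.
move=> p0 fp fd a b sa sb.
have Dconv (x y : C) (t : R) : Re x <= s -> Re y <= s -> 0 <= t <= 1 -> Re (seg x y t) <= s.
  move=> xs ys /andP[t0 t1]; rewrite Re_seg.
  have : t * Re y <= t * s by rewrite ler_wpM2l.
  have : (1 - t) * Re x <= (1 - t) * s by rewrite ler_wpM2l// subr_ge0.
  lra.
have Dcl (x : C) : (forall e : R, 0 < e -> exists2 z, Re z <= s & nm (z - x) < e) -> Re x <= s.
  move=> H; apply/ler_addgt0Pr => e /H[z zs zx].
  have := nm_Re (z - x); rewrite ReB ler_norml => /andP[h _]; lra.
have G := @goursat R [set z | Re z <= s] f Dconv Dcl fd.
have I := @segintP R [set z | Re z <= s] f Dconv fd.
have V := @segint_rev R [set z | Re z <= s] f Dconv fd.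
have sp x : Re x <= s -> Re (x + p) <= s by rewrite ReD p0 addr0.
have [sa' sb'] := (sp _ sa, sp _ sb).
have E : segint f (a + p) (b + p) = segint f a b.
  by apply/segintE/is_segint_shift => //; exact: I.
have := G a b (b + p) sa sb sb'; have := G a (b + p) (a + p) sa sb' sa'.
rewrite (V _ _ sa' sb') (V _ _ sa sa') (V _ _ sa sb') E.
move=> G1 G2; apply/eqP; rewrite -subr_eq0.
rewrite (_ : _ - _ = - ((segint f a (b + p) + - segint f a b + - segint f a (a + p)) +
  (segint f a b + segint f b (b + p) + - segint f a (b + p)))); last by ring.
by rewrite G1 G2 addr0 oppr0.
Qed.

End Periodic.

(** * The covering by the exponential *)

Section ComplexExponential.
Variable R : realType.
Local Notation C := R[i].
Local Notation Re := (@complex.Re R).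
Local Notation Im := (@complex.Im R).

Lemma HD_eps (f : C -> C) (x a : C) :
  (forall e : R, 0 < e -> exists2 d : R, 0 < d &
     forall h, nm h < d -> nm (f (x + h) - f x - a * h) <= e * nm h) ->
  is_derive x 1 f a.
Proof.
move=> H; apply/cHDP.
exists (fun u => if u == x then a else (f u - f x) / (u - x)); split.
- by move=> u; case: eqP => [->|/eqP ux]; rewrite ?subrr ?mul0r// mulrC divfK// subr_eq0.
- by rewrite eqxx.
apply/contC_P => e e0; rewrite eqxx.
have [d d0 Hd] := H (e / 2) (divr_gt0 e0 (ltr0Sn R 1)).
exists d => // u ux; case: eqP => [_|/eqP ux0]; first by rewrite subrr nm0.
rewrite -subr_eq0 in ux0; have := Hd _ ux; rewrite addrCA subrr addr0 => H1.
rewrite (_ : _ - a = (f u - f x - a * (u - x)) / (u - x)); last by field.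
rewrite nmM nmV ltr_pdivrMr ?nm_gt0//; apply: (le_lt_trans H1).
by rewrite ltr_pM2r ?nm_gt0// gtr_pMr// invf_lt1// ltr1n.
Qed.

Lemma cexpE (w : C) : cexp w = (expR (Re w) * cos (Im w)) +i* (expR (Re w) * sin (Im w)).
Proof. by rewrite /cexp; apply/eqP; rewrite eq_complex /= !mul0r subr0 addr0 !eqxx. Qed.

Lemma cexpD (a b : C) : cexp (a + b) = cexp a * cexp b.
Proof.
rewrite !cexpE ReD ImD expRD cosD sinD; apply/eqP; rewrite eq_complex /=.
by apply/andP; split; apply/eqP; ring.
Qed.

Lemma cexp0 : cexp (0 : C) = 1.
Proof. by rewrite cexpE /= expR0 cos0 sin0 mulr1 mulr0. Qed.

Lemma cexpN (w : C) : cexp (- w) = (cexp w)^-1.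
Proof.
have H : cexp w * cexp (- w) = 1 by rewrite -cexpD subrr cexp0.
have w0 : cexp w != 0.
  by apply/eqP => w0; move: H; rewrite w0 mul0r => /eqP; rewrite eq_sym oner_eq0.
by apply: (mulfI w0); rewrite H divff.
Qed.

Lemma cexpB (a b : C) : cexp (a - b) = cexp a / cexp b.
Proof. by rewrite cexpD cexpN. Qed.

Lemma nm_cexp (w : C) : nm (cexp w) = expR (Re w).
Proof.
by rewrite /nm cexpE /= !exprMn -mulrDr cos2Dsin2 mulr1 sqrtr_sqr ger0_norm// expR_ge0.
Qed.

Lemma cexp_neq0 (w : C) : cexp w != 0.
Proof. by rewrite -nm_gt0 nm_cexp expR_gt0. Qed.

Lemma cexpX (w : C) n : cexp w ^+ n = cexp (n%:R * w).
Proof.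
elim: n => [|n IH]; first by rewrite expr0 mul0r cexp0.
by rewrite exprS IH -cexpD -natr1 mulrDl mul1r addrC.
Qed.

Lemma HD_cexp0 : is_derive (0 : C) 1 (@cexp R) 1.
Proof.
have qt (f : R -> R) (a e : R) : is_derive (0 : R) 1 f a -> 0 < e -> exists2 d : R, 0 < d &
    forall x, `|x| < d -> `|f x - f 0 - a * x| <= e * `|x|.
  move=> /HDP[k [fk <- ck]] e0.
  have /cvgrPdistC_lt/(_ _ e0)/nbhs_normP[d /= d0 Hd] := ck; exists d => // x xd.
  rewrite fk subr0 (mulrC x) -mulrBl normrM ler_wpM2r// ltW// Hd//=.
  by rewrite sub0r normrN.
apply: HD_eps => e0 e00.
(* With error [e / 9] for each of exp, cos and sin, the products included, the real part contributes
   four ninths and the imaginary part five ninths of [e * nm h]. *)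
pose e := Num.min 1 e0.
have ep : 0 < e by rewrite lt_min ltr01.
have e1 : e <= 1 by rewrite ge_min lexx.
have ee : e <= e0 by rewrite ge_min lexx orbT.
have e9 : 0 < e / 9 by rewrite divr_gt0.
have [d1 d10 D1] := qt _ _ _ (is_derive_expR 0) e9.
have [d2 d20 D2] := qt _ _ _ (is_derive_cos 0) e9.
have [d3 d30 D3] := qt _ _ _ (is_derive_sin 0) e9.
exists (Num.min (e / 9) (Num.min d1 (Num.min d2 d3))).
  by rewrite !lt_min e9 d10 d20.
move=> h; rewrite !lt_min => /and4P[h0 h1 h2 h3].
have rx := nm_Re h; have ry := nm_Im h.
have {D1} := D1 _ (le_lt_trans rx h1); have {D2} := D2 _ (le_lt_trans ry h2).
have {D3} := D3 _ (le_lt_trans ry h3).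
rewrite add0r cexp0 cexpE expR0 cos0 sin0 oppr0 mul0r !mul1r !subr0 => H3 H2 H1.
set x := Re h in rx H1 *; set y := Im h in ry H2 H3 *.
set ex := expR x in H1 *; set c := cos y in H2 *; set s := sin y in H3 *.
set n := nm h in h0 rx ry *.
have n0 : 0 <= n by exact: nm_ge0.
have n9 : n <= e / 9 by apply: ltW.
have Hx : `|ex - 1 - x| <= e / 9 * n by apply: (le_trans H1); rewrite ler_wpM2l// ltW.
have Hc : `|c - 1| <= e / 9 * n by apply: (le_trans H2); rewrite ler_wpM2l// ltW.
rewrite addr0 in H3.
have Hs : `|s - y| <= e / 9 * n by apply: (le_trans H3); rewrite ler_wpM2l// ltW.
have en : e / 9 * n <= n by rewrite ler_piMl//; lra.
have nn : n * n <= e / 9 * n by rewrite ler_wpM2r.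
have Hx1 : `|ex - 1| <= 2 * n.
  rewrite (_ : ex - 1 = (ex - 1 - x) + x); last by ring.
  by apply: (le_trans (ler_normD _ _)); lra.
have Hs1 : `|s| <= 2 * n.
  rewrite (_ : s = (s - y) + y); last by ring.
  by apply: (le_trans (ler_normD _ _)); lra.
have Hc1 : `|c - 1| <= n by lra.
apply: (le_trans (nm_le _)); rewrite !ReB !ImB /= -/x -/y.
have -> : ex * c - 1 - x = (ex - 1 - x) + (c - 1) + (ex - 1) * (c - 1) by ring.
have -> : ex * s - 0 - y = (s - y) + (ex - 1) * s by ring.
have m1 : `|(ex - 1) * (c - 1)| <= 2 * n * n by rewrite normrM ler_pM.
have m2 : `|(ex - 1) * s| <= 2 * n * (2 * n) by rewrite normrM ler_pM.
have := ler_normD (ex - 1 - x + (c - 1)) ((ex - 1) * (c - 1)).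
have := ler_normD (ex - 1 - x) (c - 1); have := ler_normD (s - y) ((ex - 1) * s).
have : e * n <= e0 * n by rewrite ler_wpM2r.
lra.
Qed.

Lemma HD_cexp (w : C) : is_derive w 1 (@cexp R) (cexp w).
Proof.
have H0 : is_derive (w - w) 1 (@cexp R) 1 by rewrite subrr; exact: HD_cexp0.
have := cHDZ (cexp w) (cHDcomp (g := fun u => u - w) H0 (cHDB (cHDid w) (cHDc w w))).
move=> H; apply: (cHD_near _ (cHD_eq H _)); last by rewrite subr0 !mulr1.
by apply/nearCP; exists 1 => // u _; rewrite -cexpD addrC subrK.
Qed.

Definition tpi : C := 0 +i* (2 * pi).

Lemma cexp_tpi : cexp tpi = 1.
Proof.
rewrite cexpE /= expR0 !mul1r (_ : 2 * pi = pi *+ 2); last by rewrite mulr_natl.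
by rewrite cos2pi sin2pi.
Qed.

Lemma nm_tpi : nm tpi = 2 * pi.
Proof.
by rewrite /nm /= expr0n /= add0r sqrtr_sqr ger0_norm// mulr_ge0// pi_ge0.
Qed.

Lemma deckE (n : int) (w : C) : deck n w = w + n%:~R * tpi.
Proof.
rewrite /deck /tpi; congr (_ + _); rewrite -(rmorph_int (real_complex R)).
by apply/eqP; rewrite eq_complex /= !mulr0 mul0r subr0 addr0 eqxx mulrC /=.
Qed.

Lemma cexp_int (n : int) : cexp (n%:~R * tpi) = 1.
Proof.
case: n => n; rewrite ?NegzE.
  by rewrite -[_%:~R]/(n%:R) -cexpX cexp_tpi expr1n.
by rewrite rmorphN /= -[_%:~R]/(n.+1%:R) mulNr cexpN -cexpX cexp_tpi expr1n invr1.
Qed.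

Lemma cexp_deck n (w : C) : cexp (deck n w) = cexp w.
Proof. by rewrite deckE cexpD cexp_int mulr1. Qed.

(** The modulus forces [Re c = 0]. Subtracting a multiple of the period brings the imaginary part
    into [0, 2 pi), where cos takes the value 1 only at 0: it is injective on [0, pi], and a
    reflection treats the other half. *)
Lemma cexp_ker (c : C) : cexp c = 1 -> exists n : int, c = n%:~R * tpi.
Proof.
move=> c1; have Rc : Re c = 0.
  by apply: expR_inj; rewrite -nm_cexp c1 nm1 expR0.
pose p : R := 2 * pi; have p0 : 0 < p by rewrite mulr_gt0// pi_gt0.
pose n := Num.floor (Im c / p); exists n.
pose c' := c - n%:~R * tpi.
have c'1 : cexp c' = 1 by rewrite cexpB c1 cexp_int divr1.
have Ic' : Im c' = Im c - n%:~R * p.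
  by rewrite ImB -(rmorph_int (real_complex R)) ImM /= mul0r addr0.
have Rc' : Re c' = 0.
  by rewrite ReB Rc -(rmorph_int (real_complex R)) ReM /= mul0r mulr0 !subr0.
have r0 : 0 <= Im c'.
  by rewrite Ic' subr_ge0 -ler_pdivlMr//; apply: floor_le_tmp.
have rp : Im c' < p.
  have : Im c / p < n%:~R + 1 by rewrite -intrD1 floorD1_gt.
  by rewrite ltr_pdivrMr// mulrDl mul1r Ic'; lra.
have cr : cos (Im c') = 1.
  by move: c'1; rewrite cexpE Rc' expR0 !mul1r => -[].
suff r : Im c' = 0.
  apply/eqP; rewrite -subr_eq0 -/c' (complexRI c') Rc' r; exact/eqP.
have pi0 := @pi_gt0 R.
case: (lerP (Im c') pi) => rpi.
  by apply: (@cos_inj R); rewrite ?in_itv /= ?r0 ?lexx ?cos0 ?pi_ge0.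
have cr' : cos (p - Im c') = 1.
  have -> : p - Im c' = - Im c' + pi *+ 2 by rewrite /p mulr_natl addrC.
  by rewrite cosD2pi cosN.
have : p - Im c' = 0.
  apply: (@cos_inj R); rewrite ?in_itv /= ?lexx ?cos0 ?pi_ge0//.
  by rewrite subr_ge0 ltW//= /p; lra.
lra.
Qed.

Lemma cexp_eq (a b : C) : cexp a = cexp b -> exists n : int, a = deck n b.
Proof.
move=> ab; have [|n nE] := @cexp_ker (a - b); first by rewrite cexpB ab divff// cexp_neq0.
by exists n; rewrite deckE -nE addrC subrK.
Qed.

(** The bound on the imaginary part is what later exhibits closed annuli as images of compact
    rectangles. *)
Lemma cexp_surj_strip (z : C) : z != 0 -> exists w, cexp w = z /\ - pi <= Im w <= pi.
Proof.
move=> z0; have n0 : 0 < nm z by rewrite nm_gt0.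
pose c := Re z / nm z; pose s := Im z / nm z.
have cs : c ^+ 2 + s ^+ 2 = 1.
  by rewrite /c /s !expr_div_n -mulrDl -nm2 divff// expf_neq0// gt_eqF.
have c1 : -1 <= c <= 1.
  rewrite -ler_norml -(@ler_pXn2r _ 2)// ?nnegrE// expr1n real_normK ?num_real//.
  by rewrite -cs lerDl sqr_ge0.
have c1' : c \in Interval (BLeft (-1)) (BRight 1) by rewrite in_itv.
have ss : Num.sqrt (1 - c ^+ 2) = `|s|.
  by rewrite -cs addrC addKr sqrtr_sqr.
have zE : z = (nm z * c) +i* (nm z * s).
  by rewrite /c /s !(mulrC (nm z)) !divfK ?gt_eqF// -complexRI.
have a0 := acos_ge0 c1; have ap := acos_lepi c1.
exists (ln (nm z) +i* (if 0 <= s then acos c else - acos c)); split; last first.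
  by case: ifP => _ /=; apply/andP; split; have := @pi_ge0 R; lra.
rewrite cexpE /= lnK ?posrE// {3}zE; case: ifP => s0.
  by rewrite acosK// sin_acos// ss ger0_norm.
rewrite cosN sinN acosK// sin_acos// ss ltr0_norm ?opprK//.
by rewrite ltNge s0.
Qed.

Lemma cexp_surj (z : C) : z != 0 -> exists w, cexp w = z.
Proof. by move=> /cexp_surj_strip[w [wz _]]; exists w. Qed.

(** On the right half-plane this is the principal logarithm, the argument there being an arcsine.
    Other branches are obtained from it by translation. *)
Definition Log1 (z : C) : C := ln (nm z) +i* asin (Im z / nm z).

Lemma cexp_Log1 (z : C) : 0 < Re z -> cexp (Log1 z) = z.
Proof.
move=> z0; have zn0 : z != 0 by apply: contraTneq z0 => ->; rewrite ltxx.
have n0 : 0 < nm z by rewrite nm_gt0.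
pose c := Re z / nm z; pose s := Im z / nm z.
have cs : c ^+ 2 + s ^+ 2 = 1.
  by rewrite /c /s !expr_div_n -mulrDl -nm2 divff// expf_neq0// gt_eqF.
have s1 : -1 <= s <= 1.
  rewrite -ler_norml -(@ler_pXn2r _ 2)// ?nnegrE// expr1n real_normK ?num_real//.
  by rewrite -cs lerDr sqr_ge0.
have s1' : s \in Interval (BLeft (-1)) (BRight 1) by rewrite in_itv.
rewrite cexpE /= lnK ?posrE// -/s asinK// cos_asin//.
rewrite -cs addrK sqrtr_sqr ger0_norm; last by rewrite divr_ge0// ltW.
by rewrite /c /s !(mulrC (nm z)) !divfK ?gt_eqF// -complexRI.
Qed.

Lemma Log1_1 : Log1 1 = 0.
Proof.
rewrite /Log1 nm1 ln1 /= mul0r; congr (_ +i* _).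
have := @sinK R 0; rewrite sin0; apply.
by rewrite in_itv /= oppr_le0 divr_ge0 ?pi_ge0.
Qed.

Lemma Log1_cont : {for 1, continuous Log1}.
Proof.
have cn : {for (1 : C), continuous (@nm R)}.
  apply/(@cvgrPdistC_lt _ _ _ _ (nbhs_filter (1 : C))) => e e0; apply/nearCP; exists e => // u ue.
  apply: le_lt_trans ue; rewrite ler_norml.
  have := nmD (u - 1) 1; have := nmB u (u - 1).
  by rewrite subrK opprB addrC subrK nm1 => h1 h2; apply/andP; split; lra.
have cI : {for (1 : C), continuous Im}.
  apply/(@cvgrPdistC_lt _ _ _ _ (nbhs_filter (1 : C))) => e e0; apply/nearCP; exists e => // u ue.
  by rewrite -ImB; apply: le_lt_trans (nm_Im _) ue.
have cq : {for (1 : C), continuous (fun z => Im z / nm z)}.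
  have n1 : nm (1 : C) != 0 by rewrite nm1 oner_neq0.
  exact: (cvgM cI (cvgV n1 cn)).
apply: (cvg_ReIm (FF := nbhs_filter (1 : C))) => /=.
  apply: (@continuous_comp _ _ _ (@nm R) (@ln R) 1 cn).
  by rewrite nm1; apply: continuous_ln.
apply: (@continuous_comp _ _ _ (fun z => Im z / nm z) (@asin R) 1 cq).
by rewrite nm1 /= mul0r; apply: continuous_asin; rewrite ltrN10 ltr01.
Qed.

(** If [k] is the Carathéodory factor of the exponential at 0, then the inverse of [k \o Log1] is
    one for the logarithm at 1; its continuity only needs that of [Log1]. *)
Lemma HD_Log1 : is_derive (1 : C) 1 Log1 1.
Proof.
have [k [ek k0 ck]] := (cHDP _ _ _).1 HD_cexp0.
have ckL : {for 1, continuous (k \o Log1)}.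
  by apply: (@continuous_comp _ _ _ Log1 k 1 Log1_cont); rewrite Log1_1.
have kL : {for 1, continuous (fun z => (k (Log1 z))^-1)}.
  have n1 : (k \o Log1) 1 != 0 by rewrite /= Log1_1 k0 oner_neq0.
  exact: (cvgV n1 ckL).
have HN : \forall z \near (1 : C), Log1 z - Log1 1 = (z - 1) * (k (Log1 z))^-1.
  have /contC_P/(_ 1 ltr01)[d d0 Hd] := ckL.
  apply/nearCP; exists (Num.min d 1) => [|z]; first by rewrite lt_min d0 ltr01.
  rewrite lt_min => /andP[/Hd kd z1].
  have Rz : 0 < Re z.
    by have := nm_Re (z - 1); rewrite ReB ler_norml /= => /andP[? _]; lra.
  have kz : k (Log1 z) != 0.
    by apply: contraTneq kd; rewrite /= Log1_1 k0 => ->; rewrite sub0r nmN nm1 ltxx.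
  have := ek (Log1 z); rewrite cexp_Log1// cexp0 subr0 Log1_1 subr0 => ->.
  by rewrite mulfK.
have H : is_derive (1 : C) 1 (fun z => Log1 1 + (z - 1) * (k (Log1 z))^-1) 1.
  apply/cHDP; exists (fun z => (k (Log1 z))^-1); split; [|by rewrite Log1_1 k0 invr1|exact: kL].
  by move=> u; rewrite subrr mul0r addr0 addrAC subrr add0r.
by apply: (cHD_near _ H); apply: filterS HN => z <-; rewrite addrC subrK.
Qed.

(** A local branch of the logarithm through [w]. It transports derivatives between the cover and the
    punctured plane. *)
Lemma cexp_section (w : C) : exists s : C -> C, [/\ s (cexp w) = w,
  (\forall z \near cexp w, cexp (s z) = z) & is_derive (cexp w) 1 s (cexp w)^-1].
Proof.
have e0 := cexp_neq0 w.
exists (fun z => w + Log1 (z / cexp w)); split.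
- by rewrite divff// Log1_1 addr0.
- apply/nearCP; exists (nm (cexp w)) => [|z zw]; first by rewrite nm_gt0.
  rewrite cexpD cexp_Log1 ?(mulrC (cexp w)) ?divfK//.
  have : nm (z / cexp w - 1) < 1.
    rewrite (_ : _ - 1 = (z - cexp w) / cexp w); last by field.
    by rewrite nmM nmV ltr_pdivrMr ?nm_gt0// mul1r//.
  by have := nm_Re (z / cexp w - 1); rewrite ReB ler_norml /= => /andP[? _]; lra.
have H1 : is_derive (cexp w / cexp w) 1 Log1 1 by rewrite divff//; exact: HD_Log1.
have H2 := cHDM (cHDid (cexp w)) (cHDc (cexp w)^-1 (cexp w)).
apply: (cHD_eq (cHDD (cHDc w (cexp w)) (cHDcomp (g := fun z => z / cexp w) H1 H2))).
by rewrite add0r mulr0 addr0 !mul1r.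
Qed.

Lemma HD_descend (l L : C -> C) (w a : C) :
  (forall u, l u = L (cexp u)) -> is_derive w 1 l a ->
  is_derive (cexp w) 1 L (a / cexp w).
Proof.
move=> lL la; have [s [sw cs ds]] := cexp_section w.
have la' : is_derive (s (cexp w)) 1 l a by rewrite sw.
have H := cHDcomp la' ds; apply: (cHD_near _ H).
by apply: filterS cs => z cz; rewrite lL cz.
Qed.

End ComplexExponential.

(** * Cauchy estimates *)

Section CauchyEstimates.
Variable R : realType.
Local Notation C := R[i].
Local Notation Re := (@complex.Re R).
Local Notation Im := (@complex.Im R).

Definition holo_on (b : C) (r : R) (f : C -> C) :=
  forall z : C, nm (z - b) <= r -> derivable f z 1.

(* With z = b + e^w, the function (f z - f b) / (z - b) is 2 pi i-periodic in w
   and tends to f'(b) as Re w goes to minus infinity; its integral over a period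
   does not depend on w. *)
Lemma cauchy_estimate (f : C -> C) (b : C) (r M : R) : 0 < r -> holo_on b r f ->
  (forall z, nm (z - b) <= r -> nm (f z) <= M) -> nm (derive1 f b) <= 4 * M / r.
Proof.
move=> r0 fd fM; have M0 : 0 <= M.
  by apply: le_trans (fM b _); rewrite ?nm_ge0// subrr nm0 ltW.
have db : derivable f b 1 by apply: fd; rewrite subrr nm0 ltW.
have [k [fk kb /contC_P ck]] := (cHDP _ _ _).1 (cHDder db).
have p0 := @pi_gt0 R.
pose phi w := (f (b + cexp w) - f b) * cexp (- w).
have phik w : phi w = k (b + cexp w).
  by rewrite /phi fk addrAC subrr add0r cexpN mulrC mulKf// cexp_neq0.
have phip w : phi (w + tpi R) = phi w.
  by rewrite /phi opprD !cexpD [cexp (- tpi R)]cexpN cexp_tpi invr1 !mulr1.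
have bd w : Re w <= ln r -> nm (b + cexp w - b) <= r.
  by rewrite addrAC subrr add0r nm_cexp -ler_expR lnK ?posrE.
have phid w : Re w <= ln r -> derivable phi w 1.
  move=> wr; have fd' := cHDder (fd _ (bd _ wr)).
  have H1 := cHDcomp (g := fun u => b + cexp u) fd' (cHDD (cHDc b w) (HD_cexp w)).
  have H2 := cHDcomp (f := @cexp R) (g := fun u => - u) (HD_cexp (- w)) (cHDN (cHDid w)).
  exact: cHDd (cHDM (cHDB H1 (cHDc (f b) w)) H2).
have tR : Re (tpi R) = 0 by [].
have P := segint_period tR phip phid.
pose w0 : C := (ln r)%:C.
have w0r : Re w0 <= ln r by [].
have fcont w : Re w <= ln r -> {for w, continuous phi}.
  by move=> /phid /cHDder /cHDcont.
have IS w : Re w <= ln r -> is_segint phi w (w + tpi R) (segint phi w (w + tpi R)).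
  move=> wr; apply: segint_ex => t t01; apply: fcont.
  by rewrite Re_seg ReD tR addr0 subrr mulr0 addr0.
have Rseg w t : Re (seg w (w + tpi R) t) = Re w.
  by rewrite Re_seg ReD tR addr0 subrr mulr0 addr0.
have tE w : w + tpi R - w = tpi R by rewrite addrAC subrr add0r.
set S := segint phi w0 (w0 + tpi R).
(* On the line [Re w = ln r]. One factor 2 comes from the difference [f z - f b], the other from
   [segint_bound]. *)
have S1 : nm S <= 2 * (2 * M / r * (2 * pi)).
  have := @segint_bound _ phi w0 (w0 + tpi R) S 0 0 0 (2 * M / r) (IS _ w0r).
  rewrite tE nm_tpi (_ : S - _ = S); last by ring.
  apply => t _; set z := seg _ _ _.
  have zr : Re z = ln r by rewrite Rseg.
  rewrite (_ : _ - _ = phi z); last by ring.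
  rewrite /phi nmM nm_cexp ReN zr expRN lnK ?posrE// ler_wpM2r ?invr_ge0 ?(ltW r0)//.
  apply: (le_trans (nmB _ _)); rewrite mulr_natl mulr2n lerD// fM ?bd ?zr//.
  by rewrite subrr nm0 ltW.
(* Far to the left the integrand is [e]-close to the derivative of [f] at [b], so the same integral
   is close to that derivative times the period. *)
have S2 (e : R) : 0 < e -> nm (S - derive1 f b * tpi R) <= 2 * (e * (2 * pi)).
  move=> e0; have [d d0 Hd] := ck _ e0.
  pose x := Num.min (ln r) (ln (d / 2)).
  have xr : Re (x%:C) <= ln r by rewrite /= ge_min lexx.
  rewrite /S (P _ _ w0r xr).
  have := @segint_bound _ phi x%:C (x%:C + tpi R) _ (derive1 f b) 0 0 e (IS _ xr).
  rewrite tE nm_tpi.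
  rewrite (_ : _ + 0 / 2 * _ = derive1 f b * tpi R); last by ring.
  apply => t _; set z := seg _ _ _; rewrite mul0r addr0 phik -kb ltW// Hd//.
  rewrite addrAC subrr add0r nm_cexp Rseg /=.
  have d2 : 0 < d / 2 by rewrite divr_gt0.
  apply: (@le_lt_trans _ _ (d / 2)); last by rewrite gtr_pMr// invf_lt1// ltr1n.
  by rewrite -[leRHS]lnK ?posrE// ler_expR ge_min lexx orbT.
apply/ler_addgt0Pr => e e0; have {}S2 := S2 (e / 2) (divr_gt0 e0 (ltr0Sn R 1)).
have : nm (derive1 f b * tpi R) <= 2 * (2 * M / r * (2 * pi)) + 2 * (e / 2 * (2 * pi)).
  rewrite (_ : derive1 f b * _ = S - (S - derive1 f b * tpi R)); last by ring.
  by apply: (le_trans (nmB _ _)); rewrite lerD.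
rewrite nmM nm_tpi -ler_pdivlMr ?mulr_gt0// => /le_trans; apply.
rewrite (_ : (_ + _) / _ = 4 * M / r + e)//.
have aux (p a s c : R) : p != 0 -> s != 0 ->
    (2 * (2 * a / s * (2 * p)) + 2 * (c / 2 * (2 * p))) / (2 * p) = 4 * a / s + c.
  by move=> ? ?; field; apply/andP.
by apply: aux; rewrite gt_eqF.
Qed.

(* The difference quotients of f are holomorphic; by the Cauchy estimate their
   derivatives at b form a Cauchy family. *)
Theorem holo_derive1 (f : C -> C) (b : C) (r : R) : 0 < r -> holo_on b r f ->
  derivable (derive1 f) b 1.
Proof.
move=> r0 fd.
have db : derivable f b 1 by apply: fd; rewrite subrr nm0 ltW.
have [d1 d10 Hd1] := (contC_P _ _).1 (cHDcont (cHDder db)) 1 ltr01.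
pose d := Num.min r (d1 / 2).
have d0 : 0 < d by rewrite lt_min r0 divr_gt0.
have dr : d <= r by rewrite ge_min lexx.
have dd1 : d < d1.
  by apply: (@le_lt_trans _ _ (d1 / 2)); [rewrite ge_min lexx orbT|lra].
have fd' z : nm (z - b) <= d -> is_derive z 1 f (derive1 f z).
  by move=> zd; apply/cHDder/fd/(le_trans zd).
pose M := nm (f b) + 1.
have fM z : nm (z - b) <= d -> nm (f z) <= M.
  move=> zd; have := Hd1 z (le_lt_trans zd dd1) => h.
  rewrite (_ : f z = f b + (f z - f b)); last by ring.
  by apply: (le_trans (nmD _ _)); rewrite lerD2l ltW.
pose K := 4 * M / (d / 4).
have tri3 (x y z : C) : nm (x - z) <= nm (x - y) + nm (y - z).
  by apply: le_trans (nmD _ _); rewrite addrA subrK.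
have f'K z : nm (z - b) <= d / 2 -> nm (derive1 f z) <= K.
  move=> zd; apply: cauchy_estimate; first by rewrite divr_gt0.
    by move=> u uz; apply: cHDd (fd' u _); have := tri3 u z b; lra.
  by move=> u uz; apply: fM; have := tri3 u z b; lra.
have segb (z h : C) (t s : R) : nm (z - b) <= s -> 0 <= t <= 1 -> nm (z + t%:C * h - b) <= s + nm h.
  move=> zs /andP[t0 t1]; rewrite addrAC; apply: (le_trans (nmD _ _)); rewrite lerD//.
  by rewrite nmM nmR ger0_norm// ler_piMl// nm_ge0.
have addK (z h : C) : z + h - z = h by rewrite addrAC subrr add0r.
have lip z h : nm (z - b) <= d / 4 -> nm h <= d / 4 -> nm (f (z + h) - f z) <= 2 * K * nm h.
  move=> zd hd; have := @holo_bound _ f (derive1 f) z (z + h) K; rewrite addK mulrA; apply.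
    by move=> t t01; apply: fd'; have := segb z h t _ zd t01; lra.
  by move=> t t01; apply: f'K; have := segb z h t _ zd t01; lra.
pose K2 := 4 * (2 * K) / (d / 8).
have lip' z h : nm (z - b) <= d / 8 -> nm h <= d / 4 ->
    nm (derive1 f (z + h) - derive1 f z) <= K2 * nm h.
  move=> zd hd.
  have dg u : nm (u - z) <= d / 8 -> is_derive u 1 (fun v => f (v + h) - f v)
      (derive1 f (u + h) - derive1 f u).
    move=> uz; have u1 : nm (u - b) <= d by have := tri3 u z b; lra.
    have u2 : nm (u + h - b) <= d.
      by rewrite addrAC (le_trans (nmD _ _))//; have := tri3 u z b; lra.
    have H := cHDcomp (g := fun v => v + h) (fd' _ u2) (cHDD (cHDid u) (cHDc h u)).
    by apply: (cHD_eq (cHDB H (fd' _ u1))); rewrite addr0 mulr1.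
  have dz : nm (z - z) <= d / 8 by rewrite subrr nm0; lra.
  rewrite -(cHD1 (dg z dz)).
  rewrite (_ : K2 * nm h = 4 * (2 * K * nm h) / (d / 8)); last by rewrite /K2; ring.
  apply: cauchy_estimate; first by rewrite divr_gt0.
    by move=> u /dg/cHDd.
  by move=> u uz; apply: lip => //; have := tri3 u z b; lra.
have K2p : 0 <= K2.
  have M0 : 0 <= M by rewrite addr_ge0// nm_ge0.
  have K0 : 0 <= K by apply: divr_ge0; [apply: mulr_ge0 => //|lra].
  by apply: divr_ge0; [do 2?apply: mulr_ge0 => //|lra].
have quo z h : nm (z - b) <= d / 8 -> nm h <= d / 4 ->
    nm (f (z + h) - f z - derive1 f z * h) <= 2 * K2 * nm h * nm h.
  move=> zd hd.
  have := @holo_bound _ (fun u => f u - derive1 f z * u) (fun u => derive1 f u - derive1 f z)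
    z (z + h) (K2 * nm h).
  rewrite addK (_ : _ - _ - _ = f (z + h) - f z - derive1 f z * h); last by ring.
  rewrite !mulrA; apply.
    move=> t t01; apply: cHD_eq (cHDB (fd' _ _) (cHDZ _ (cHDid _))) _; last by rewrite mulr1.
    by have := segb z h t _ zd t01; lra.
  move=> t /andP[t0 t1]; have th : nm (t%:C * h) <= nm h.
    by rewrite nmM nmR ger0_norm// ler_piMl// nm_ge0.
  apply: le_trans (lip' _ _ zd (le_trans th hd)) _; rewrite ler_wpM2l//.
pose q h := (derive1 f (b + h) - derive1 f b) / h.
pose K3 := 4 * (2 * K2) / (d / 8).
(* [q h] is the derivative at [b] of the function u -> (f(u + h) - f(u)) / h. Two such functions
   differ by the Taylor remainders bounded in [quo], and the Cauchy estimate applies to their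
   difference. *)
have qC h k : h != 0 -> k != 0 -> nm h <= d / 8 -> nm k <= d / 8 ->
    nm (q h - q k) <= K3 * (nm h + nm k).
  move=> h0 k0 hd kd.
  have dg u l : nm (u - b) <= d / 8 -> nm l <= d / 8 -> l != 0 ->
      is_derive u 1 (fun v => (f (v + l) - f v) / l) ((derive1 f (u + l) - derive1 f u) / l).
    move=> u1 ld l0.
    have u2 : nm (u + l - b) <= d by rewrite addrAC (le_trans (nmD _ _))//; lra.
    have H := cHDcomp (g := fun v => v + l) (fd' _ u2) (cHDD (cHDid u) (cHDc l u)).
    have u3 : nm (u - b) <= d by lra.
    apply: (cHD_eq (cHDM (cHDB H (fd' _ u3)) (cHDc l^-1 u))).
    by rewrite addr0 mulr1 mulr0 addr0.
  have dz : nm (b - b) <= d / 8 by rewrite subrr nm0; lra.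
  rewrite -(cHD1 (cHDB (dg b h dz hd h0) (dg b k dz kd k0))).
  rewrite (_ : K3 * _ = 4 * (2 * K2 * (nm h + nm k)) / (d / 8)); last by rewrite /K3; ring.
  apply: cauchy_estimate; first by rewrite divr_gt0.
    by move=> u ud; apply: cHDd (cHDB (dg u h ud hd h0) (dg u k ud kd k0)).
  move=> u ud; rewrite (_ : _ - _ = (f (u + h) - f u - derive1 f u * h) / h -
    (f (u + k) - f u - derive1 f u * k) / k); last by field; rewrite h0 k0.
  apply: (le_trans (nmB _ _)); rewrite mulrDr !nmM !nmV lerD//.
    by rewrite ler_pdivrMr ?nm_gt0//; apply: quo => //; lra.
  by rewrite ler_pdivrMr ?nm_gt0//; apply: quo => //; lra.
have [l ql] : exists l : C, q h @[h --> 0^'] --> l.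
  apply: cauchy_cvgC => e e0.
  have K3p : 0 <= K3 by apply: divr_ge0; [do 2?apply: mulr_ge0 => //|lra].
  pose s := Num.min (d / 8) (e / (2 * (K3 + 1))).
  have K31 : 0 < K3 + 1 by lra.
  have s0 : 0 < s by rewrite lt_min !divr_gt0// mulr_gt0.
  have sd : s <= d / 8 by rewrite ge_min lexx.
  have se : s * (2 * (K3 + 1)) <= e.
    by rewrite -ler_pdivlMr ?mulr_gt0// ge_min lexx orbT.
  have hs : (s / 2)%:C != 0 :> C by rewrite -nm_gt0 nmR normr_gt0 gt_eqF// divr_gt0.
  have hsn : nm (s / 2)%:C = s / 2 by rewrite nmR ger0_norm// divr_ge0// ltW.
  exists (q (s / 2)%:C); apply/near'CP; exists s => // h h0; rewrite subr0 => hs'.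
  apply: le_lt_trans (qC _ _ h0 hs _ _) _; rewrite ?hsn; [lra..|].
  apply: (@lt_le_trans _ _ ((K3 + 1) * (2 * s))); last by rewrite mulrCA mulrC mulrA (mulrC _ s) -mulrA in se *; lra.
  apply: (@le_lt_trans _ _ (K3 * (2 * s))); first by rewrite ler_wpM2l//; lra.
  by rewrite ltr_pM2r; lra.
apply/cvg_ex; exists l => /=.
apply: cvg_trans ql; apply: near_eq_cvg; apply/near'CP; exists 1 => // h h0 _.
by rewrite /q /GRing.scale /= mulr1 mulrC (addrC b).
Qed.

(** The Cauchy estimate on the disc of radius [1 + nm z] about [z] bounds the first derivative
    uniformly; on discs of arbitrary radius it then makes the second derivative vanish. *)
Theorem liouville_affine (f : C -> C) (K : R) : (forall z : C, derivable f z 1) ->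
  (forall z, nm (f z) <= K * (1 + nm z)) -> forall z, f z = f 0 + derive1 f 0 * z.
Proof.
move=> fd fK.
have K0 : 0 <= K by have := fK 0; rewrite nm0 addr0 mulr1; apply: le_trans; exact: nm_ge0.
have f'K z : nm (derive1 f z) <= 8 * K.
  have r0 : 0 < 1 + nm z by have := nm_ge0 z; lra.
  have := @cauchy_estimate f z (1 + nm z) (2 * K * (1 + nm z)) r0.
  rewrite mulrA mulfK ?gt_eqF// (_ : 4 * (2 * K) = 8 * K); last by ring.
  apply => u uz //; apply: (le_trans (fK u)); rewrite -mulrA mulrCA ler_wpM2l//.
  by have := nmD (u - z) z; rewrite subrK; lra.
have fd' z : derivable (derive1 f) z 1 by apply: (@holo_derive1 f z 1) => // u _; exact: fd.
have aux (e : R) : 0 < e -> 4 * (8 * K) / ((32 * K + 1) / e) <= e.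
  move=> e0; rewrite ler_pdivrMr; last by rewrite divr_gt0//; lra.
  have en : e != 0 by rewrite gt_eqF.
  have -> : e * ((32 * K + 1) / e) = 32 * K + 1 by field.
  lra.
have f''0 z : derive1 (derive1 f) z = 0.
  apply/eqP; rewrite -nm_eq0 eq_le nm_ge0 andbT; apply/ler_addgt0Pr => e e0; rewrite add0r.
  have r0 : 0 < (32 * K + 1) / e by rewrite divr_gt0//; lra.
  have := @cauchy_estimate (derive1 f) z _ (8 * K) r0.
  move=> H; apply: (le_trans (H _ _)) => //.
  exact: aux.
have f'c z : derive1 f z = derive1 f 0.
  by apply: holo_const => u; rewrite -(f''0 u); exact: cHDder.
move=> z; have H (u : C) : is_derive u 1 (fun u => f u - derive1 f 0 * u) 0.
  apply: (cHD_eq (cHDB (cHDder (fd u)) (cHDZ _ (cHDid u)))).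
  by rewrite f'c mulr1 subrr.
have := holo_const H z 0; rewrite mulr0 subr0 => <-.
by rewrite subrK.
Qed.

End CauchyEstimates.

(** * Lifts and the surfaces they define *)

Section Matrices.
Variable R : realType.
Local Notation C := R[i].
Local Notation M2 := 'M[C]_2.
Local Notation Re := (@complex.Re R).
Local Notation Im := (@complex.Im R).

Lemma ord2 (i : 'I_2) : i = 0 \/ i = 1.
Proof. by case: i => [[|[|//]] p]; [left|right]; apply/val_inj. Qed.

Lemma mx2_eq (A B : M2) : A 0 0 = B 0 0 -> A 0 1 = B 0 1 -> A 1 0 = B 1 0 ->
  A 1 1 = B 1 1 -> A = B.
Proof.
by move=> ? ? ? ?; apply/matrixP => i j; case: (ord2 i) => ->; case: (ord2 j) => ->.
Qed.

Lemma mx2_00 (a b c d : C) : mx2 a b c d 0 0 = a. Proof. by rewrite mxE. Qed.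
Lemma mx2_01 (a b c d : C) : mx2 a b c d 0 1 = b. Proof. by rewrite mxE. Qed.
Lemma mx2_10 (a b c d : C) : mx2 a b c d 1 0 = c. Proof. by rewrite mxE. Qed.
Lemma mx2_11 (a b c d : C) : mx2 a b c d 1 1 = d. Proof. by rewrite mxE. Qed.
Definition mx2_ij := (mx2_00, mx2_01, mx2_10, mx2_11).

Lemma mx2_eta (A : M2) : A = mx2 (A 0 0) (A 0 1) (A 1 0) (A 1 1).
Proof. by apply: mx2_eq; rewrite mx2_ij. Qed.

Lemma sum2 (V : nmodType) (f : 'I_2 -> V) : \sum_i f i = f 0 + f 1.
Proof. by rewrite !big_ord_recl big_ord0 addr0; congr (f _ + f _); apply/val_inj. Qed.

Lemma mul2E (A B : M2) i j : (A *m B) i j = A i 0 * B 0 j + A i 1 * B 1 j.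
Proof. by rewrite mxE sum2. Qed.

Lemma mul_mx2 (a b c d a' b' c' d' : C) : mx2 a b c d *m mx2 a' b' c' d' =
  mx2 (a * a' + b * c') (a * b' + b * d') (c * a' + d * c') (c * b' + d * d').
Proof. by apply: mx2_eq; rewrite mul2E !mx2_ij. Qed.

Lemma add_mx2 (a b c d a' b' c' d' : C) : mx2 a b c d + mx2 a' b' c' d' =
  mx2 (a + a') (b + b') (c + c') (d + d').
Proof. by apply: mx2_eq; rewrite mxE !mx2_ij. Qed.

Lemma opp_mx2 (a b c d : C) : - mx2 a b c d = mx2 (- a) (- b) (- c) (- d).
Proof. by apply: mx2_eq; rewrite mxE !mx2_ij. Qed.

Lemma scale_mx2 (k a b c d : C) : k *: mx2 a b c d = mx2 (k * a) (k * b) (k * c) (k * d).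
Proof. by apply: mx2_eq; rewrite mxE !mx2_ij. Qed.

Lemma adjointE (A : M2) i j : adjoint A i j = (A j i)^*%C.
Proof. by rewrite !mxE. Qed.

Lemma adjoint_mx2 (a b c d : C) : adjoint (mx2 a b c d) = mx2 a^*%C c^*%C b^*%C d^*%C.
Proof. by apply: mx2_eq; rewrite adjointE !mx2_ij. Qed.

Lemma tr2 (A : M2) : \tr A = A 0 0 + A 1 1.
Proof. by rewrite /mxtrace sum2. Qed.

Lemma det2 (A : M2) : \det A = A 0 0 * A 1 1 - A 0 1 * A 1 0.
Proof.
rewrite {1}(mx2_eta A) (expand_det_row _ 0) sum2 /cofactor !det_mx11 !mxE /=.
by rewrite expr0 expr1 mul1r mulN1r mulrN.
Qed.

Lemma adj_mx2 (a b c d : C) : \adj (mx2 a b c d) = mx2 d (- b) (- c) a.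
Proof.
apply: mx2_eq; rewrite mxE mx2_ij /cofactor !det_mx11 !mxE /=;
  by rewrite ?expr0 ?expr1 ?expr2 ?mulrNN ?mulN1r ?mul1r.
Qed.

Lemma one_mx2 : (1%:M : M2) = mx2 1 0 0 1.
Proof. by apply: mx2_eq; rewrite mx2_ij mxE. Qed.

Lemma zero_mx2 : (0 : M2) = mx2 0 0 0 0.
Proof. by apply: mx2_eq; rewrite mx2_ij mxE. Qed.

Definition mx2E := (mul_mx2, add_mx2, opp_mx2, scale_mx2, adjoint_mx2, adj_mx2, one_mx2, zero_mx2).

Lemma adjointM (A B : M2) : adjoint (A *m B) = adjoint B *m adjoint A.
Proof. by rewrite /adjoint map_mxM trmx_mul. Qed.

Lemma adjointK (A : M2) : adjoint (adjoint A) = A.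
Proof. by apply/matrixP => i j; rewrite !adjointE conjcK. Qed.

Lemma adjointZ (k : C) (A : M2) : adjoint (k *: A) = k^*%C *: adjoint A.
Proof. by apply/matrixP => i j; rewrite !(adjointE, mxE) rmorphM. Qed.

Lemma det_adjoint (A : M2) : \det (adjoint A) = (\det A)^*%C.
Proof. by rewrite /adjoint det_tr det_map_mx. Qed.

Lemma adjM (A B : M2) : \adj (A *m B) = \adj B *m \adj A.
Proof.
by rewrite (mx2_eta A) (mx2_eta B) !mx2E; apply: mx2_eq; rewrite !mx2_ij; ring.
Qed.

Lemma invmx_det1 (A : M2) : \det A = 1 -> invmx A = \adj A.
Proof. by move=> A1; rewrite /invmx unitmxE A1 unitr1 invr1 scale1r. Qed.

Lemma unitmx_det1 (A : M2) : \det A = 1 -> A \in unitmx.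
Proof. by move=> A1; rewrite unitmxE A1 unitr1. Qed.

(** The product of the column (x, y) with the row (y, - x). In these spinor coordinates of the
    traceless singular matrices, the metric identities for a null curve become polynomial
    identities. *)
Definition nil (x y : C) : M2 := mx2 (x * y) (- x ^+ 2) (y ^+ 2) (- (x * y)).

Lemma nilP (A : M2) : \tr A = 0 -> \det A = 0 -> exists x y, A = nil x y.
Proof.
rewrite tr2 det2 => /eqP; rewrite addr_eq0 => /eqP A0.
rewrite A0 mulNr => /eqP; rewrite subr_eq0 => /eqP A1.
have [b0|b0] := eqVneq (A 0 1) 0.
  exists 0, (sqrtc (A 1 0)).
  have d0 : A 1 1 = 0.
    by apply/eqP; rewrite -sqrf_eq0 expr2 -oppr_eq0 A1 b0 mul0r.
  by rewrite {1}(mx2_eta A) /nil sqr_sqrtc A0 d0 b0 mul0r expr0n /= !oppr0.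
pose x := sqrtc (- A 0 1); have x2 : x ^+ 2 = - A 0 1 by rewrite sqr_sqrtc.
have x0 : x != 0 by rewrite sqrtc_eq0 oppr_eq0.
exists x, (A 0 0 / x).
rewrite {1}(mx2_eta A) /nil x2 expr_div_n x2 mulrC divfK// opprK A0 opprK.
have e2 : A 1 1 ^+ 2 = - (A 0 1 * A 1 0) by rewrite -A1 opprK expr2.
by congr mx2; rewrite sqrrN e2 invrN mulrNN mulrAC divff// mul1r.
Qed.

Definition fro (A : M2) : R :=
  nm (A 0 0) ^+ 2 + nm (A 0 1) ^+ 2 + nm (A 1 0) ^+ 2 + nm (A 1 1) ^+ 2.

Lemma nm2C (x : C) : (nm x ^+ 2)%:C = x * x^*%C.
Proof. by rewrite rmorphXn /= -nmE sqr_normc. Qed.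

Lemma nm2E (x : C) : nm x ^+ 2 = Re (x * x^*%C).
Proof. by rewrite -nm2C. Qed.

Lemma fro_nil (x y : C) : fro (nil x y) = (nm x ^+ 2 + nm y ^+ 2) ^+ 2.
Proof. by rewrite /fro /nil !mx2_ij !nmN !nmX !nmM; ring. Qed.

Lemma fro_ge0 (A : M2) : 0 <= fro A.
Proof. by rewrite !addr_ge0// sqr_ge0. Qed.

Lemma fro_eq0 (A : M2) : fro A = 0 -> A = 0.
Proof.
move=> /eqP; rewrite /fro !paddr_eq0 ?addr_ge0 ?sqr_ge0// !sqrf_eq0 !nm_eq0.
move=> /andP[/andP[/andP[/eqP a /eqP b] /eqP c] /eqP d].
by rewrite (mx2_eta A) a b c d zero_mx2.
Qed.

Lemma fro_tr (A : M2) : fro A = Re (\tr (A *m adjoint A)).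
Proof.
rewrite (mx2_eta A) !mx2E tr2 !mx2_ij /fro !mx2_ij !nm2E -!ReD; congr Re; ring.
Qed.

(** SL(2, C) acts isometrically on Minkowski space. All computations at a point of the surface are
    thereby moved to the identity matrix. *)
Lemma lprod_conj (F S T : M2) : \det F = 1 ->
  lprod (F *m S *m adjoint F) (F *m T *m adjoint F) = lprod S T.
Proof.
move=> F1; rewrite /lprod; suff -> : \tr (F *m S *m adjoint F *m \adj (F *m T *m adjoint F)) = \tr (S *m \adj T) by [].
have aF1 : \det (adjoint F) = 1 by rewrite det_adjoint F1 conjc1.
rewrite !adjM -!mulmxA mxtrace_mulC -!mulmxA.
rewrite (mulmxA (adjoint F)) mul_mx_adj aF1 mul1mx mulmxA.
by rewrite -!mulmxA mul_adj_mx F1 mulmx1.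
Qed.

Lemma lprodDl (X Y Z : M2) : lprod (X + Y) Z = lprod X Z + lprod Y Z.
Proof. by rewrite /lprod mulmxDl mxtraceD ReD; lra. Qed.

Lemma lprodZl (k : R) (X Y : M2) : lprod (k%:C *: X) Y = k * lprod X Y.
Proof.
by rewrite /lprod -scalemxAl mxtraceZ ReM /= mul0r subr0; lra.
Qed.

Lemma adjZ2 (k : C) (X : M2) : \adj (k *: X) = k *: \adj X.
Proof. by rewrite (mx2_eta X) !mx2E; congr mx2; ring. Qed.

Lemma lprodZr (k : R) (X Y : M2) : lprod X (k%:C *: Y) = k * lprod X Y.
Proof.
by rewrite /lprod adjZ2 -scalemxAr mxtraceZ ReM /= mul0r subr0; lra.
Qed.

Lemma lprodE (X Y : M2) (r : R) : \tr (X *m \adj Y) = (- 2 * r)%:C -> lprod X Y = r.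
Proof. by move=> H; rewrite /lprod H /=; lra. Qed.

Section Nilpotent.
Variables x y : C.
Let N := nil x y.
Let k := fro N.
(** For A = F^(-1) dF this commutator is normal to the surface translated to the identity, and
    [fro A] is its length. The matrices [S t] are the tangent vectors there. *)
Definition nil_normal (A : M2) := A *m adjoint A - adjoint A *m A.
Let H := nil_normal N.
Let S t := t *: N + adjoint (t *: N).

Let kE : k%:C = (x * x^*%C + y * y^*%C) ^+ 2.
Proof. by rewrite /k fro_nil rmorphXn rmorphD /= !nm2C. Qed.

Lemma lprod_tangent t s : lprod (S t) (S s) = Re (t * s^*%C) * k.
Proof.
apply: lprodE; rewrite rmorphM rmorphM /= kE rmorphN rmorph_nat.
rewrite mulrA; have -> : -2 * (Re (t * s^*%C))%:C = - (t * s^*%C + t^*%C * s).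
  by rewrite mulNr -addcJ (rmorphM conjc) /= conjcK.
rewrite /S /N /nil !mx2E !(rmorphM, rmorphN, rmorphXn) /=.
by rewrite tr2 !mx2_ij; ring.
Qed.

Lemma lprod_normal : lprod H H = k ^+ 2.
Proof.
apply: lprodE; rewrite rmorphM rmorphXn /= kE rmorphN rmorph_nat.
rewrite /H /nil_normal /N /nil !mx2E !(rmorphM, rmorphN, rmorphXn) /=.
by rewrite tr2 !mx2_ij; ring.
Qed.

Lemma lprod_normal_tangent t : lprod H (S t) = 0.
Proof.
apply: lprodE; rewrite mulr0.
rewrite /S /H /nil_normal /N /nil !mx2E !(rmorphM, rmorphN, rmorphXn) /=.
by rewrite tr2 !mx2_ij; ring.
Qed.

Lemma lprod_normal_one : lprod H 1%:M = 0.
Proof.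
apply: lprodE; rewrite mulr0.
rewrite /H /nil_normal /N /nil !mx2E !(rmorphM, rmorphN, rmorphXn) /=.
by rewrite tr2 !mx2_ij; ring.
Qed.

(** The source of the mean curvature 1: the Laplacian of the surface is a multiple of
    [N *m adjoint N], translated by F. *)
Lemma lprod_normal_laplacian : lprod (N *m adjoint N) H = k ^+ 2 / 2.
Proof.
apply: lprodE; rewrite (_ : -2 * (k ^+ 2 / 2) = - k ^+ 2); last by field.
rewrite rmorphN rmorphXn /= kE.
rewrite /H /nil_normal /N /nil !mx2E !(rmorphM, rmorphN, rmorphXn) /=.
by rewrite tr2 !mx2_ij; ring.
Qed.

Lemma adjoint_normal : adjoint H = H.
Proof.
rewrite /H /nil_normal /N /nil !mx2E !(rmorphM, rmorphN, rmorphXn) /=.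
by congr mx2; rewrite !(rmorphD, rmorphM, rmorphN, rmorphXn) /= ?conjcK; ring.
Qed.

End Nilpotent.

End Matrices.

(** * The surface of a null lift is conformal of constant mean curvature one *)

Section Bryant.
Variable R : realType.
Local Notation C := R[i].
Local Notation M2 := 'M[C]_2.
Local Notation Re := (@complex.Re R).
Local Notation Im := (@complex.Im R).
Local Notation Ci := (@Complex R 0 1).

Lemma add2E (A B : M2) i j : (A + B) i j = A i j + B i j. Proof. by rewrite mxE. Qed.
Lemma scale2E (k : C) (A : M2) i j : (k *: A) i j = k * A i j. Proof. by rewrite mxE. Qed.

Definition entireM (F : C -> M2) := forall w i j, derivable (fun u => F u i j) w 1.

Lemma entireM_HD (F : C -> M2) (w : C) i j : entireM F ->
  is_derive w 1 (fun u => F u i j) (dmx F w i j).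
Proof. by move=> eF; rewrite mxE; exact: cHDder. Qed.

Lemma entireM_dmx (F : C -> M2) : entireM F -> entireM (dmx F).
Proof.
move=> eF w i j; have -> : (fun u => dmx F u i j) = derive1 (fun u => F u i j).
  by apply/funext => u; rewrite mxE.
by apply: (@holo_derive1 R _ w 1) => // z _; exact: eF.
Qed.

Lemma dmxE (F D : C -> M2) (w : C) :
  (forall i j, is_derive w 1 (fun u => F u i j) (D w i j)) -> dmx F w = D w.
Proof. by move=> H; apply/matrixP => i j; rewrite mxE; apply: cHD1. Qed.

Lemma CDsum (I : Type) (r : seq I) (f : I -> R -> C) t (d : I -> C) :
  (forall a, CD (f a) t (d a)) -> CD (fun s => \sum_(a <- r) f a s) t (\sum_(a <- r) d a).
Proof.
move=> fd; elim: r => [|a r IH].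
  rewrite big_nil; under eq_fun do rewrite big_nil.
  by split; exact: HDc.
by rewrite big_cons; under eq_fun do rewrite big_cons; exact: CDD.
Qed.

Lemma contsum (I : Type) (r : seq I) (f : I -> C -> C) x :
  (forall a, {for x, continuous (f a)}) -> {for x, continuous (fun s => \sum_(a <- r) f a s)}.
Proof.
move=> fd; elim: r => [|a r IH].
  have -> : (fun s => \sum_(a <- [::]) f a s) = fun=> 0.
    by apply/funext => u; rewrite big_nil.
  by apply/contC_P => e e0; exists 1 => // u _; rewrite subrr nm0.
have -> : (fun s => \sum_(b <- a :: r) f b s) = fun s => f a s + \sum_(b <- r) f b s.
  by apply/funext => u; rewrite big_cons.
exact: (cvgD (fd a) IH).
Qed.

Lemma contJ (f : C -> C) x : {for x, continuous f} -> {for x, continuous (fun u => (f u)^*%C)}.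
Proof.
move=> /contC_P H; apply/contC_P => e /H[d d0 Hd]; exists d => // u /Hd.
by rewrite -rmorphB nmJ.
Qed.

(** Sums of a holomorphic times an antiholomorphic factor on the cover. The class contains [F F^*]
    and is stable under [pd], so smoothness follows by induction on the number of derivatives, and
    each derivative is explicit. *)
Definition bihol_sum (I : finType) (H K : I -> C -> M2) (f : C -> M2) :=
  [/\ forall a, entireM (H a), forall a, entireM (K a) &
      forall w, f (cexp w) = \sum_a H a w *m adjoint (K a w)].

Lemma bihol_entry (I : finType) (H K : I -> C -> M2) w i j :
  (\sum_a H a w *m adjoint (K a w)) i j =
  \sum_a (H a w i 0 * (K a w j 0)^*%C + H a w i 1 * (K a w j 1)^*%C).
Proof. by rewrite summxE; apply: eq_bigr => a _; rewrite mul2E !adjointE. Qed.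

Lemma bihol_CD_path (I : finType) (H K : I -> C -> M2) f w (c : R -> C) t0 v i j :
  bihol_sum H K f -> c t0 = cexp w -> CD c t0 v ->
  CD (fun t => f (c t) i j) t0
    ((\sum_a ((v / cexp w *: dmx (H a) w) *m adjoint (K a w)
        + H a w *m adjoint (v / cexp w *: dmx (K a) w))) i j).
Proof.
move=> [eH eK fE] cw dc; have [s [sw cs ds]] := cexp_section w.
pose sg (t : R) := s (c t).
have sg0 : sg t0 = w by rewrite /sg cw.
have dsg : CD sg t0 (v / cexp w).
  have ds' : is_derive (c t0) 1 s (cexp w)^-1 by rewrite cw.
  by apply: (CD_eq (CDcomp ds' dc)); rewrite mulrC.
have fsg : \forall t \near t0, \sum_a (H a (sg t) i 0 * (K a (sg t) j 0)^*%C
    + H a (sg t) i 1 * (K a (sg t) j 1)^*%C) = f (c t) i j.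
  have cc := CDcont dc; rewrite /prop_for /continuous_at cw in cc.
  have Hs : \forall t \near t0, cexp (s (c t)) = c t := cc _ cs.
  by apply: filterS Hs => t Ht; rewrite -bihol_entry -fE /sg Ht.
apply: (CD_near fsg).
have entd (G : C -> M2) k l : entireM G -> CD (fun t => G (sg t) k l) t0 (v / cexp w * dmx G w k l).
  move=> eG; have := entireM_HD w k l eG; rewrite -{1}sg0 => dG.
  by apply: (CD_eq (CDcomp dG dsg)); rewrite mulrC.
rewrite summxE; apply: CDsum => a.
have Ha k l := entd _ k l (eH a); have Ka k l := CDJ (entd _ k l (eK a)).
apply: (CD_eq (CDD (CDM (Ha i 0) (Ka j 0)) (CDM (Ha i 1) (Ka j 1)))).
by rewrite sg0; move: (dmx (H a) w) (dmx (K a) w) => DH DK; rewrite add2E !mul2E !adjointE !scale2E; ring.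
Qed.

Lemma bihol_CD (I : finType) (H K : I -> C -> M2) f w v i j : bihol_sum H K f ->
  CD (fun t => f (cexp w + t%:C * v) i j) 0
    ((\sum_a ((v / cexp w *: dmx (H a) w) *m adjoint (K a w)
        + H a w *m adjoint (v / cexp w *: dmx (K a) w))) i j).
Proof.
move=> bf; apply: (bihol_CD_path i j bf _ (CDline (cexp w) v 0)).
by rewrite mul0r addr0.
Qed.

Lemma bihol_pdE (I : finType) (H K : I -> C -> M2) f w v : bihol_sum H K f ->
  pd v f (cexp w) = \sum_a ((v / cexp w *: dmx (H a) w) *m adjoint (K a w)
        + H a w *m adjoint (v / cexp w *: dmx (K a) w)).
Proof.
move=> bf; apply/matrixP => i j; rewrite mxE.
have [d1 d2] := bihol_CD w v i j bf.
by rewrite (HD1 d1) (HD1 d2) -complexRI.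
Qed.

Lemma entireM_scale (G : C -> M2) (k : C -> C) :
  (forall w : C, derivable k w 1) -> entireM G -> entireM (fun w => k w *: G w).
Proof.
move=> dk eG w i j; have -> : (fun u => (k u *: G u) i j) = (fun u => k u * G u i j).
  by apply/funext => u; rewrite mxE.
exact: cHDd (cHDM (cHDder (dk w)) (cHDder (eG w i j))).
Qed.

Lemma HD_cexpV (v w : C) : is_derive w 1 (fun u => v / cexp u) (- v / cexp w).
Proof.
apply: (cHD_eq (cHDZ v (cHDV (cexp_neq0 w) (HD_cexp w)))).
by have := cexp_neq0 w => ?; field.
Qed.

(** The product rule doubles the index set: [true] marks the terms whose holomorphic factor is
    differentiated. The factor [v / cexp w] is the direction [v] read in the coordinate w, since dw
    = dz / z. *)
Lemma bihol_pd (I : finType) (H K : I -> C -> M2) f v : bihol_sum H K f ->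
  bihol_sum (fun p : bool * I => if p.1 then fun w => v / cexp w *: dmx (H p.2) w else H p.2)
    (fun p : bool * I => if p.1 then K p.2 else fun w => v / cexp w *: dmx (K p.2) w) (pd v f).
Proof.
move=> bf; have [eH eK fE] := bf.
have dv (w : C) : derivable (fun u : C => v / cexp u) w 1 by exact: cHDd (HD_cexpV v w).
split.
- by move=> [[] a] //=; apply: entireM_scale => //; exact: entireM_dmx.
- by move=> [[] a] //=; apply: entireM_scale => //; exact: entireM_dmx.
- move=> w; rewrite (bihol_pdE w v bf) big_split /=.
  rewrite -(pair_bigA _ (fun b a => (if b then fun w => v / cexp w *: dmx (H a) w else H a) w
     *m adjoint ((if b then K a else fun w => v / cexp w *: dmx (K a) w) w))) /=.
  by rewrite big_bool.
Qed.

Lemma bihol_smooth (I : finType) (H K : I -> C -> M2) f : bihol_sum H K f ->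
  smooth_on (@Cstar R) f.
Proof.
move=> bf s z i j /cexp_surj[w <-].
have {I H K bf} [I [H [K bs]]] : exists (I : finType) (H K : I -> C -> M2),
    bihol_sum H K (foldr (@pd R) f s).
  elim: s => [|v s [J [H' [K' bs]]]]; first by exists I, H, K.
  by eexists; eexists; eexists; exact: (bihol_pd v bs).
split; last by move=> v; have [d1 d2] := bihol_CD w v i j bs; split; [case: d1 | case: d2].
set h := foldr _ _ _ in bs *.
have [eH eK fE] := bs; have [sc [sw cs ds]] := cexp_section w.
have entc (G : C -> M2) k l : entireM G -> {for cexp w, continuous (fun u => G (sc u) k l)}.
  move=> eG; have := entireM_HD w k l eG; rewrite -{1}sw => dG.
  exact: cHDcont (cHDcomp dG ds).
have Hc : {for cexp w, continuous (fun u => \sum_a (H a (sc u) i 0 * (K a (sc u) j 0)^*%C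
    + H a (sc u) i 1 * (K a (sc u) j 1)^*%C))}.
  apply: contsum => a.
  exact: (cvgD (cvgM (entc _ _ _ (eH a)) (contJ (entc _ _ _ (eK a))))
               (cvgM (entc _ _ _ (eH a)) (contJ (entc _ _ _ (eK a))))).
move/contC_P : Hc => Hc; apply/contC_P => e /Hc[d d0 Hd].
have /nearCP[d' d'0 Hd'] := cs.
exists (Num.min d d') => [|u]; first by rewrite lt_min d0.
rewrite lt_min => /andP[/Hd + /Hd' ucs].
have fu : h u i j = (\sum_a H a (sc u) *m adjoint (K a (sc u))) i j by rewrite -fE ucs.
by rewrite fu fE !bihol_entry sw.
Qed.

Lemma sum_unit (V : nmodType) (g : unit -> V) : \sum_a g a = g tt.
Proof. by rewrite (big_pred1 tt) //; case. Qed.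

Lemma adjointN (A : M2) : adjoint (- A) = - adjoint A.
Proof. by apply/matrixP => i j; rewrite !(adjointE, mxE) rmorphN. Qed.

Section Lift.
Variables f F : C -> M2.
Hypothesis bF : bryant_lift f F.

Let eF : entireM F. Proof. by case: bF. Qed.
Let F1 w : \det (F w) = 1. Proof. by case: bF => _ H _ _. Qed.

Lemma lift_bihol : bihol_sum (fun _ : unit => F) (fun _ : unit => F) f.
Proof.
split; [by move=> _; exact: eF | by move=> _; exact: eF |].
by move=> w; rewrite sum_unit; case: bF => _ _ _ ->.
Qed.

Lemma det1_tr (G : C -> M2) (w : C) :
  entireM G -> (forall w, \det (G w) = 1) -> \tr (mc_form G w) = 0.
Proof.
move=> eG G1; rewrite /mc_form invmx_det1// (mx2_eta (G w)) (mx2_eta (dmx G w)) !mx2E tr2 !mx2_ij.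
have d k l := entireM_HD w k l eG.
have H := cHDB (cHDM (d 0 0) (d 1 1)) (cHDM (d 0 1) (d 1 0)).
have : is_derive w 1 (fun _ : C => 1 : C) (dmx G w 0 0 * G w 1 1 + G w 0 0 * dmx G w 1 1 -
   (dmx G w 0 1 * G w 1 0 + G w 0 1 * dmx G w 1 0)).
  by apply: (cHD_near _ H); apply/nearCP; exists 1 => // u _; rewrite -det2.
move=> /cHD1; rewrite (cHD1 (cHDc (1 : C) w)) => E; rewrite [RHS]E; ring.
Qed.

Lemma lift_dmx w : dmx F w = F w *m mc_form F w.
Proof. by rewrite /mc_form mulKVmx// unitmx_det1. Qed.

Lemma lift_nil w : exists x y, mc_form F w = nil x y.
Proof. by apply: nilP; [exact: det1_tr | case: bF => _ _ /(_ w)[]]. Qed.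

Lemma lift_fro w : 0 < fro (mc_form F w).
Proof.
rewrite lt_def fro_ge0 andbT; apply/eqP => /fro_eq0 N0.
by case: bF => _ _ /(_ w)[/eqP D0 _] _; apply: D0; rewrite lift_dmx N0 mulmx0.
Qed.

Lemma lift_pd0 v w : pd v f (cexp w) = (v / cexp w *: dmx F w) *m adjoint (F w) +
  F w *m adjoint (v / cexp w *: dmx F w).
Proof. by rewrite (bihol_pdE w v lift_bihol) sum_unit. Qed.

Lemma lift_pd v w : pd v f (cexp w) = F w *m (v / cexp w *: mc_form F w
   + adjoint (v / cexp w *: mc_form F w)) *m adjoint (F w).
Proof. by rewrite lift_pd0 lift_dmx scalemxAr adjointM mulmxDr mulmxDl !mulmxA. Qed.

Lemma nm_Vcexp (w : C) : nm (cexp w)^-1 ^+ 2 = (nm (cexp w) ^+ 2)^-1.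
Proof. by rewrite nmV exprVn. Qed.

Lemma lift_conf_factor w : conf_factor f (cexp w) = fro (mc_form F w) / nm (cexp w) ^+ 2.
Proof.
have [x [y Nxy]] := lift_nil w.
rewrite /conf_factor lift_pd lprod_conj// Nxy lprod_tangent mulrC; congr (_ * _).
by rewrite div1r -nm_Vcexp nm2E.
Qed.

Let entireM_D v : entireM (fun u => v / cexp u *: dmx F u).
Proof.
apply: entireM_scale; last exact: entireM_dmx.
by move=> w; exact: cHDd (HD_cexpV v w).
Qed.

Lemma lift_pd_bihol v : bihol_sum
  (fun b : bool => if b then fun u => v / cexp u *: dmx F u else F)
  (fun b : bool => if b then F else fun u => v / cexp u *: dmx F u) (pd v f).
Proof.
split; [case; [exact: entireM_D|exact: eF]|case; [exact: eF|exact: entireM_D]|move=> w].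
by rewrite lift_pd0 big_bool.
Qed.

(** The terms in which one factor is differentiated twice cancel between the directions 1 and i,
    because i^2 = -1. Each direction leaves the mixed term twice, whence the 4. *)
Lemma lift_laplacian w : pd 1 (pd 1 f) (cexp w) + pd Ci (pd Ci f) (cexp w) =
  F w *m ((4 / nm (cexp w) ^+ 2)%:C *: (mc_form F w *m adjoint (mc_form F w))) *m adjoint (F w).
Proof.
have e0 := cexp_neq0 w.
have E v : pd v (pd v f) (cexp w) =
  (v / cexp w *: dmx (fun u => v / cexp u *: dmx F u) w) *m adjoint (F w) +
  (v / cexp w *: dmx F w) *m adjoint (v / cexp w *: dmx F w) +
  ((v / cexp w *: dmx F w) *m adjoint (v / cexp w *: dmx F w) +
  F w *m adjoint (v / cexp w *: dmx (fun u => v / cexp u *: dmx F u) w)).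
  by rewrite (bihol_pdE w v (lift_pd_bihol v)) big_bool.
have D2 v : dmx (fun u => v / cexp u *: dmx F u) w = v *: dmx (fun u => 1 / cexp u *: dmx F u) w.
  have e1 := @entireM_D 1; set G := (fun u => 1 / cexp u *: dmx F u) in e1 *.
  apply: (@dmxE _ (fun w => v *: dmx G w)) => i j.
  have H := cHDZ v (entireM_HD w i j e1); apply: (cHD_near _ (cHD_eq H _)).
    apply/nearCP; exists 1 => // u _.
    by rewrite /G; move: (dmx F u) => M; rewrite !scale2E; ring.
  by move: (dmx G w) => M; rewrite scale2E.
rewrite (E 1) (E Ci) (D2 1) (D2 Ci) lift_dmx.
set D := dmx (fun u => 1 / cexp u *: dmx F u) w; set N := mc_form F w; set A := F w.
have i2 : (Ci / cexp w) *: (Ci *: D) = - ((1 / cexp w) *: (1 *: D)).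
  by rewrite !scalerA mulr1 mulrAC -expr2 sqr_i mulN1r scaleNr div1r.
have CvB (B : M2) (v : C) : (v / cexp w *: B) *m adjoint (v / cexp w *: B) =
   (nm v ^+ 2 / nm (cexp w) ^+ 2)%:C *: (B *m adjoint B).
  by rewrite adjointZ -scalemxAl -scalemxAr scalerA -nm2C nmM nmV expr_div_n.
have Cv (B B' : M2) (v : C) : (v / cexp w *: (B *m B')) *m adjoint (v / cexp w *: (B *m B')) =
   (nm v ^+ 2 / nm (cexp w) ^+ 2)%:C *: (B *m (B' *m adjoint B') *m adjoint B).
  by rewrite CvB adjointM !mulmxA.
have ni : nm Ci = 1 by rewrite /nm /= expr0n expr1n add0r sqrtr1.
rewrite i2 !Cv ni nm1 expr1n adjointN mulNmx mulmxN.
have aux (X Y Z : M2) : X + Z + (Z + Y) + (- X + Z + (Z - Y)) = 4 *: Z.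
  by apply/matrixP => i j; rewrite !mxE; ring.
rewrite aux scalerA -scalemxAr -scalemxAl; congr (_ *: _).
by rewrite rmorphM [in RHS]rmorphM rmorph1 mul1r rmorph_nat.
Qed.

Theorem lift_cmc1 :
  [/\ forall z, (@Cstar R) z -> hyperbolic_space (f z),
      smooth_on (@Cstar R) f,
      conformal_immersion_on (@Cstar R) f &
      forall z, (@Cstar R) z -> exists N, unit_normal f z N /\ mean_curvature f z N = 1].
Proof.
have ec w : 0 < nm (cexp w) ^+ 2 :> R by rewrite exprn_gt0// nm_gt0 cexp_neq0.
have ni : nm Ci = 1 by rewrite /nm /= expr0n expr1n add0r sqrtr1.
split.
- move=> z /cexp_surj[w <-]; exists (F w); split; first exact: F1.
  by case: bF => _ _ _ ->.
- exact: bihol_smooth lift_bihol.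
- move=> z /cexp_surj[w <-]; rewrite lift_conf_factor; have [x [y Nxy]] := lift_nil w.
  split; first by rewrite divr_gt0// lift_fro.
    rewrite lift_pd lprod_conj// Nxy lprod_tangent mulrC; congr (_ * _).
    by rewrite -nm2E nmM nmV ni mul1r exprVn.
  rewrite !lift_pd lprod_conj// Nxy lprod_tangent.
  have -> : 1 / cexp w * (Ci / cexp w)^*%C = (nm (cexp w)^-1 ^+ 2)%:C * - Ci.
    rewrite nm2C (rmorphM conjc) /= div1r mulrCA mulrC.
    by congr (_ * _); apply/eqP; rewrite eq_complex /= oppr0 !eqxx.
  by rewrite ReM /= oppr0 mulr0 mul0r subr0 mul0r.
- move=> z /cexp_surj[w <-]; have [x [y Nxy]] := lift_nil w.
  pose k := fro (mc_form F w); have k0 : 0 < k := lift_fro w.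
  have kE : k = fro (nil x y) by rewrite /k Nxy.
  pose H := nil_normal (nil x y).
  exists (F w *m (k^-1%:C *: H) *m adjoint (F w)); split; first split.
  + by rewrite !adjointM adjointK adjointZ conjc_real adjoint_normal mulmxA.
  + rewrite lprod_conj// lprodZl lprodZr lprod_normal -kE.
    have kn : k != 0 by rewrite gt_eqF.
    by field.
  + have -> : f (cexp w) = F w *m 1%:M *m adjoint (F w) by rewrite mulmx1; case: bF.
    by rewrite lprod_conj// lprodZl lprod_normal_one mulr0.
  + by rewrite lift_pd lprod_conj// Nxy lprodZl lprod_normal_tangent mulr0.
  + by rewrite lift_pd lprod_conj// Nxy lprodZl lprod_normal_tangent mulr0.
  rewrite /mean_curvature -lprodDl lift_laplacian lprod_conj// lift_conf_factor.
  rewrite Nxy lprodZl lprodZr lprod_normal_laplacian -kE.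
  have kn : k != 0 by rewrite gt_eqF.
  have en : nm (cexp w) != 0 by rewrite nm_eq0 cexp_neq0.
  by field; apply/andP.
Qed.

End Lift.
End Bryant.

(** * The Hopf differential *)

Section Hopf.
Variable R : realType.
Local Notation C := R[i].
Local Notation M2 := 'M[C]_2.

Lemma ratioM (k a b : C) : k != 0 -> Defs.ratio (k * a) (k * b) = Defs.ratio a b.
Proof.
move=> k0; rewrite /Defs.ratio mulf_eq0 (negbTE k0) /=; case: eqP => [//|/eqP b0].
by rewrite invfM mulrACA divff// mul1r.
Qed.

Lemma ratio_neq0 (a b : C) : b != 0 -> Defs.ratio a b = Some (a / b).
Proof. by rewrite /Defs.ratio => /negbTE ->. Qed.

Lemma hyp_gauss_finite (F : C -> M2) w (G : C) : dmx F w != 0 ->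
  dmx F w 0 0 = G * dmx F w 1 0 -> dmx F w 0 1 = G * dmx F w 1 1 ->
  hyp_gauss F w = Some G.
Proof.
rewrite /hyp_gauss; move: (dmx F w) => D D0 D1 D2.
case: ifPn => [|/norP[/negbNE/eqP a0 /negbNE/eqP b0]].
  rewrite D1; have [->|d0] := eqVneq (D 1 0) 0; first by rewrite mulr0 eqxx.
  by rewrite ratio_neq0// mulfK.
have d1 : D 1 1 != 0.
  apply: contraNneq D0 => d; apply/eqP; rewrite (mx2_eta D) zero_mx2.
  by congr mx2 => //; rewrite D2 d mulr0.
by rewrite D2 ratio_neq0// mulfK.
Qed.

(** If F^(-1) dF is [nil x y], both rows of dF are multiples of (y, - x), and they do not both
    vanish; either one gives g = x / y. *)
Lemma sec_gaussE (f F : C -> M2) w : bryant_lift f F ->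
  sec_gauss F w = Defs.ratio (mc_form F w 0 0) (mc_form F w 1 0).
Proof.
move=> bF; have [x [y Nxy]] := lift_nil bF w.
have F1 : \det (F w) = 1 by case: bF.
rewrite /sec_gauss (lift_dmx bF) Nxy !mul2E /nil !mx2_ij; rewrite det2 in F1.
set a := F w 0 0 in F1 *; set b := F w 0 1 in F1 *.
set c := F w 1 0 in F1 *; set d := F w 1 1 in F1 *.
have e1 : a * (x * y) + b * y ^+ 2 = y * (a * x + b * y) by ring.
have e2 : - (a * - x ^+ 2 + b * - (x * y)) = x * (a * x + b * y) by ring.
have e3 : c * (x * y) + d * y ^+ 2 = y * (c * x + d * y) by ring.
have e4 : - (c * - x ^+ 2 + d * - (x * y)) = x * (c * x + d * y) by ring.
have nz : (x != 0) || (y != 0).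
  have N0 := lift_fro bF w; rewrite Nxy fro_nil in N0.
  rewrite -negb_and; apply: contraTN N0 => /andP[/eqP -> /eqP ->].
  by rewrite nm0 expr0n addr0 expr0n ltxx.
have rE : Defs.ratio (x * y) (y ^+ 2) = Defs.ratio x y.
  have [->|y0] := eqVneq y 0; first by rewrite /Defs.ratio expr0n !eqxx.
  by rewrite mulrC expr2 ratioM.
rewrite rE -(oppr_eq0 (a * _ + b * - _)) e2 e4 e1 e3.
have [ab|ab] := eqVneq (a * x + b * y) 0.
  have cd : c * x + d * y != 0.
    apply: contraTN nz => /eqP cd.
    have xE : x = d * (a * x + b * y) - b * (c * x + d * y) by rewrite -[LHS]mul1r -F1; ring.
    have yE : y = a * (c * x + d * y) - c * (a * x + b * y) by rewrite -[LHS]mul1r -F1; ring.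
    rewrite ab cd !mulr0 subr0 in xE yE.
    by rewrite xE yE eqxx.
  by rewrite ab !mulr0 eqxx /= !(mulrC _ (c * x + d * y)) ratioM.
have -> : (y * (a * x + b * y) != 0) || (x * (a * x + b * y) != 0).
  by rewrite !mulf_eq0 (negbTE ab) !orbF orbC.
by rewrite !(mulrC _ (a * x + b * y)) ratioM.
Qed.

(** The condition dF F^(-1) d^2F = Q dF. It is polynomial in F and its derivatives and is kept by
    left multiplication of F with constants. *)
Definition hopf_rel (F : C -> M2) (Q : C -> C) := forall w,
  dmx F w *m \adj (F w) *m dmx (dmx F) w = Q w *: dmx F w.

Section Algebra.
Variables (m n l Q d : C) (N' : M2).
Hypothesis ml : m ^+ 2 + n * l = 0.
Hypothesis N11 : N' 1 1 = - N' 0 0.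
Hypothesis Nd : 2 * (m * N' 0 0) + (N' 0 1 * l + n * N' 1 0) = 0.

(** [m], [n], [l] stand for the entries of F^(-1) dF and [N'] for its derivative, so that [Nd] is
    the derivative of [ml]. Here g has a pole and [d] is the derivative of 1/g; in the other case g
    = m / l and [d] is its derivative. *)
Lemma hopf_algebra_infty : l = 0 -> m = 0 -> n != 0 -> d * n = - N' 0 0 ->
  d *: mx2 m n l (- m) = Q *: mx2 0 1 0 0 <-> mx2 m n l (- m) *m N' = Q *: mx2 m n l (- m).
Proof.
move=> l0 m0 n0 dE; rewrite m0 l0 oppr0 (mx2_eta N') !mx2E.
have N10 : N' 1 0 = 0.
  by move: Nd; rewrite m0 l0 mul0r !mulr0 !add0r => /eqP; rewrite mulf_eq0 (negbTE n0) => /eqP.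
split=> E; have := congr1 (fun M : M2 => M 0 1) E; rewrite /= !mx2_ij => QE.
  rewrite dE mulr1 in QE.
  by apply: mx2_eq; rewrite !mx2_ij ?N10 ?N11 -?QE; ring.
rewrite N11 mul0r add0r in QE.
have {}QE : - N' 0 0 = Q by apply: (mulfI n0); rewrite QE mulrC.
by apply: mx2_eq; rewrite !mx2_ij ?dE ?QE; ring.
Qed.

Lemma hopf_algebra_finite : l != 0 -> d * l ^+ 2 = N' 0 0 * l - m * N' 1 0 ->
  d *: mx2 m n l (- m) = Q *: mx2 (m / l) (- (m / l) ^+ 2) 1 (- (m / l)) <->
  mx2 m n l (- m) *m N' = Q *: mx2 m n l (- m).
Proof.
move=> l0 dE; rewrite (mx2_eta N') mul_mx2 !scale_mx2; split=> E.
  have := congr1 (fun M : M2 => M 1 0) E; rewrite /= !mx2_ij mulr1 => QE.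
  have {}QE : N' 0 0 * l - m * N' 1 0 = Q * l by rewrite -dE -QE; ring.
  have e00 : m * N' 0 0 + n * N' 1 0 = Q * m.
    apply: (mulIf l0); rewrite mulrAC -QE.
    have -> : (m * N' 0 0 + n * N' 1 0) * l = (N' 0 0 * l - m * N' 1 0) * m
       + (m ^+ 2 + n * l) * N' 1 0 by ring.
    by rewrite ml mul0r addr0.
  have e01 : m * N' 0 1 - n * N' 0 0 = Q * n.
    apply: (mulIf l0).
    have -> : (m * N' 0 1 - n * N' 0 0) * l =
      m * (2 * (m * N' 0 0) + (N' 0 1 * l + n * N' 1 0)) - (m ^+ 2 + n * l) * N' 0 0
      - m * (m * N' 0 0 + n * N' 1 0) by ring.
    rewrite Nd ml e00.
    have -> : m * 0 - 0 * N' 0 0 - m * (Q * m) =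
      - Q * (m ^+ 2 + n * l) + Q * n * l by ring.
    by rewrite ml mulr0 add0r.
  rewrite N11; apply: mx2_eq; rewrite !mx2_ij.
  - exact: e00.
  - by rewrite -e01; ring.
  - by rewrite -QE; ring.
  - have -> : l * N' 0 1 + - m * - N' 0 0 =
      (2 * (m * N' 0 0) + (N' 0 1 * l + n * N' 1 0)) - (m * N' 0 0 + n * N' 1 0) by ring.
    by rewrite Nd e00; ring.
have := congr1 (fun M : M2 => M 1 0) E; rewrite /= !mx2_ij => QE.
have {}dE : d = Q / l.
  apply: (mulIf (expf_neq0 2 l0)); rewrite dE.
  have -> : N' 0 0 * l - m * N' 1 0 = l * N' 0 0 + - m * N' 1 0 by ring.
  by rewrite QE; field.
have nE : n = - m ^+ 2 / l.
  by apply: (mulIf l0); rewrite divfK//; apply/eqP; rewrite -addr_eq0 addrC ml.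
by rewrite dE; apply: mx2_eq; rewrite !mx2_ij ?nE; field.
Qed.

End Algebra.

Section Equivalence.
Variables f F : C -> M2.
Hypothesis bF : bryant_lift f F.
Let eF : entireM F. Proof. by case: bF. Qed.
Let F1 w : \det (F w) = 1. Proof. by case: bF. Qed.

Lemma lift_mc w : mc_form F w = \adj (F w) *m dmx F w.
Proof. by rewrite /mc_form invmx_det1. Qed.

Lemma lift_det w : \det (dmx F w) = 0.
Proof. by rewrite (lift_dmx bF) det_mulmx; case: bF => _ _ /(_ w)[_ ->] _; rewrite mulr0. Qed.

(** In the product rule for adj(F) dF, the term adj(dF) dF is det(dF) times the identity, which
    vanishes. *)
Lemma HD_mc (w : C) i j :
  is_derive w 1 (fun u => mc_form F u i j) ((\adj (F w) *m dmx (dmx F) w) i j).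
Proof.
have d0 := lift_det w; rewrite det2 in d0.
have dF k l := entireM_HD w k l eF; have dD k l := entireM_HD w k l (entireM_dmx eF).
have E u : mc_form F u = mx2 (F u 1 1 * dmx F u 0 0 - F u 0 1 * dmx F u 1 0)
    (F u 1 1 * dmx F u 0 1 - F u 0 1 * dmx F u 1 1)
    (F u 0 0 * dmx F u 1 0 - F u 1 0 * dmx F u 0 0)
    (F u 0 0 * dmx F u 1 1 - F u 1 0 * dmx F u 0 1).
  rewrite lift_mc; move: (dmx F u) => D; rewrite (mx2_eta (F u)) {1}(mx2_eta D) !mx2E !mx2_ij.
  by congr mx2; ring.
have E' : \adj (F w) *m dmx (dmx F) w =
    mx2 (F w 1 1 * dmx (dmx F) w 0 0 - F w 0 1 * dmx (dmx F) w 1 0)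
    (F w 1 1 * dmx (dmx F) w 0 1 - F w 0 1 * dmx (dmx F) w 1 1)
    (F w 0 0 * dmx (dmx F) w 1 0 - F w 1 0 * dmx (dmx F) w 0 0)
    (F w 0 0 * dmx (dmx F) w 1 1 - F w 1 0 * dmx (dmx F) w 0 1).
  move: (dmx (dmx F) w) => D; rewrite (mx2_eta (F w)) {1}(mx2_eta D) !mx2E !mx2_ij.
  by congr mx2; ring.
rewrite E'.
have nE (k l : 'I_2) (h : C -> C) a : (forall u, mc_form F u k l = h u) ->
    is_derive w 1 h a -> is_derive w 1 (fun u => mc_form F u k l) a.
  by move=> hE; apply: cHD_near; apply/nearCP; exists 1 => // u _.
have H i1 i2 j1 j2 i3 i4 j3 j4 := cHDB (cHDM (dF i1 j1) (dD i2 j2)) (cHDM (dF i3 j3) (dD i4 j4)).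
case: (ord2 i) => ->; case: (ord2 j) => ->; rewrite mx2_ij.
- apply: nE (fun u => etrans (congr1 (fun M : M2 => M 0 0) (E u)) (mx2_00 _ _ _ _)) _.
  apply: (cHD_eq (H 1 0 1 0 0 1 1 0)).
  move: (dmx F w) (dmx (dmx F) w) d0 => D D' d0.
  by apply/eqP; rewrite -subr_eq0 -d0; apply/eqP; ring.
- apply: nE (fun u => etrans (congr1 (fun M : M2 => M 0 1) (E u)) (mx2_01 _ _ _ _)) _.
  apply: (cHD_eq (H 1 0 1 1 0 1 1 1)).
  by move: (dmx F w) (dmx (dmx F) w) => D D'; ring.
- apply: nE (fun u => etrans (congr1 (fun M : M2 => M 1 0) (E u)) (mx2_10 _ _ _ _)) _.
  apply: (cHD_eq (H 0 1 0 0 1 0 0 0)).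
  by move: (dmx F w) (dmx (dmx F) w) => D D'; ring.
- apply: nE (fun u => etrans (congr1 (fun M : M2 => M 1 1) (E u)) (mx2_11 _ _ _ _)) _.
  apply: (cHD_eq (H 0 1 0 1 1 0 0 1)).
  move: (dmx F w) (dmx (dmx F) w) d0 => D D' d0.
  by apply/eqP; rewrite -subr_eq0 -d0; apply/eqP; ring.
Qed.

Lemma hopf_relE Q : hopf_rel F Q <->
  forall w, mc_form F w *m (\adj (F w) *m dmx (dmx F) w) = Q w *: mc_form F w.
Proof.
split=> H w.
  by rewrite lift_mc -mulmxA [dmx F w *m _]mulmxA H -scalemxAr.
have := congr1 (mulmx (F w)) (H w); rewrite lift_mc -scalemxAr !mulmxA.
by rewrite mul_mx_adj F1 mul1mx -!mulmxA.
Qed.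

Let m u := mc_form F u 0 0.
Let n u := mc_form F u 0 1.
Let l u := mc_form F u 1 0.

Lemma mc_entries u : mc_form F u = mx2 (m u) (n u) (l u) (- m u) /\ m u ^+ 2 + n u * l u = 0.
Proof.
have [x [y]] := lift_nil bF u; rewrite /m /n /l => ->.
by rewrite /nil !mx2_ij; split => //; ring.
Qed.

Lemma gauss_derivatives w (N' := \adj (F w) *m dmx (dmx F) w) :
  [/\ l w != 0 -> sec_gauss F w = Some (m w / l w) /\
        derive1 (@aff R \o sec_gauss F) w * l w ^+ 2 = N' 0 0 * l w - m w * N' 1 0,
      l w = 0 -> [/\ sec_gauss F w = None, m w = 0, n w != 0 &
        derive1 (@aff_infty R \o sec_gauss F) w * n w = - N' 0 0],
      N' 1 1 = - N' 0 0 &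
      2 * (m w * N' 0 0) + (N' 0 1 * l w + n w * N' 1 0) = 0].
Proof.
have dm : is_derive w 1 m (N' 0 0) := HD_mc w 0 0.
have dn : is_derive w 1 n (N' 0 1) := HD_mc w 0 1.
have dl : is_derive w 1 l (N' 1 0) := HD_mc w 1 0.
have sE u : sec_gauss F u = Defs.ratio (m u) (l u) by rewrite (sec_gaussE u bF).
have ml u : m u ^+ 2 + n u * l u = 0 by case: (mc_entries u).
have nz (h : C -> C) (a : C) : is_derive w 1 h a -> h w != 0 -> \forall u \near w, h u != 0.
  move=> hd h0; have /contC_P/(_ (nm (h w))) := cHDcont hd; rewrite nm_gt0 => /(_ h0)[d d0 Hd].
  apply/nearCP; exists d => // u /Hd; apply: contraTneq => ->.
  by rewrite sub0r nmN ltxx.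
split.
- move=> l0; split; first by rewrite sE ratio_neq0.
  have H := cHDM dm (cHDV l0 dl).
  have Hn : is_derive w 1 (@aff R \o sec_gauss F)
      (N' 0 0 * (l w)^-1 + m w * (- N' 1 0 / l w ^+ 2)).
    apply: (cHD_near _ H); apply: filterS (nz _ _ dl l0) => u lu.
    by rewrite /= sE ratio_neq0.
  by rewrite (cHD1 Hn); field.
- move=> l0; have m0 : m w = 0.
    by have := ml w; rewrite l0 mulr0 addr0 => /eqP; rewrite sqrf_eq0 => /eqP.
  have n0 : n w != 0.
    apply: contraTneq (lift_fro bF w) => n0; have [-> _] := mc_entries w.
    by rewrite /fro !mx2_ij m0 n0 l0 oppr0 nm0 expr0n !addr0 ltxx.
  split=> //; first by rewrite sE l0 /Defs.ratio eqxx.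
  have H := cHDN (cHDM dm (cHDV n0 dn)).
  (* Near a pole 1/g = l / m is rewritten as - m / n by m^2 + n l = 0. The latter is holomorphic as
     n does not vanish, and it has the right value 0 where g is infinite. *)
  have Hn : is_derive w 1 (@aff_infty R \o sec_gauss F)
      (- (N' 0 0 * (n w)^-1 + m w * (- N' 0 1 / n w ^+ 2))).
    apply: (cHD_near _ H); apply: filterS (nz _ _ dn n0) => u nu.
    rewrite /= sE; have [lu|lu] := eqVneq (l u) 0.
      have := ml u; rewrite lu mulr0 addr0 => /eqP; rewrite sqrf_eq0 => /eqP ->.
      by rewrite /Defs.ratio eqxx /= mul0r oppr0.
    rewrite ratio_neq0//=; have mu : m u != 0.
      apply/eqP => mu; have := ml u; rewrite mu expr0n add0r => /eqP.
      by rewrite mulf_eq0 (negbTE nu) (negbTE lu).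
    have e : l u = - m u ^+ 2 / n u.
      by apply: (mulIf nu); rewrite divfK// mulrC; apply/eqP; rewrite -addr_eq0 addrC ml.
    by rewrite e; field; rewrite mu nu.
  by rewrite (cHD1 Hn) m0 mul0r addr0 mulNr divfK.
- have H : is_derive w 1 (fun u => mc_form F u 1 1) (- N' 0 0).
    apply: (cHD_near _ (cHDN dm)); apply/nearCP; exists 1 => // u _.
    by have [-> _] := mc_entries u; rewrite mx2_11.
  by rewrite -(cHD1 (HD_mc w 1 1)) (cHD1 H).
- have H := cHDD (cHDX 2 dm) (cHDM dn dl).
  have H0 : is_derive w 1 (fun u => m u ^+ 2 + n u * l u) 0.
    by apply: (cHD_near _ (cHDc 0 w)); apply/nearCP; exists 1 => // u _; rewrite ml.
  have := cHD1 H; rewrite (cHD1 H0) expr1 => E; rewrite [RHS]E; ring.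
Qed.

Lemma hopf_iff (q : C -> C) : (forall z, (@Cstar R) z -> derivable q z 1) ->
  hopf_differential F q <-> hopf_rel F (fun w => q (cexp w) * cexp w ^+ 2).
Proof.
move=> dq; rewrite hopf_relE.
suff H w : (if sec_gauss F w is Some a
    then derive1 (@aff R \o sec_gauss F) w *: mc_form F w =
      (q (cexp w) * cexp w ^+ 2) *: mx2 a (- a ^+ 2) 1 (- a)
    else derive1 (@aff_infty R \o sec_gauss F) w *: mc_form F w =
      (q (cexp w) * cexp w ^+ 2) *: mx2 0 1 0 0) <->
    mc_form F w *m (\adj (F w) *m dmx (dmx F) w) = (q (cexp w) * cexp w ^+ 2) *: mc_form F w.
  by split=> [[_ H'] w|H']; [apply/H; exact: H' | split=> // w; apply/H; exact: H'].
have [H1 H2 N11 Nd] := gauss_derivatives w; have [NE ml] := mc_entries w.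
have [l0|l0] := eqVneq (l w) 0.
  by have [-> m0 n0 dE] := H2 l0; rewrite NE; exact: hopf_algebra_infty.
by have [-> dE] := H1 l0; rewrite NE; exact: hopf_algebra_finite.
Qed.

End Equivalence.

End Hopf.

(** * The linear system for the given data *)

Section System.
Variable R : realType.
Local Notation C := R[i].
Local Notation M2 := 'M[C]_2.
Local Notation Re := (@complex.Re R).
Local Notation Im := (@complex.Im R).
Implicit Types th z w : C.

Definition gauss0 (z : C) : C := ((z - 1) / z) ^+ 2.

(* dF F^-1 for the Gauss map [gauss0] and the Hopf differential
   [th (z - 1) / z ^ 2 dz^2], in the coordinate w with z = cexp w. *)
Definition conn th z : M2 :=
  (th * z ^+ 2 / 2) *: mx2 (gauss0 z) (- gauss0 z ^+ 2) 1 (- gauss0 z).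

Definition conn_system th (F : C -> M2) :=
  [/\ entireM F, forall w, \det (F w) = 1 & forall w, dmx F w = conn th (cexp w) *m F w].

Lemma connE th z : z != 0 -> conn th z =
  mx2 (th / 2 * (z - 1) ^+ 2) (- (th / 2 * (z - 1) ^+ 4 / z ^+ 2))
    (th / 2 * z ^+ 2) (- (th / 2 * (z - 1) ^+ 2)).
Proof. by move=> z0; rewrite /conn /gauss0 !mx2E; congr mx2; field. Qed.

Lemma conn_neq0 th z : th != 0 -> z != 0 -> conn th z != 0.
Proof.
move=> th0 z0; apply/eqP => /(congr1 (fun M : M2 => M 1 0)) /eqP.
rewrite connE//= !mx2_ij zero_mx2 mx2_ij mulf_eq0 expf_eq0 (negbTE z0) andbF orbF.
by rewrite mulf_eq0 (negbTE th0) invr_eq0 pnatr_eq0.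
Qed.

Lemma conn_sq th z : z != 0 -> conn th z *m conn th z = 0.
Proof. by move=> z0; rewrite connE// !mx2E; congr mx2; field. Qed.

Definition dconn th z : M2 :=
  mx2 (th * (z - 1) * z) (- (th * (z - 1) ^+ 3 * (z + 1) / z ^+ 2))
    (th * z ^+ 2) (- (th * (z - 1) * z)).

Lemma conn_dconn th z : z != 0 -> conn th z *m dconn th z = (th * (z - 1)) *: conn th z.
Proof. by move=> z0; rewrite connE// /dconn !mx2E; congr mx2; field. Qed.

Lemma HD_conn th (w : C) i j :
  is_derive w 1 (fun u : C => conn th (cexp u) i j) (dconn th (cexp w) i j).
Proof.
have e := HD_cexp w; have e0 := cexp_neq0 w.
have nE (k l : 'I_2) (h : C -> C) a : (forall u, conn th (cexp u) k l = h u) ->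
    is_derive w 1 h a -> is_derive w 1 (fun u : C => conn th (cexp u) k l) a.
  by move=> hE H; apply: (cHD_near _ H); apply/nearCP; exists 1 => // u _.
have e1 := cHDB e (cHDc 1 w).
have d00 := cHDZ (th / 2) (cHDX 2 e1).
case: (ord2 i) => ->; case: (ord2 j) => ->; rewrite /dconn mx2_ij.
- apply: nE (fun u => etrans (congr1 (fun M : M2 => M 0 0) (connE th (cexp_neq0 u))) (mx2_00 _ _ _ _)) _.
  by apply: (cHD_eq d00); rewrite expr1; field.
- apply: nE (fun u => etrans (congr1 (fun M : M2 => M 0 1) (connE th (cexp_neq0 u))) (mx2_01 _ _ _ _)) _.
  have H := cHDN (cHDM (cHDZ (th / 2) (cHDX 4 e1)) (cHDV (f := fun u : C => cexp u ^+ 2) (x := w) (expf_neq0 2 e0) (cHDX 2 e))).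
  by apply: (cHD_eq H); rewrite /=; field.
- apply: nE (fun u => etrans (congr1 (fun M : M2 => M 1 0) (connE th (cexp_neq0 u))) (mx2_10 _ _ _ _)) _.
  by apply: (cHD_eq (cHDZ (th / 2) (cHDX 2 e))); rewrite expr1; field.
- apply: nE (fun u => etrans (congr1 (fun M : M2 => M 1 1) (connE th (cexp_neq0 u))) (mx2_11 _ _ _ _)) _.
  by apply: (cHD_eq (cHDN d00)); rewrite expr1; field.
Qed.

Lemma dmx_mul (A A' F : C -> M2) (w : C) :
  (forall i j, is_derive w 1 (fun u => A u i j) (A' w i j)) -> entireM F ->
  dmx (fun u => A u *m F u) w = A' w *m F w + A w *m dmx F w.
Proof.
move=> dA eF; apply: (@dmxE R _ (fun w => A' w *m F w + A w *m dmx F w)) => i j.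
have dF k l := entireM_HD w k l eF.
have H := cHDD (cHDM (dA i 0) (dF 0 j)) (cHDM (dA i 1) (dF 1 j)).
apply: (cHD_near _ (cHD_eq H _)).
  by apply/nearCP; exists 1 => // u _; rewrite mul2E.
by move: (dmx F w) => D; rewrite add2E !mul2E; ring.
Qed.

Section Data.
Variables (th : C) (f F : C -> M2).
Hypothesis th0 : th != 0.
Hypothesis sF : conn_system th F.
Hypothesis fF : forall w, f (cexp w) = F w *m adjoint (F w).

Let eF : entireM F. Proof. by case: sF. Qed.
Let F1 w : \det (F w) = 1. Proof. by case: sF. Qed.
Let dF w : dmx F w = conn th (cexp w) *m F w. Proof. by case: sF. Qed.

Lemma system_dmx_neq0 w : dmx F w != 0.
Proof.
rewrite dF; apply/eqP => /(congr1 (mulmx^~ (invmx (F w)))).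
rewrite mulmxK ?unitmx_det1// mul0mx => /eqP.
by apply/negP; apply: conn_neq0 => //; exact: cexp_neq0.
Qed.

Lemma system_lift : bryant_lift f F.
Proof.
split=> // w; split; first exact: system_dmx_neq0.
rewrite /mc_form dF mulmxA !det_mulmx F1 mulr1.
by rewrite connE ?cexp_neq0// [X in _ * X]det2 !mx2_ij; field; exact: cexp_neq0.
Qed.

Lemma system_gauss w : hyp_gauss F w = Some (gauss0 (cexp w)).
Proof.
apply: hyp_gauss_finite; first exact: system_dmx_neq0.
  by rewrite dF !mul2E /conn scale_mx2 !mx2_ij; ring.
by rewrite dF !mul2E /conn scale_mx2 !mx2_ij; ring.
Qed.

(** As the connection squares to 0, d^2F is its derivative times F, and the Hopf relation reduces to
    [conn_dconn]. *)
Lemma system_hopf : hopf_differential F (fun z => th * (z - 1) / z ^+ 2).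
Proof.
apply/(hopf_iff system_lift).
  move=> z z0; have z2 : z ^+ 2 != 0 by rewrite expf_neq0.
  exact: cHDd (cHDM (cHDZ th (cHDB (cHDid z) (cHDc 1 z))) (cHDV (f := fun u : C => u ^+ 2) (x := z) z2 (cHDX 2 (cHDid z)))).
move=> w /=; have e0 := cexp_neq0 w.
have DD : dmx (dmx F) w = dconn th (cexp w) *m F w.
  have -> : dmx F = fun u => conn th (cexp u) *m F u by apply/funext.
  rewrite (dmx_mul (A' := fun w => dconn th (cexp w)) (fun i j => HD_conn th w i j) eF).
  by rewrite dF mulmxA conn_sq// mul0mx addr0.
rewrite DD dF -!mulmxA (mulmxA (F w)) mul_mx_adj F1 mul1mx.
rewrite mulmxA conn_dconn// -scalemxAl; congr (_ *: _).
by rewrite divfK// expf_neq0.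
Qed.

End Data.
End System.

(** * Completeness of the surfaces defined by the linear system *)

Section Completeness.
Variable R : realType.
Local Notation C := R[i].
Local Notation M2 := 'M[C]_2.
Local Notation Re := (@complex.Re R).
Local Notation Im := (@complex.Im R).
Local Notation mu := (@lebesgue_measure R).

(** With a primitive [P] of [g] on [[0, t]], both [K * P + phi] and [K * P - phi] have nonnegative
    derivative, and the increment of [P] is at most the integral of [g]. Applied with the density of
    length as [g], it bounds functions along paths of finite length. *)
Lemma length_bound (g : R -> R) (L : R) :
  (forall t : R, 0 <= t < 1 -> {for t, continuous g}) ->
  (forall t : R, 0 <= t < 1 -> 0 <= g t) ->
  (\int[mu]_(t in `[0%R, 1%R[) (g t)%:E <= L%:E)%E ->
  forall (phi dphi : R -> R) (K : R), 0 <= K ->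
  (forall t : R, 0 <= t < 1 -> is_derive t 1 phi (dphi t)) ->
  (forall t : R, 0 <= t < 1 -> `|dphi t| <= K * g t) ->
  forall t : R, 0 <= t < 1 -> `|phi t - phi 0| <= K * L.
Proof.
move=> gc g0 gL phi dphi K K0 dp bp t /andP[t0 t1].
have L0 : 0 <= L.
  rewrite -lee_fin; apply: le_trans gL; apply: integral_ge0 => x /=.
  by rewrite in_itv /= lee_fin => /g0.
move: t0; rewrite le_eqVlt => /orP[/eqP <-|t0].
  by rewrite subrr normr0 mulr_ge0.
have i01 x : 0 <= x <= t -> 0 <= x < 1.
  by move=> /andP[-> xt]; rewrite (le_lt_trans xt t1).
have [P dP] : exists P : R -> R, forall x : R, 0 <= x <= t -> is_derive x 1 P (g x).
  by apply: real_primitive => [|x /i01/gc//]; exact: ltW.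
have PL : P t - P 0 <= L.
  rewrite -lee_fin EFinB.
  have Pc x : 0 <= x <= t -> {for x, continuous P} by move=> /dP; exact: HDcont.
  rewrite -(@continuous_FTC2 R g P 0 t t0).
  - apply: le_trans gL; apply: ge0_subset_integral => //=.
    + apply/measurable_realfun.measurable_EFinP; apply: measurable_realfun.subspace_continuous_measurable_fun => //.
      by apply: continuous_in_subspaceT => x; rewrite inE /= in_itv /= => /gc.
  - apply: continuous_in_subspaceT => x; rewrite inE /= in_itv /= => xt.
    exact: gc (i01 _ xt).
  - split=> [x||].
    + by rewrite in_itv /= => /andP[x0 xt]; apply: HDd (dP x _); rewrite !ltW.
    + by apply: cvg_at_right_filter; apply: Pc; rewrite lexx ltW.
    + by apply: cvg_at_left_filter; apply: Pc; rewrite lexx ltW.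
  - move=> x; rewrite in_itv /= => /andP[x0 xt]; apply: HD1 (dP x _); by rewrite !ltW.
have mv (s : R) : `|s| <= 1 -> 0 <= K * (P t - P 0) + s * (phi t - phi 0).
  move=> s1; have [||x] := @MVT R (fun x => K * P x + s * phi x) (fun x => K * g x + s * dphi x) 0 t t0.
  - move=> x; rewrite in_itv /= => /andP[x0 xt].
    have xt' : 0 <= x <= t by rewrite !ltW.
    exact: (HDD (HDZ K (dP x xt')) (HDZ s (dp x (i01 _ xt')))).
  - apply: continuous_in_subspaceT => x; rewrite inE /= in_itv /= => xt.
    exact: HDcont (HDD (HDZ K (dP x xt)) (HDZ s (dp x (i01 _ xt)))).
  rewrite in_itv /= => /andP[x0 xt] E.
  have -> : K * (P t - P 0) + s * (phi t - phi 0) = K * P t + s * phi t - (K * P 0 + s * phi 0) by ring.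
  rewrite E subr0 mulr_ge0 ?(ltW t0)//.
  have xt' : 0 <= x <= t by rewrite !ltW.
  have := bp x (i01 _ xt').
  have : `|s * dphi x| <= `|dphi x| by rewrite normrM ler_piMl.
  by rewrite ler_norml => /andP[+ _]; lra.
have KL : K * (P t - P 0) <= K * L by rewrite ler_wpM2l.
have := mv 1; rewrite normr1 => /(_ (lexx _)).
have := mv (-1); rewrite normrN normr1 => /(_ (lexx _)).
by rewrite ler_norml; lra.
Qed.

Definition annulus (B : R) : set C :=
  (fun p : R * R => cexp (p.1 +i* p.2)) @` ([set x : R | - B <= x <= B] `*` [set y : R | - pi <= y <= pi]).

Lemma annulus_compact B : compact (annulus B).
Proof.
have sc (a b : R) : compact [set x : R | a <= x <= b].
  have -> : [set x : R | a <= x <= b] = [set` Interval (BLeft a) (BRight b)] by apply/seteqP; split => x; rewrite /= in_itv.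
  exact: segment_compact.
apply: continuous_compact; last exact: compact_setX (sc _ _) (sc _ _).
apply: continuous_subspaceT => -[x y].
have c1 : (p.1 : R) @[p --> nbhs (x, y)] --> x by exact: cvg_fst.
have c2 : (p.2 : R) @[p --> nbhs (x, y)] --> y by exact: cvg_snd.
have ce : {for (x +i* y), continuous (@cexp R)} := cHDcont (HD_cexp _).
apply: (@continuous_comp _ _ _ (fun p : R * R => p.1 +i* p.2) (@cexp R) (x, y) _ ce).
by apply: cvg_ReIm.
Qed.

Lemma annulus_sub B : annulus B `<=` @Cstar R.
Proof. by move=> z [p _ <-]; exact: cexp_neq0. Qed.

Lemma annulusP B z : z != 0 -> `|ln (nm z)| <= B -> annulus B z.
Proof.
move=> /cexp_surj_strip[w [<- wp]]; rewrite nm_cexp expRK => wB.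
exists (Re w, Im w); last by rewrite -complexRI.
by split => //=; rewrite -ler_norml.
Qed.

Variables (th : C) (f F : C -> M2).
Hypothesis th0 : th != 0.
Hypothesis sF : conn_system th F.
Hypothesis fF : forall w, f (cexp w) = F w *m adjoint (F w).

Let bF : bryant_lift f F := system_lift th0 sF fF.
Let F1 w : \det (F w) = 1. Proof. by case: sF. Qed.

Lemma tr_conj_adjoint (A N : M2) (k : C) :
  \tr (A *m adjoint (k *: N) *m adjoint A) = (k * \tr (A *m N *m adjoint A))^*%C.
Proof.
have trJ (B : M2) : \tr (adjoint B) = (\tr B)^*%C by rewrite !tr2 !adjointE rmorphD.
by rewrite -mxtraceZ -trJ !adjointZ !adjointM adjointK -scalemxAr -scalemxAl mulmxA.
Qed.

Lemma nm_entry (A : M2) i j : nm (A i j) <= Num.sqrt (fro A).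
Proof.
rewrite -[leLHS]ger0_norm ?nm_ge0// -sqrtr_sqr ler_wsqrtr// /fro.
have p k l := sqr_ge0 (nm (A k l)); have := (p 0 0, p 0 1, p 1 0, p 1 1).
by case: (ord2 i) => ->; case: (ord2 j) => -> [[[]]]; lra.
Qed.

Lemma fro_gt0 w : 0 < fro (F w).
Proof.
rewrite lt_def fro_ge0 andbT; apply/eqP => /fro_eq0 F0; have := F1 w.
by rewrite F0 det0 => /eqP; rewrite eq_sym oner_eq0.
Qed.

Lemma fro_adj (A : M2) : fro (\adj A) = fro A.
Proof. by rewrite (mx2_eta A) adj_mx2 /fro !mx2_ij !nmN; ring. Qed.

Lemma nm_mul3 (A B D : M2) i j : nm ((A *m B *m D) i j) <=
  4 * (Num.sqrt (fro A) * Num.sqrt (fro B) * Num.sqrt (fro D)).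
Proof.
have e k l : nm (A i k * B k l * D l j) <= Num.sqrt (fro A) * Num.sqrt (fro B) * Num.sqrt (fro D).
  by rewrite !nmM !ler_pM ?mulr_ge0 ?nm_ge0 ?nm_entry.
rewrite !mul2E.
have -> : (A i 0 * B 0 0 + A i 1 * B 1 0) * D 0 j + (A i 0 * B 0 1 + A i 1 * B 1 1) * D 1 j =
  A i 0 * B 0 0 * D 0 j + A i 1 * B 1 0 * D 0 j + (A i 0 * B 0 1 * D 1 j + A i 1 * B 1 1 * D 1 j) by ring.
apply: (le_trans (nmD _ _)).
have := nmD (A i 0 * B 0 0 * D 0 j) (A i 1 * B 1 0 * D 0 j).
have := nmD (A i 0 * B 0 1 * D 1 j) (A i 1 * B 1 1 * D 1 j).
have := (e 0 0, e 0 1, e 1 0, e 1 1); move=> [[[]]]; lra.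
Qed.

Let nu w := Num.sqrt (fro (mc_form F w)).

(** The first column of the connection F N F^(-1), with N = F^(-1) dF, has the entries th/2 (z -
    1)^2 and th/2 z^2. They are not both small because |z - 1| + |z| >= 1. Hence N can only be small
    where F is large. *)
Lemma system_lower w : nm th / 32 <= fro (F w) * nu w.
Proof.
have E : conn th (cexp w) = F w *m mc_form F w *m \adj (F w).
  by rewrite -(lift_dmx bF); case: sF => _ _ ->; rewrite -mulmxA mul_mx_adj F1 mulmx1.
have := nm_mul3 (F w) (mc_form F w) (\adj (F w)).
rewrite -E fro_adj mulrAC -expr2 sqr_sqrtr ?fro_ge0// -/(nu w) => H.
have z0 := cexp_neq0 w; have t0 : 0 <= nm th by exact: nm_ge0.
move: (H 0 0) (H 1 0); rewrite (connE _ z0) mx2_00 mx2_10; move: (cexp w) => z.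
rewrite !nmM nmV.
have -> : nm (2 : C) = 2 by rewrite -(rmorph_nat (real_complex R)) nmR ger0_norm.
move=> h1 h2.
have : 1 <= 2 * (nm (z - 1) ^+ 2 + nm z ^+ 2).
  have : 1 <= nm (z - 1) + nm z.
    by rewrite -(nm1 R) nm_sym; have := nmD (1 - z) z; rewrite subrK.
  by have := (nm_ge0 (z - 1), nm_ge0 z, sqr_ge0 (nm (z - 1) - nm z)) => -[[]]; nra.
move=> /(ler_wpM2l t0); lra.
Qed.

Section Path.
Variable c : R -> C.
Hypothesis cin : path_in (@Cstar R) c.
Let dc t : C := derive1 (Re \o c) t +i* derive1 (Im \o c) t.
Let g t := Num.sqrt (conf_factor f (c t)) * speed c t.

Lemma path_CD t : 0 <= t < 1 -> CD c t (dc t).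
Proof. by move=> /cin[_ d1 d2 _ _]; split; [exact: HDder d1 | exact: HDder d2]. Qed.

Lemma path_gE t w : c t = cexp w -> g t = nu w * nm (dc t / cexp w).
Proof.
move=> ct; rewrite /g ct (lift_conf_factor bF) sqrtrM ?fro_ge0// sqrtrV ?sqr_ge0//.
rewrite sqrtr_sqr ger0_norm ?nm_ge0// nmM nmV -mulrA [_^-1 * _]mulrC.
by [].
Qed.

Lemma path_g_ge0 t : 0 <= g t.
Proof. by rewrite mulr_ge0 ?sqrtr_ge0. Qed.

Lemma path_g_cont t : 0 <= t < 1 -> {for t, continuous g}.
Proof.
move=> t01; have [ct _ _ c1 c2] := cin t01.
have cc := CDcont (path_CD t01).
have [_ sm _ _] := lift_cmc1 bF.
have cf : {for t, continuous (fun s => conf_factor f (c s))}.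
  have E z : conf_factor f z = - Re (pd 1 f z 0 0 * pd 1 f z 1 1 - pd 1 f z 0 1 * pd 1 f z 1 0).
    rewrite /conf_factor /lprod; move: (pd 1 f z) => P.
    rewrite mul_mx_adj det2 tr2 !mxE /= !mulr1n ReD; lra.
  have pc i j : {for t, continuous (fun s => pd 1 f (c s) i j)}.
    have [pcz _] := sm [:: 1] (c t) i j ct.
    exact: (@continuous_comp _ _ _ c (fun u => pd 1 f u i j) t cc pcz).
  have -> : (fun s => conf_factor f (c s)) = (fun s => - Re (pd 1 f (c s) 0 0 * pd 1 f (c s) 1 1
      - pd 1 f (c s) 0 1 * pd 1 f (c s) 1 0)) by apply/funext.
  have H : {for t, continuous (fun s => pd 1 f (c s) 0 0 * pd 1 f (c s) 1 1
      - pd 1 f (c s) 0 1 * pd 1 f (c s) 1 0)}.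
    exact: (cvgB (cvgM (pc 0 0) (pc 1 1)) (cvgM (pc 0 1) (pc 1 0))).
  exact: (cvgN (cvg_Re H)).
have sq (h : R -> R) : {for t, continuous h} -> {for t, continuous (fun s => Num.sqrt (h s))}.
  move=> hc; exact: (@continuous_comp _ _ _ h (@Num.sqrt R) t hc (@sqrt_continuous R _)).
have sp : {for t, continuous (speed c)}.
  by apply: sq; exact: (cvgD (cvgM c1 c1) (cvgM c2 c2)).
exact: (cvgM (sq _ cf) sp).
Qed.

(** The trace of [F F^*] is [fro F]; its derivative is twice the real part of [tau] times a sum of
    two diagonal entries of F N F^*, each at most [4 * (fro F * nu)]. Division by [fro F] leaves the
    constant 16. *)
Lemma path_trace (t : R) : 0 <= t < 1 -> exists d : R,
  is_derive t 1 (fun s => ln (Re (\tr (f (c s))))) d /\ `|d| <= 16 * g t.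
Proof.
move=> t01; have [ct _ _ _ _] := cin t01; have [w cw] := cexp_surj ct.
have d1 i := bihol_CD_path i i (lift_bihol bF) (esym cw) (path_CD t01).
set tau := dc t / cexp w; set N := mc_form F w.
have dT : CD (fun s => \tr (f (c s))) t (\tr (F w *m (tau *: N + adjoint (tau *: N)) *m adjoint (F w))).
  have := CDD (d1 0) (d1 1); rewrite -tr2 sum_unit => H.
  have E : (fun s => \tr (f (c s))) = (fun s => f (c s) 0 0 + f (c s) 1 1).
    by apply/funext => s; rewrite tr2.
  rewrite E; apply: (CD_eq H); congr (\tr _).
  by rewrite (lift_dmx bF) scalemxAr adjointM mulmxDr mulmxDl !mulmxA.
have [dR _] := dT.
have TE : Re (\tr (f (c t))) = fro (F w) by rewrite -cw fF fro_tr.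
have T0 := fro_gt0 w.
set D := Re _ in dR.
have dln : is_derive (Re (\tr (f (c t)))) 1 (@ln R) (fro (F w))^-1.
  by rewrite TE; exact: is_derive1_ln.
exists ((fro (F w))^-1 * D); split.
  exact: (HDcomp (g := fun s => Re (\tr (f (c s)))) dln dR).
rewrite normrM normfV (ger0_norm (ltW T0)) mulrC ler_pdivrMr//.
have DE : D = 2 * Re (tau * \tr (F w *m N *m adjoint (F w))).
  rewrite /D mulmxDr mulmxDl mxtraceD ReD -scalemxAr -scalemxAl mxtraceZ.
  have -> : \tr (F w *m adjoint (tau *: N) *m adjoint (F w)) =
      (tau * \tr (F w *m N *m adjoint (F w)))^*%C by exact: tr_conj_adjoint.
  by case: (tau * _) => x y /=; lra.
have sF0 : 0 <= Num.sqrt (fro (F w)) by exact: sqrtr_ge0.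
have aF : fro (adjoint (F w)) = fro (F w).
  by rewrite /fro !adjointE !nmJ; lra.
have := nm_mul3 (F w) N (adjoint (F w)).
rewrite aF mulrAC -expr2 sqr_sqrtr ?fro_ge0// -/(nu w) => H.
rewrite DE (path_gE (esym cw)) -/tau normrM ger0_norm//.
have := nm_Re (tau * \tr (F w *m N *m adjoint (F w))); rewrite nmM tr2.
set A := _ *m adjoint (F w) in H *.
have := ler_wpM2l (nm_ge0 tau) (le_trans (nmD (A 0 0) (A 1 1)) (lerD (H 0 0) (H 1 1))).
lra.
Qed.

(** The logarithm of |z|^2 is 2 Re w, and the length element is [nu] |dw|, at least [k] |dw|. *)
Lemma path_log (k t : R) : 0 <= t < 1 -> 0 < k -> (forall w, c t = cexp w -> k <= nu w) ->
  exists d : R, is_derive t 1 (fun s => ln (nm (c s) ^+ 2)) d /\ `|d| <= 2 / k * g t.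
Proof.
move=> t01 k0 kn; have [ct _ _ _ _] := cin t01; have [w cw] := cexp_surj ct.
have [c1 c2] := path_CD t01.
have H := HDD (HDX 2 c1) (HDX 2 c2).
have n0 : 0 < nm (c t) ^+ 2 by rewrite exprn_gt0// nm_gt0.
have E : (fun s => nm (c s) ^+ 2) = (fun s => Re (c s) ^+ 2 + Im (c s) ^+ 2).
  by apply/funext => s; rewrite nm2.
rewrite -E in H.
have dln : is_derive (nm (c t) ^+ 2) 1 (@ln R) (nm (c t) ^+ 2)^-1 by exact: is_derive1_ln.
have := HDcomp (g := fun s => nm (c s) ^+ 2) dln H; set D := _ * _ => HD.
exists D; split => //.
have DE : D = 2 * Re (dc t / c t).
  rewrite /D nm2 ReM; move: n0; rewrite nm2; case: (c t) => x y /= n0.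
  have n1 : x ^+ 2 + y ^+ 2 != 0 by rewrite gt_eqF.
  by field.
rewrite DE normrM ger0_norm// -mulrA ler_wpM2l// (path_gE (esym cw)).
apply: (le_trans (nm_Re _)); rewrite -cw mulrA ler_peMl ?nm_ge0//.
by rewrite mulrC ler_pdivlMr// mul1r kn.
Qed.

Lemma path_not_divergent (L : R) : (path_length f c <= L%:E)%E -> ~ divergent_in (@Cstar R) c.
Proof.
move=> cL dv.
have lb := length_bound path_g_cont (fun t _ => path_g_ge0 t) cL.
(* [length_bound] wants the derivative as a function; it is picked pointwise, with the default 0
   outside [0, 1). *)
pose dT t := if pselect (0 <= t < 1) is left t01 then sval (cid (path_trace t01)) else 0.
have b1 : forall t, 0 <= t < 1 -> `|ln (Re (\tr (f (c t)))) - ln (Re (\tr (f (c 0))))| <= 16 * L.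
  apply: (lb (fun s => ln (Re (\tr (f (c s))))) dT) => // t t01; rewrite /dT;
    by case: pselect => // t01'; case: cid => d /= [].
pose M := expR (ln (Re (\tr (f (c 0)))) + 16 * L).
have M0 : 0 < M by exact: expR_gt0.
(* Along the path [fro F] is at most [M], so [system_lower] bounds the metric from below by this
   constant. *)
pose k := nm th / 32 / M.
have k0 : 0 < k by rewrite !divr_gt0// nm_gt0.
have kn t w : 0 <= t < 1 -> c t = cexp w -> k <= nu w.
  move=> t01 cw; have := b1 t t01; rewrite {1}cw fF -fro_tr ler_norml => /andP[_ h].
  have T0 := fro_gt0 w.
  have TM : fro (F w) <= M.
    by rewrite -[leLHS]lnK ?posrE// /M ler_expR; lra.
  rewrite /k ler_pdivrMr//; apply: (le_trans (system_lower w)).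
  by rewrite mulrC ler_wpM2l// sqrtr_ge0.
pose dL t := if pselect (0 <= t < 1) is left t01 then
   sval (cid (path_log t01 k0 (fun w => @kn t w t01))) else 0.
have k20 : 0 <= 2 / k by rewrite divr_ge0// ltW.
have b2 : forall t, 0 <= t < 1 -> `|ln (nm (c t) ^+ 2) - ln (nm (c 0) ^+ 2)| <= 2 / k * L.
  apply: (lb (fun s => ln (nm (c s) ^+ 2)) dL) => // t t01; rewrite /dL;
    by case: pselect => // t01'; case: cid => d /= [].
pose B : R := `|ln (nm (c 0) ^+ 2)| + 2 / k * L.
have inK t : 0 <= t < 1 -> annulus B (c t).
  move=> t01; have [ct _ _ _ _] := cin t01; apply: annulusP => //.
  have := b2 t t01; rewrite {1}lnXn ?nm_gt0// => h.
  have : `|ln (nm (c t)) *+ 2| <= B.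
    rewrite -[X in `|X|](subrK (ln (nm (c 0) ^+ 2))).
    by apply: (le_trans (ler_normD _ _)); rewrite addrC lerD2l.
  apply: le_trans; rewrite normrMn mulr2n lerDl//.
have := dv _ (@annulus_compact B) (@annulus_sub B) => dK.
have : \forall t \near (1 : R)^'-, False.
  near=> t; have : ~ annulus B (c t) by near: t.
  apply; apply: inK; apply/andP; split; last by near: t; exact: nbhs_left_lt.
  by apply: ltW; near: t; exact: nbhs_left_gt.
by move=> /filter_ex[].
Unshelve. all: by end_near. Qed.

End Path.

Theorem system_complete : complete_on (@Cstar R) f.
Proof.
move=> c cin dv; apply/eqP; rewrite -leye_eq leNgt; apply/negP => lt.
have fin : path_length f c \is a fin_num.
  rewrite ge0_fin_numE//; apply: integral_ge0 => t _.
  by rewrite lee_fin mulr_ge0 ?sqrtr_ge0.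
apply: (@path_not_divergent c cin (fine (path_length f c))) => //.
by rewrite fineK.
Qed.

Theorem system_cmc1 : cmc1_immersion f.
Proof. by have [? ? ? ?] := lift_cmc1 bF; split => //; exact: system_complete. Qed.

End Completeness.

(** * Frobenius solutions *)

Section Series.
Variable R : realType.
Local Notation C := R[i].
Local Notation Re := (@complex.Re R).
Local Notation Im := (@complex.Im R).
Implicit Types (a : nat -> C) (z nu th : C) (A M : R).

Lemma cvgC_le (u : nat -> C) (l b : C) (K : R) :
  u @ \oo --> l -> (forall n, nm (u n - b) <= K) -> nm (l - b) <= K.
Proof.
move=> /cvgC_P ul uK; apply/ler_addgt0Pl => e e0.
have [n un] := filter_ex (ul e e0).
have -> : l - b = - (u n - l) + (u n - b) by ring.
by apply: (le_trans (nmD _ _)); rewrite nmN lerD// ltW.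
Qed.

Lemma cvgCS (u : nat -> C) (l : C) :
  u n @[n --> \oo] --> l -> u n.+1 @[n --> \oo] --> l.
Proof. by move=> H; rewrite (cvg_shiftS u). Qed.

Definition psum a n z : C := \sum_(k < n) a k * z ^+ k.

Definition pser a z : C := lim (psum a n z @[n --> \oo]).

Definition pder a k : C := k.+1%:R * a k.+1.

(** Domination by an exponential series: it makes the power series converge everywhere, and termwise
    differentiation keeps it. *)
Definition exp_bound A M a := forall k, nm (a k) <= A * (M ^+ k / k`!%:R).

Lemma nm_nat n : nm (n%:R : C) = n%:R.
Proof. by rewrite -(rmorph_nat (real_complex R)) nmR ger0_norm. Qed.

Lemma exp_bound_pder A M a : exp_bound A M a -> exp_bound (A * M) M (pder a).
Proof.
move=> aM k; rewrite /pder nmM nm_nat.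
have := ler_wpM2l (ler0n R k.+1) (aM k.+1); rewrite factS natrM => H.
apply: (le_trans H); rewrite le_eqVlt; apply/orP; left; apply/eqP.
rewrite exprS; have k1 : (k.+1%:R : R) != 0 by rewrite pnatr_eq0.
have f0 : (k`!%:R : R) != 0 by rewrite pnatr_eq0 -lt0n fact_gt0.
by field; apply/andP.
Qed.

Section Bounded.
Variables (A M : R) (a : nat -> C).
Hypothesis (A0 : 0 <= A) (M0 : 0 <= M) (aM : exp_bound A M a).

Let E z n := series (exp_coeff (M * nm z)) n.

Lemma exp_partial_le (x : R) n : 0 <= x -> series (exp_coeff x) n <= expR x.
Proof.
move=> x0; apply: nondecreasing_cvgn_le; last exact: is_cvg_series_exp_coeff.
apply/nondecreasing_seqP => k; rewrite /series /= big_nat_recr//= lerDl.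
exact: exp_coeff_ge0.
Qed.

Lemma psum_diff z m n : (m <= n)%N ->
  nm (psum a n z - psum a m z) <= A * (E z n - E z m).
Proof.
move=> /subnK <-; elim: (n - m)%N => [|k IH].
  by rewrite !subrr mulr0 nm0.
rewrite addSn /psum big_ord_recr /= -!/(psum _ _ _) /E /series /= big_nat_recr//=.
rewrite addrAC [X in A * X]addrAC mulrDr.
apply: (le_trans (nmD _ _)); apply: lerD; first exact: IH.
rewrite nmM nmX /exp_coeff /= exprMn.
have := ler_wpM2r (exprn_ge0 (k + m) (nm_ge0 z)) (aM (k + m)).
by move/le_trans; apply; rewrite le_eqVlt; apply/orP; left; apply/eqP; ring.
Qed.

Lemma psum_le z n : nm (psum a n z) <= A * expR (M * nm z).
Proof.
have := psum_diff z (leq0n n); rewrite {2}/psum big_ord0 subr0 => /le_trans; apply.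
rewrite ler_wpM2l// /E [series _ 0]big_geq// subr0.
by apply: exp_partial_le; rewrite mulr_ge0 ?nm_ge0.
Qed.

Lemma pser_cvg z : psum a n z @[n --> \oo] --> pser a z.
Proof.
suff [l Hl] : exists l : C, psum a n z @[n --> \oo] --> l by exact: cvgP Hl.
apply: cauchy_cvgC => e e0.
have x0 : 0 <= M * nm z by rewrite mulr_ge0 ?nm_ge0.
have A1 : 0 < A + 1 by rewrite ltr_wpDl.
have : \forall m \near \oo, `|expR (M * nm z) - E z m| < e / (A + 1).
  have /cvgrPdist_lt H : series (exp_coeff (M * nm z)) @ \oo --> expR (M * nm z).
    exact: is_cvg_series_exp_coeff.
  by apply: H; rewrite divr_gt0.
move=> [m _ Hm]; exists (psum a m z); exists m => // n /= mn.
apply: (le_lt_trans (psum_diff _ mn)).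
have := Hm m (leqnn m); rewrite /= ltr_norml ltr_pdivlMr// => /andP[_ h].
have En := exp_partial_le n x0; have Em := exp_partial_le m x0.
apply: le_lt_trans h; rewrite mulrC; apply: ler_pM => //; rewrite ?lerB//; last by rewrite lerDl.
by rewrite subr_ge0 /E; move: mn => /subnK <-; elim: (n - m)%N => // k IH;
   rewrite addSn (le_trans IH)// /series /= big_nat_recr//= lerDl exp_coeff_ge0.
Qed.

End Bounded.

Lemma HD_psum a n (z : C) : is_derive z 1 (psum a n.+1) (psum (pder a) n z).
Proof.
elim: n => [|n IH].
  rewrite /psum big_ord0; apply: (cHD_near _ (cHDc (a 0%N) z)).
  by apply/nearCP; exists 1 => // u _; rewrite big_ord1 expr0 mulr1.
have H := cHDD IH (cHDZ (a n.+1) (cHDX n.+1 (cHDid z))).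
rewrite /psum big_ord_recr /= -/(psum _ _ _).
apply: (cHD_near _ (cHD_eq H _)); last by rewrite /pder /= mulr1; ring.
by apply/nearCP; exists 1 => // u _; rewrite /psum [in RHS]big_ord_recr.
Qed.

(* The second derivatives of the partial sums are uniformly bounded on balls. *)
Lemma psum_quadratic A M a n (z h : C) : 0 <= A -> 0 <= M -> exp_bound A M a -> nm h <= 1 ->
  nm (psum a n.+2 (z + h) - psum a n.+2 z - psum (pder a) n.+1 z * h) <=
  4 * (A * M * M * expR (M * (nm z + 1))) * nm h ^+ 2.
Proof.
move=> A0 M0 aM h1; set K := A * M * M * _.
have b2 := exp_bound_pder (exp_bound_pder aM).
have inb (t : R) : 0 <= t <= 1 -> nm (t%:C * h) <= nm h.
  by move=> /andP[t0 t1]; rewrite nmM nmR ger0_norm// ler_piMl ?nm_ge0.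
have D2 (s : R) : 0 <= s <= 1 -> nm (psum (pder a) n.+1 (z + s%:C * h) - psum (pder a) n.+1 z) <= 2 * (K * nm h).
  move=> s01; have AMM : 0 <= A * M * M by rewrite !mulr_ge0.
  have := @holo_bound R (psum (pder a) n.+1) (psum (pder (pder a)) n) z (z + s%:C * h) K.
  have -> : z + s%:C * h - z = s%:C * h by ring.
  move=> H; apply: (le_trans (H _ _)) => [t _|t t01|]; first exact: HD_psum.
    apply: (le_trans (psum_le AMM M0 b2 _ _)); rewrite ler_wpM2l// ler_expR ler_wpM2l//.
    apply: (le_trans (nmD _ _)); rewrite lerD2l.
    apply: (le_trans _ h1); apply: (le_trans _ (inb s s01)).
    rewrite nmM nmR ger0_norm ?ler_piMl ?nm_ge0//; by move/andP: t01 => [].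
  by rewrite !ler_wpM2l ?inb// !mulr_ge0 ?expR_ge0.
pose f := fun u => psum a n.+2 u - psum (pder a) n.+1 z * u.
have H := @holo_bound R f (fun u => psum (pder a) n.+1 u - psum (pder a) n.+1 z) z (z + h) (2 * (K * nm h)).
have E0 : z + h - z = h by ring.
rewrite E0 in H.
have -> : psum a n.+2 (z + h) - psum a n.+2 z - psum (pder a) n.+1 z * h = f (z + h) - f z.
  by rewrite /f; ring.
apply: (le_trans (H _ D2)).
  by move=> t _; apply: (cHD_eq (cHDB (HD_psum _ _ _) (cHDZ _ (cHDid _)))); rewrite mulr1.
by rewrite le_eqVlt; apply/orP; left; apply/eqP; ring.
Qed.

(** The quadratic error bound [psum_quadratic] does not depend on the number of terms, hence passes
    to the limit. *)
Lemma HD_pser A M a (z : C) : 0 <= A -> 0 <= M -> exp_bound A M a ->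
  is_derive z 1 (pser a) (pser (pder a) z).
Proof.
move=> A0 M0 aM; have b1 := exp_bound_pder aM.
set K := 4 * (A * M * M * expR (M * (nm z + 1))).
have K0 : 0 <= K by rewrite !mulr_ge0 ?expR_ge0.
have Q (h : C) : nm h <= 1 -> nm (pser a (z + h) - pser a z - pser (pder a) z * h) <= K * nm h ^+ 2.
  move=> h1.
  have c1 := pser_cvg A0 M0 aM (z := z + h); have c2 := pser_cvg A0 M0 aM (z := z).
  have c3 := pser_cvg (mulr_ge0 A0 M0) M0 b1 (z := z).
  rewrite -[X in nm X]subr0.
  apply: (@cvgC_le (fun n => psum a n.+2 (z + h) - psum a n.+2 z - psum (pder a) n.+1 z * h)) => [|n].
    exact: (cvgB (cvgB (cvgCS (cvgCS c1)) (cvgCS (cvgCS c2))) (cvgM (cvgCS c3) (cvg_cst h))).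
  by rewrite subr0; exact: psum_quadratic.
apply: HD_eps => e e0; exists (Num.min 1 (e / (K + 1))).
  by rewrite lt_min ltr01 divr_gt0// ltr_wpDl.
move=> h; rewrite lt_min => /andP[h1 h2]; apply: (le_trans (Q h (ltW h1))).
rewrite expr2 mulrA ler_wpM2r ?nm_ge0//.
move: h2; rewrite ltr_pdivlMr ?ltr_wpDl// => h2; apply: (le_trans _ (ltW h2)).
by rewrite mulrC ler_wpM2l ?nm_ge0// lerDl.
Qed.

Section Frobenius.
Variables (th nu : C) (d : R).
Hypothesis d0 : 0 < d.
Hypothesis nud : forall k : nat, d <= nm (k.+1%:R + 2 * nu).

(** For X = z^(1 + nu) times a power series, X'' - 2 X' - th X (derivatives in w) multiplies the
    k-th coefficient by (1 + nu + k)^2 - 2 (1 + nu + k) - th, which equals k (k + 2 nu) because nu^2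
    = 1 + th. Equating with - th z X gives this recursion. *)
Fixpoint fcoef (k : nat) : C :=
  if k is l.+1 then - th * fcoef l / (l.+1%:R * (l.+1%:R + 2 * nu)) else 1.

(** One factor k of the denominator k (k + 2 nu) builds the factorial; the other is bounded below by
    [d]. *)
Lemma fcoef_bound : exp_bound 1 (nm th / d) fcoef.
Proof.
have M0 : 0 <= nm th / d by rewrite divr_ge0 ?nm_ge0// ltW.
elim=> [|k IH]; first by rewrite nm1 expr0 fact0 divr1 mulr1.
rewrite /= nmM nmV !nmM nmN nm_nat mul1r factS natrM exprS.
rewrite mul1r in IH.
have k1 : 0 < (k.+1%:R : R) by rewrite ltr0n.
have f0 : 0 < (k`!%:R : R) by rewrite ltr0n fact_gt0.
have dn := nud k; have n0 := lt_le_trans d0 dn.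
have -> : nm th / d * (nm th / d) ^+ k / (k.+1%:R * k`!%:R) =
  nm th * ((nm th / d) ^+ k / k`!%:R) * (k.+1%:R * d)^-1.
  by field; rewrite !gt_eqF.
apply: ler_pM; rewrite ?mulr_ge0 ?invr_ge0 ?mulr_ge0 ?nm_ge0 ?ler0n//.
  by rewrite ler_wpM2l ?nm_ge0.
by rewrite lef_pV2 ?posrE ?mulr_gt0// ler_wpM2l// ltW.
Qed.

Let M0 : 0 <= nm th / d. Proof. by rewrite divr_ge0 ?nm_ge0// ltW. Qed.

Definition fser z := pser fcoef z.
Definition fser1 z := pser (pder fcoef) z.
Definition fser2 z := pser (pder (pder fcoef)) z.

Lemma HD_fser (z : C) : is_derive z 1 fser (fser1 z).
Proof. exact: HD_pser ler01 M0 fcoef_bound. Qed.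

Lemma HD_fser1 (z : C) : is_derive z 1 fser1 (fser2 z).
Proof. exact: HD_pser (mulr_ge0 ler01 M0) M0 (exp_bound_pder fcoef_bound). Qed.

Lemma fser_0 : fser 0 = 1.
Proof.
have c := pser_cvg ler01 M0 fcoef_bound (z := 0).
apply/eqP; rewrite -subr_eq0 -nm_eq0 eq_le nm_ge0 andbT.
have -> : fser 0 - 1 = pser fcoef 0 - 1 by [].
apply: (@cvgC_le (fun n => psum fcoef n.+1 0)) => [|n].
  exact: cvgCS c.
rewrite /psum big_ord_recl /= expr0 mulr1 big1 ?addr0 ?subrr ?nm0// => i _.
by rewrite expr0n /= mulr0.
Qed.

Lemma fser_ode z : z * fser2 z + (1 + 2 * nu) * fser1 z = - th * fser z.
Proof.
have nz k : (k.+1%:R + 2 * nu : C) != 0.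
  by rewrite -nm_eq0 gt_eqF// (lt_le_trans d0).
have c2 := pser_cvg (mulr_ge0 (mulr_ge0 ler01 M0) M0) M0 (exp_bound_pder (exp_bound_pder fcoef_bound)) (z := z).
have c1 := pser_cvg (mulr_ge0 ler01 M0) M0 (exp_bound_pder fcoef_bound) (z := z).
have c0 := pser_cvg ler01 M0 fcoef_bound (z := z).
have rec k : (k.+1%:R + 2 * nu) * (k.+1%:R * fcoef k.+1) = - th * fcoef k.
  rewrite /=; have := nz k; move: (k.+1%:R + 2 * nu) => y y0.
  have k1 : (k.+1%:R : C) != 0 by rewrite pnatr_eq0.
  by field; apply/andP.
(* The equation holds exactly for truncated sums, provided that the second derivative is cut one
   term earlier because of its factor [z]. *)
have id (a : nat -> C) : (forall k, (k.+1%:R + 2 * nu) * (k.+1%:R * a k.+1) = - th * a k) ->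
    forall n, z * psum (pder (pder a)) n z + (1 + 2 * nu) * psum (pder a) n.+1 z = - th * psum a n.+1 z.
  have pS (b : nat -> C) n : psum b n.+1 z = psum b n z + b n * z ^+ n by rewrite /psum big_ord_recr.
  move=> ra; elim=> [|n IH].
    by rewrite !pS /psum !big_ord0 !expr0 /pder mulr0 !add0r !mulr1 -(ra 0%N).
  rewrite (pS _ n) (pS _ n.+1) [in RHS]pS [RHS]mulrDr -IH mulrA -(ra n.+1) /pder exprS.
  have -> : n.+2%:R = n.+1%:R + 1 :> C by rewrite natr1.
  by ring.
apply/eqP; rewrite -subr_eq0 -nm_eq0 eq_le nm_ge0 andbT.
rewrite -[X in nm X]subr0.
apply: (@cvgC_le (fun n => z * psum (pder (pder fcoef)) n z + (1 + 2 * nu) * psum (pder fcoef) n.+1 z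
    - (- th * psum fcoef n.+1 z))) => [|n]; last by rewrite id// subrr subr0 nm0.
exact: (cvgB (cvgD (cvgM (cvg_cst z) c2) (cvgM (cvg_cst (1 + 2 * nu)) (cvgCS c1))) (cvgM (cvg_cst (- th)) (cvgCS c0))).
Qed.

End Frobenius.
End Series.

(** * Solutions of the linear system from the Frobenius series *)

Section FrobeniusSystem.
Variable R : realType.
Local Notation C := R[i].
Local Notation M2 := 'M[C]_2.
Local Notation Re := (@complex.Re R).
Local Notation Im := (@complex.Im R).
Variables (th nu : C) (d : R).
Hypothesis th0 : th != 0.
Hypothesis d0 : 0 < d.
Hypothesis nud : forall k : nat, d <= nm (k.+1%:R + 2 * nu).
Hypothesis nu2 : nu ^+ 2 = 1 + th.

(* The second row X of a solution satisfies X'' - 2 X' = - th (z - 1) X, and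
   the first one is recovered from U = X' / z^2. *)
Definition frobX (w : C) : C := cexp ((1 + nu) * w) * fser th nu (cexp w).
Definition frobU (w : C) : C := cexp ((1 + nu) * w) *
  ((1 + nu) * fser th nu (cexp w) + cexp w * fser1 th nu (cexp w)) / cexp w ^+ 2.
(** The second row of the system reads X' = th/2 z^2 (V - G X); this is its solution for V. *)
Definition frobV (w : C) : C := 2 / th * frobU w + gauss0 (cexp w) * frobX w.

Let HDe (w : C) : is_derive w 1 (fun u => cexp ((1 + nu) * u)) (cexp ((1 + nu) * w) * (1 + nu)).
Proof. by apply: (cHD_eq (cHDcomp (HD_cexp _) (cHDZ (1 + nu) (cHDid w)))); rewrite mulr1. Qed.

Let HDf (w : C) : is_derive w 1 (fun u => fser th nu (cexp u)) (fser1 th nu (cexp w) * cexp w).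
Proof. exact: cHDcomp (HD_fser th d0 nud _) (HD_cexp w). Qed.

Let HDf1 (w : C) : is_derive w 1 (fun u => fser1 th nu (cexp u)) (fser2 th nu (cexp w) * cexp w).
Proof. exact: cHDcomp (HD_fser1 th d0 nud _) (HD_cexp w). Qed.

Lemma HD_frobX (w : C) : is_derive w 1 frobX (cexp w ^+ 2 * frobU w).
Proof.
apply: (cHD_eq (cHDM (HDe w) (HDf w))); rewrite /frobU; have := cexp_neq0 w.
move: (cexp w) (cexp _) => z e z0; field; exact: z0.
Qed.

Lemma HD_frobU (w : C) : is_derive w 1 frobU (- (th * (cexp w - 1) / cexp w ^+ 2) * frobX w).
Proof.
have z0 := cexp_neq0 w.
have H := cHDM (cHDM (HDe w) (cHDD (cHDZ (1 + nu) (HDf w)) (cHDM (HD_cexp w) (HDf1 w))))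
  (cHDV (f := fun u : C => cexp u ^+ 2) (x := w) (expf_neq0 2 z0) (cHDX 2 (HD_cexp w))).
apply: (cHD_eq H); rewrite /frobX /=.
have := fser_ode th d0 nud (cexp w).
have -> : th = nu ^+ 2 - 1 by rewrite nu2 addrC addKr.
set t := nu ^+ 2 - 1.
move: (fser t nu (cexp w)) (fser1 t nu (cexp w)) (fser2 t nu (cexp w)) => f0 f1 f2.
move: (cexp ((1 + nu) * w)) => e; move: (cexp w) z0 => z z0 H2; rewrite /t in H2 *.
have {H2} -> : f2 = (- (nu ^+ 2 - 1) * f0 - (1 + 2 * nu) * f1) / z by rewrite -H2; field.
by field.
Qed.

Lemma HD_gauss0 (w : C) : is_derive w 1 (fun u => gauss0 (cexp u)) (2 * (cexp w - 1) / cexp w ^+ 2).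
Proof.
have z0 := cexp_neq0 w.
have H := cHDX 2 (cHDM (cHDB (HD_cexp w) (cHDc 1 w)) (cHDV z0 (HD_cexp w))).
by apply: (cHD_eq H); rewrite /=; field.
Qed.

Lemma HD_frobV (w : C) : is_derive w 1 frobV (gauss0 (cexp w) * cexp w ^+ 2 * frobU w).
Proof.
have H := cHDD (cHDZ (2 / th) (HD_frobU w)) (cHDM (HD_gauss0 w) (HD_frobX w)).
have z0 := cexp_neq0 w; apply: (cHD_eq H).
move: (frobX w) (frobU w) (cexp w) (gauss0 _) z0 => x u z g z0.
by field; rewrite th0 z0.
Qed.

Let deck_exp n (w : C) :
  cexp ((1 + nu) * deck n w) = cexp (nu * (n%:~R * tpi R)) * cexp ((1 + nu) * w).
Proof.
rewrite deckE; have := cexp_int R n; move: (n%:~R * tpi R) => t t1.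
have -> : (1 + nu) * (w + t) = t + (nu * t + (1 + nu) * w) by ring.
by rewrite cexpD t1 mul1r cexpD.
Qed.

Lemma frobX_deck n (w : C) : frobX (deck n w) = cexp (nu * (n%:~R * tpi R)) * frobX w.
Proof. by rewrite /frobX cexp_deck deck_exp mulrA. Qed.

Lemma frobU_deck n (w : C) : frobU (deck n w) = cexp (nu * (n%:~R * tpi R)) * frobU w.
Proof. by rewrite /frobU cexp_deck deck_exp !mulrA. Qed.

Lemma frobV_deck n (w : C) : frobV (deck n w) = cexp (nu * (n%:~R * tpi R)) * frobV w.
Proof. by rewrite /frobV frobX_deck frobU_deck cexp_deck; ring. Qed.

Lemma frob_conn (w : C) : conn th (cexp w) *m mx2 (frobV w) 0 (frobX w) 0 =
  mx2 (gauss0 (cexp w) * cexp w ^+ 2 * frobU w) 0 (cexp w ^+ 2 * frobU w) 0.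
Proof.
rewrite /conn /frobV !mx2E; move: (frobX w) (frobU w) (cexp w) (gauss0 _) => x u z g.
by congr mx2; rewrite ?mulr0 ?addr0//; field.
Qed.

Lemma frob_nonzero : exists w, frobX w != 0.
Proof.
have /cHDcont/contC_P := HD_fser th d0 nud 0.
move=> /(_ 1 ltr01)[e e0 He].
pose w : C := (ln (e / 2))%:C.
exists w; rewrite mulf_neq0 ?cexp_neq0//; apply/eqP => f0.
have := He (cexp w); rewrite f0 (fser_0 th d0 nud) subr0 sub0r nmN nm1 ltxx.
move=> H; suff : false by []; apply: H.
by rewrite nm_cexp /= lnK ?posrE ?divr_gt0// ltr_pdivrMr// ltr_pMr// ltr1n.
Qed.

End FrobeniusSystem.

(** * Existence of the surface *)

Section Existence.
Variable R : realType.
Local Notation C := R[i].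
Local Notation M2 := 'M[C]_2.
Local Notation Re := (@complex.Re R).
Local Notation Im := (@complex.Im R).

(** The expression is constant in w. The powers z^(1 + nu) and z^(1 - nu) multiply to z^2, which
    cancels, so it is a continuous function of z also at 0, where its value is 2 nu. *)
Lemma frob_wronskian (th nu : C) (d : R) : 0 < d ->
  (forall k : nat, d <= nm (k.+1%:R + 2 * nu)) ->
  (forall k : nat, d <= nm (k.+1%:R + 2 * - nu)) ->
  nu ^+ 2 = 1 + th -> forall w : C,
  frobU th nu w * frobX th (- nu) w - frobU th (- nu) w * frobX th nu w = 2 * nu.
Proof.
move=> d0 dp dn nu2 w.
have nu2' : (- nu) ^+ 2 = 1 + th by rewrite sqrrN.
set W := fun u : C => frobU th nu u * frobX th (- nu) u - frobU th (- nu) u * frobX th nu u.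
have Wc (u v : C) : W u = W v.
  apply: (@holo_const R W) => {}u.
  have H := cHDB (cHDM (HD_frobU d0 dp nu2 u) (HD_frobX th d0 dn u)) (cHDM (HD_frobU d0 dn nu2' u) (HD_frobX th d0 dp u)).
  by apply: (cHD_eq H); ring.
pose V z := 2 * nu * (fser th nu z * fser th (- nu) z) +
  z * (fser1 th nu z * fser th (- nu) z - fser1 th (- nu) z * fser th nu z).
have WV u : W u = V (cexp u).
  rewrite /W /V /frobU /frobX; have z0 := cexp_neq0 u.
  have e1 : cexp ((1 + nu) * u) * cexp ((1 - nu) * u) = cexp u ^+ 2.
    by rewrite -cexpD cexpX; congr cexp; ring.
  have e2 : cexp ((1 - nu) * u) = cexp u ^+ 2 / cexp ((1 + nu) * u).
    by rewrite -e1 mulrAC divff ?mul1r// cexp_neq0.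
  rewrite e2; have := cexp_neq0 ((1 + nu) * u).
  move: (cexp ((1 + nu) * u)) (cexp u) z0 => e z z0 ez.
  move: (fser _ _ _) (fser _ _ _) (fser1 _ _ _) (fser1 _ _ _) => *.
  by field; rewrite z0 ez.
have dV := cHDD (cHDZ (2 * nu) (cHDM (HD_fser th d0 dp 0) (HD_fser th d0 dn 0)))
  (cHDM (cHDid (0 : C)) (cHDB (cHDM (HD_fser1 th d0 dp 0) (HD_fser th d0 dn 0)) (cHDM (HD_fser1 th d0 dn 0) (HD_fser th d0 dp 0)))).
have V0 : V 0 = 2 * nu by rewrite /V (fser_0 th d0 dp) (fser_0 th d0 dn) !mul0r addr0 !mulr1.
rewrite -/(W w); apply/eqP; rewrite -subr_eq0 -nm_eq0 eq_le nm_ge0 andbT.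
apply/ler_addgt0Pl => e e0; rewrite addr0.
have /contC_P := cHDcont dV; move=> /(_ e e0)[r r0 Hr].
pose u : C := (ln (r / 2))%:C.
rewrite (Wc w u) WV -V0 ltW//; apply: Hr.
by rewrite subr0 nm_cexp /= lnK ?posrE ?divr_gt0// ltr_pdivrMr// ltr_pMr// ltr1n.
Qed.

(** Any choice of logarithms defines the surface: deck transformations multiply F from the right by
    matrices [D] with [D *m adjoint D = 1], which drop out of [F F^*]. *)
Lemma cexp_section_lift (F : C -> M2) :
  (forall n w, exists2 D : M2, F (deck n w) = F w *m D & D *m adjoint D = 1) ->
  exists f : C -> M2, forall w, f (cexp w) = F w *m adjoint (F w).
Proof.
move=> FD.
pose l z : C := if pselect (z != 0) is left z0 then sval (cid (cexp_surj z0)) else 0.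
exists (fun z => F (l z) *m adjoint (F (l z))) => w; rewrite /l.
case: pselect => [z0|]; last by rewrite cexp_neq0.
case: cid => u /= /cexp_eq[n ->]; have [D -> D1] := FD n w.
by rewrite adjointM mulmxA -(mulmxA (F w)) D1 mulmx1.
Qed.

Lemma mc_form_right (F : C -> M2) (w w' : C) (D : M2) : \det (F w) = 1 -> \det D = 1 ->
  F w' = F w *m D -> dmx F w' = dmx F w *m D ->
  mc_form F w' = \adj D *m mc_form F w *m D.
Proof.
move=> F1 D1 e1 e2; rewrite /mc_form !invmx_det1 ?e1 ?det_mulmx ?F1 ?D1 ?mulr1//.
by rewrite e2 adjM !mulmxA.
Qed.

Lemma order_at0_Q0_0 (th : C) : th != 0 -> order_at0 (fun z : C => th * (z - 1) / z ^+ 2) (-2).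
Proof.
move=> th0; exists (fun z => th * (z - 1)); split.
- by apply/nearCP; exists 1 => // t _; exact: cHDd (cHDZ th (cHDB (cHDid t) (cHDc 1 t))).
- by rewrite sub0r mulrN1 oppr_eq0.
- by apply/near'CP; exists 1 => // t _ _; rewrite mulrC.
Qed.

Lemma order_at0_Q0_infty (th : C) : th != 0 ->
  order_at0 (fun t : C => th * (t^-1 - 1) / t^-1 ^+ 2 / t ^+ 4) (-3).
Proof.
move=> th0; exists (fun z => th * (1 - z)); split.
- by apply/nearCP; exists 1 => // t _; exact: cHDd (cHDZ th (cHDB (cHDc 1 t) (cHDid t))).
- by rewrite subr0 mulr1.
- apply/near'CP; exists 1 => // t t0 _; have -> : t ^ (-3) = (t ^+ 3)^-1 by [].
  by field.
Qed.

Lemma nm_cexp_imag (x : R) n : nm (cexp (x%:C * (n%:~R * tpi R))) = 1.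
Proof.
have -> : x%:C * (n%:~R * tpi R) = 0 +i* (x * n%:~R * (2 * pi)).
  rewrite /tpi -(rmorph_int (real_complex R)); apply/eqP; rewrite eq_complex /=.
  by apply/andP; split; apply/eqP; ring.
by rewrite nm_cexp /= expR0.
Qed.

Lemma cexp_half_int (nu : C) : cexp (nu * tpi R) = (cexp (nu * tpi R))^-1 ->
  exists n : int, 2 * nu = n%:~R.
Proof.
move=> E; have [|n nE] := @cexp_ker R (2 * nu * tpi R).
  rewrite (_ : 2 * nu * tpi R = nu * tpi R + nu * tpi R); last by ring.
  by rewrite cexpD {1}E mulVf// cexp_neq0.
exists n; apply: (mulIf _ nE).
by rewrite -nm_eq0 nm_tpi mulf_neq0 ?pnatr_eq0// gt_eqF// pi_gt0.
Qed.

Lemma conn_system_exists (th nu : C) (d : R) : th != 0 -> nu != 0 -> 0 < d ->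
  (forall k : nat, d <= nm (k.+1%:R + 2 * nu)) ->
  (forall k : nat, d <= nm (k.+1%:R + 2 * - nu)) ->
  nu ^+ 2 = 1 + th ->
  exists2 F, conn_system th F & forall n (w : C), let b := cexp (nu * (n%:~R * tpi R)) in
    F (deck n w) = F w *m mx2 b 0 0 b^-1.
Proof.
move=> th0 nu0 d0 dp dn nu2; have nu2' : (- nu) ^+ 2 = 1 + th by rewrite sqrrN.
(* This scaling of the first column turns the Wronskian 2 nu into determinant 1. *)
set k := th / (4 * nu).
pose F (w : C) := mx2 (k * frobV th nu w) (frobV th (- nu) w) (k * frobX th nu w) (frobX th (- nu) w).
pose D (w : C) := mx2 (k * (gauss0 (cexp w) * cexp w ^+ 2 * frobU th nu w))
  (gauss0 (cexp w) * cexp w ^+ 2 * frobU th (- nu) w)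
  (k * (cexp w ^+ 2 * frobU th nu w)) (cexp w ^+ 2 * frobU th (- nu) w).
have dF (w : C) i j : is_derive w 1 (fun u => F u i j) (D w i j).
  have E (h : C -> C) (a : C) : (forall u, F u i j = h u) -> is_derive w 1 h a ->
      is_derive w 1 (fun u => F u i j) a.
    by move=> hE H; apply: (cHD_near _ H); apply/nearCP; exists 1 => // u _.
  move: E; case: (ord2 i) => ->; case: (ord2 j) => -> E; rewrite /D mx2_ij.
  - exact: E (fun u => mx2_00 _ _ _ _) (cHDZ k (HD_frobV th0 d0 dp nu2 w)).
  - exact: E (fun u => mx2_01 _ _ _ _) (HD_frobV th0 d0 dn nu2' w).
  - exact: E (fun u => mx2_10 _ _ _ _) (cHDZ k (HD_frobX th d0 dp w)).
  - exact: E (fun u => mx2_11 _ _ _ _) (HD_frobX th d0 dn w).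
exists F.
  split=> [w i j|w|w].
  - exact: cHDd (dF w i j).
  - rewrite det2 /F !mx2_ij /frobV; have := frob_wronskian d0 dp dn nu2 w.
    move: (frobU _ _ _) (frobU _ _ _) (frobX _ _ _) (frobX _ _ _) (gauss0 _) => v u x y g uv.
    have -> : k * (2 / th * u + g * x) * y - (2 / th * v + g * y) * (k * x) =
      2 / th * k * (u * y - v * x) by ring.
    by rewrite uv /k; field; rewrite nu0.
  - rewrite (dmxE (dF w)) /D /F /frobV /conn !mx2E.
    move: (frobU _ _ _) (frobU _ _ _) (frobX _ _ _) (frobX _ _ _) => v u y x.
    move: (gauss0 (cexp w)) => g; move: (cexp w) => z.
    by congr mx2; field.
move=> n w b; have bN : cexp (- nu * (n%:~R * tpi R)) = b^-1 by rewrite mulNr cexpN.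
rewrite /F !mx2E !frobV_deck !frobX_deck bN -/b; move: (b^-1) => c.
by congr mx2; ring.
Qed.

(** Replacing F by F D^(-1) conjugates F^(-1) dF by D and so turns g into the Moebius image of g
    under D. The inverse is the one in the definition of rho_g, whence [deck (- n)]. *)
Lemma diag_monodromy_rho (f F : C -> M2) (nu : C) : bryant_lift f F ->
  (forall n (w : C), let b := cexp (nu * (n%:~R * tpi R)) in F (deck n w) = F w *m mx2 b 0 0 b^-1) ->
  represents_rho_g F (fun n => let b := cexp (nu * (n%:~R * tpi R)) in mx2 b 0 0 b^-1).
Proof.
move=> bF FD n; set b := cexp _ => /=; have b0 : b != 0 by exact: cexp_neq0.
split=> [|w]; first by rewrite det2 !mx2_ij mul0r subr0 divff.
have bn : cexp (nu * ((- n)%:~R * tpi R)) = b^-1 by rewrite rmorphN mulNr mulrN cexpN.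
have F1 : F (deck (- n) w) = F w *m mx2 b^-1 0 0 b by rewrite FD bn invrK.
have [_ dF _ _] := bF.
have eF : entireM F by case: bF.
have F2 : dmx F (deck (- n) w) = dmx F w *m mx2 b^-1 0 0 b.
  apply: (@dmxE R F (fun=> _) (deck (- n) w)) => i j.
  have s : is_derive (deck (- n) w) 1 (fun u : C => u - (- n)%:~R * tpi R) 1.
    by apply: (cHD_eq (cHDB (cHDid _) (cHDc _ _))); rewrite subr0.
  have H k : is_derive (deck (- n) w) 1 (fun u => F (u - (- n)%:~R * tpi R) i k) (dmx F w i k).
    have Fk : is_derive (deck (- n) w - (- n)%:~R * tpi R) 1 (fun u => F u i k) (dmx F w i k).
      by rewrite deckE addrK; exact: entireM_HD.
    by apply: (cHD_eq (cHDcomp (f := fun u : C => F u i k) (g := fun u : C => u - (- n)%:~R * tpi R) Fk s)); rewrite mulr1.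
  have := cHDD (cHDM (H 0) (cHDc (mx2 b^-1 0 0 b 0 j) _)) (cHDM (H 1) (cHDc (mx2 b^-1 0 0 b 1 j) _)).
  move=> H2; apply: (cHD_near _ (cHD_eq H2 _)).
    apply/nearCP; exists 1 => // u _; rewrite -mul2E.
    by have := FD (- n) (u - (- n)%:~R * tpi R); rewrite /= deckE subrK bn invrK => <-.
  by rewrite !mulr0 !addr0 -mul2E.
have D1 : \det (mx2 b^-1 0 0 b) = 1 by rewrite det2 !mx2_ij mul0r subr0 mulVf.
rewrite !(sec_gaussE _ bF) (mc_form_right (dF w) D1 F1 F2) adj_mx2.
move: (mc_form F w) => N; rewrite (mx2_eta N) !mx2E !mx2_ij.
rewrite !(oppr0, mul0r, mulr0, addr0, add0r) /Defs.ratio mulf_eq0 invr_eq0 (negbTE b0) orbF.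
rewrite mulf_eq0 invr_eq0 (negbTE b0) /=.
case: eqP => [n0|/eqP n0] /=; rewrite !mx2_ij /Defs.ratio ?eqxx//.
rewrite mul0r add0r invr_eq0 (negbTE b0); congr Some; field.
by rewrite b0 n0.
Qed.

Theorem existence (theta nu : R) : theta != 0 -> 0 < nu -> nu ^+ 2 = 1 + theta ->
  ~ (2 * nu \is a Num.int) ->
  exists f : C -> M2, H1_reducible_cmc1 (-2) (-3) f (fun z => Some (gauss0 z))
    (fun z => theta%:C * (z - 1) / z ^+ 2).
Proof.
move=> t0 nu0 nu2 nuZ; set th := theta%:C.
have th0 : th != 0 by rewrite -nm_eq0 nmR normr_eq0.
have n0 : nu%:C != 0 by rewrite -nm_eq0 nmR normr_eq0 gt_eqF.
have nat_nu k (s : R) : k.+1%:R + 2 * s%:C = (k.+1%:R + 2 * s)%:C.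
  by rewrite rmorphD rmorphM !rmorph_nat.
(* Every positive integer is at most the floor of 2 nu or at least the next integer, so the smaller
   of the two gaps is a uniform bound; both are positive since 2 nu is not an integer. *)
have dm : exists2 d : R, 0 < d & forall k : nat, d <= `|k.+1%:R - 2 * nu|.
  have fl := Num.Theory.floor_itv (2 * nu).
  have /andP[fl1 fl2] := fl; set m := Num.floor (2 * nu) in fl1 fl2.
  have fl1' : m%:~R < 2 * nu.
    by rewrite lt_neqAle fl1 andbT; apply/eqP => mE; apply: nuZ; rewrite -mE intr_int.
  exists (Num.min (2 * nu - m%:~R) ((m + 1)%:~R - 2 * nu)); first by rewrite lt_min !subr_gt0 fl1'.
  move=> k; rewrite ge_min.
  have [km|mk] := leP (k.+1%:Z) m; apply/orP; [left|right].
    have km' : (k.+1%:R : R) <= m%:~R by rewrite -[leLHS]/(k.+1%:Z%:~R) ler_int.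
    by rewrite distrC ger0_norm ?lerB// subr_ge0 (le_trans km').
  have mk' : (m + 1)%:~R <= (k.+1%:R : R) by rewrite -[leRHS]/(k.+1%:Z%:~R) ler_int lezD1.
  by rewrite ger0_norm ?lerB// subr_ge0 (le_trans (ltW fl2)).
have [d1 d10 dn] := dm.
pose d := Num.min d1 1.
have d0 : 0 < d by rewrite lt_min d10 ltr01.
have dpC k : d <= nm (k.+1%:R + 2 * nu%:C).
  rewrite nat_nu nmR ge_min; apply/orP; right.
  have k1 : (1 : R) <= k.+1%:R by rewrite ler1n.
  by rewrite ger0_norm; have := nu0; lra.
have dnC k : d <= nm (k.+1%:R + 2 * - nu%:C).
  by rewrite -rmorphN nat_nu nmR mulrN ge_min dn.
have nu2C : nu%:C ^+ 2 = 1 + th by rewrite -rmorphXn nu2 rmorphD rmorph1.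
have [F sF FD] := conn_system_exists th0 n0 d0 dpC dnC nu2C.
have [f fF] : exists f : C -> M2, forall w, f (cexp w) = F w *m adjoint (F w).
  apply: cexp_section_lift => n w; eexists; first exact: FD.
  have := nm_cexp_imag nu n; move: (cexp _) => b b1; have b0 : b != 0 by rewrite -nm_eq0 b1 oner_eq0.
  rewrite !mx2E !(rmorph0, mul0r, mulr0, addr0, add0r) -!nm2C b1 nmV b1 invr1 expr1n.
  by rewrite rmorph1 -one_mx2.
have bF := system_lift th0 sF fF.
exists f, F; split.
- exact: system_cmc1 th0 sF fF.
- by split=> // [w|]; [exact: (system_gauss th0 sF) | exact: (system_hopf th0 sF fF)].
- exists (fun n => let b := cexp (nu%:C * (n%:~R * tpi R)) in mx2 b 0 0 b^-1); split.
  + exact: diag_monodromy_rho bF FD.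
  + exists 1%:M; split; first exact: unitmx1.
    move=> n; rewrite mul1mx invmx1 mulmx1; apply/is_diag_mxP => i j.
    by case: (ord2 i) => ->; case: (ord2 j) => ->; rewrite // mx2_ij.
  (* If the diagonal matrix of the generator were scalar, e^(2 pi i nu) would equal its inverse. *)
  + move=> /(_ 1) /is_scalar_mxP[a] /= E.
    have [n nE] : exists n : int, 2 * nu%:C = n%:~R.
      apply: cexp_half_int; rewrite -[X in _ * X]mul1r; set b := cexp _ in E *.
      have := congr1 (fun M : M2 => M 0 0) E; have := congr1 (fun M : M2 => M 1 1) E.
      by rewrite !mx2_ij !mxE !mulr1n => e1 e0; rewrite [LHS]e0 -e1.
    apply: nuZ; suff -> : 2 * nu = n%:~R by rewrite intr_int.
    by apply: complexI; rewrite rmorphM rmorph_nat rmorph_int.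
- by split; [exact: order_at0_Q0_0 | exact: order_at0_Q0_infty].
Qed.

End Existence.

(** * Dual total curvature *)

Section Rectangles.
Variable R : realType.
Local Notation mu := (@lebesgue_measure R).
Local Notation mu2 := (mu \x mu)%E.

Lemma segment_measure_lty (a b : R) : (mu `[a, b] < +oo)%E.
Proof. by rewrite lebesgue_measure_itv /=; case: ifP => // _; rewrite -EFinB ltry. Qed.

Lemma rectangle_integrable (f : R * R -> R) (K a b c d : R) :
  measurable_fun setT f -> (forall p, `|f p| <= K) ->
  mu2.-integrable (`[a, b] `*` `[c, d]) (EFin \o f).
Proof.
move=> mf fK; apply: measurable_bounded_integrable.
- exact: measurableX.
- have E : mu2 (`[a, b] `*` `[c, d]) = (mu `[a, b] * mu `[c, d])%E by exact: product_measure1E.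
  suff : (mu2 (`[a, b] `*` `[c, d]) < +oo)%E by [].
  by rewrite E lte_mul_pinfty ?ge0_fin_numE ?segment_measure_lty.
- exact: measurable_funTS.
- by exists K; split; [rewrite num_real | move=> M KM p _; exact: le_trans (fK p) (ltW KM)].
Qed.

Lemma segment_FTC2 (f F : R -> R) (a b : R) : a < b -> continuous f ->
  (forall x : R, is_derive x 1 F (f x)) ->
  (\int[mu]_(x in `[a, b]) (f x)%:E = (F b - F a)%:E)%E.
Proof.
move=> ab cf dF; have Fc x : {for x, continuous F} by exact: HDcont (dF x).
rewrite EFinB; apply: continuous_FTC2 => //.
- exact: continuous_subspaceT.
- split=> [x _||]; first exact: HDd (dF x).
  + by apply: cvg_at_right_filter; exact: Fc.
  + by apply: cvg_at_left_filter; exact: Fc.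
- by move=> x _; apply: HD1 (dF x).
Qed.

Lemma rectangle_int_x (A P : R -> R -> R) (K a b c d : R) : a < b ->
  measurable_fun setT (fun p : R * R => A p.1 p.2) -> (forall x y, `|A x y| <= K) ->
  (forall y, continuous (A^~ y)) -> (forall x y : R, is_derive x 1 (P^~ y) (A x y)) ->
  (\int[mu2]_(p in `[a, b] `*` `[c, d]) (A p.1 p.2)%:E =
   \int[mu]_(y in `[c, d]) (P b y - P a y)%:E)%E.
Proof.
move=> ab mA AK cA dA; have iA := rectangle_integrable a b c d mA (fun p => AK p.1 p.2).
rewrite integral_mkcond -integral21_prod_meas1; last first.
  by rewrite -integrable_mkcond//; exact: measurableX.
rewrite [RHS]integral_mkcond; apply: eq_integral => y _; rewrite /fubini_G [RHS]/patch.
have yE : (y \in `[c, d]%classic) = (c <= y <= d) by apply: asboolb; rewrite in_itv.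
case: ifPn => yi.
  rewrite -(segment_FTC2 ab (cA y) (fun x => dA x y)) [RHS]integral_mkcond.
  by apply: eq_integral => x _; rewrite /patch in_setX /= yi andbT.
by apply: integral0_eq => x _; rewrite /patch in_setX /= (negbTE yi) andbF.
Qed.

Lemma rectangle_int_y (B Q : R -> R -> R) (K a b c d : R) : c < d ->
  measurable_fun setT (fun p : R * R => B p.1 p.2) -> (forall x y, `|B x y| <= K) ->
  (forall x, continuous (B x)) -> (forall x y : R, is_derive y 1 (Q x) (B x y)) ->
  (\int[mu2]_(p in `[a, b] `*` `[c, d]) (B p.1 p.2)%:E =
   \int[mu]_(x in `[a, b]) (Q x d - Q x c)%:E)%E.
Proof.
move=> cd mB BK cB dB; have iB := rectangle_integrable a b c d mB (fun p => BK p.1 p.2).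
rewrite integral_mkcond -integral12_prod_meas1; last first.
  by rewrite -integrable_mkcond//; exact: measurableX.
rewrite [RHS]integral_mkcond; apply: eq_integral => x _; rewrite /fubini_F [RHS]/patch.
case: ifPn => xi.
  rewrite -(segment_FTC2 cd (cB x) (dB x)) [RHS]integral_mkcond.
  by apply: eq_integral => y _; rewrite /patch in_setX /= xi.
by apply: integral0_eq => y _; rewrite /patch in_setX /= (negbTE xi).
Qed.

(* The potential ln (|z|^4 + |z - 1|^4), in the real coordinates of z = x + i y. *)
Definition dpot (x y : R) := x ^+ 2 + y ^+ 2.
Definition epot (x y : R) := (x - 1) ^+ 2 + y ^+ 2.
Definition ppot (x y : R) := dpot x y ^+ 2 + epot x y ^+ 2.
Definition ppotx (x y : R) := 4 * x * dpot x y + 4 * (x - 1) * epot x y.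
Definition ppoty (x y : R) := 4 * y * (dpot x y + epot x y).
Definition ppotxx (x y : R) := 4 * dpot x y + 8 * x ^+ 2 + 4 * epot x y + 8 * (x - 1) ^+ 2.
Definition ppotyy (x y : R) := 4 * (dpot x y + epot x y) + 16 * y ^+ 2.
(** [apot] and [bpot] are the second derivatives of the potential in x and y. They are kept apart so
    that each is integrated first in its own variable; their sum [hpot] is the curvature density. *)
Definition apot (x y : R) := (ppotxx x y * ppot x y - ppotx x y ^+ 2) / ppot x y ^+ 2.
Definition bpot (x y : R) := (ppotyy x y * ppot x y - ppoty x y ^+ 2) / ppot x y ^+ 2.
Definition hpot (x y : R) := 16 * dpot x y * epot x y / ppot x y ^+ 2.

Lemma dpot_epot_ge x y : 1 / 2 <= dpot x y + epot x y.
Proof. by rewrite /dpot /epot; have := (sqr_ge0 y, sqr_ge0 (2 * x - 1)) => -[]; nra. Qed.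

Lemma dpot_ge0 x y : 0 <= dpot x y. Proof. by rewrite addr_ge0 ?sqr_ge0. Qed.
Lemma epot_ge0 x y : 0 <= epot x y. Proof. by rewrite addr_ge0 ?sqr_ge0. Qed.

Lemma ppot_ge x y : (dpot x y + epot x y) ^+ 2 <= 2 * ppot x y.
Proof. by rewrite /ppot; have := sqr_ge0 (dpot x y - epot x y); nra. Qed.

Lemma ppot_gt0 x y : 0 < ppot x y.
Proof. by have := dpot_epot_ge x y; have := ppot_ge x y; nra. Qed.

Lemma hpotE x y : hpot x y = apot x y + bpot x y.
Proof.
rewrite /hpot /apot /bpot -mulrDl; congr (_ / _).
by rewrite /ppotxx /ppotyy /ppotx /ppoty /ppot /dpot /epot; ring.
Qed.

Lemma hpot_ge0 x y : 0 <= hpot x y.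
Proof. by rewrite /hpot !mulr_ge0 ?invr_ge0 ?sqr_ge0 ?dpot_ge0 ?epot_ge0. Qed.

(** Since s <= 4 p, the two terms are at most 48 and 64 times p^2, with sum 112. The bound only
    serves integrability on rectangles. *)
Lemma pot_bound (s p k l : R) : 1 / 2 <= s -> s ^+ 2 <= 2 * p -> 0 <= k <= 12 * s ->
  0 <= l <= 16 * s * p -> `|(k * p - l) / p ^+ 2| <= 112.
Proof.
move=> s0 sp /andP[k0 ks] /andP[l0 ls]; have p0 : 0 < p by nra.
have p2 : 0 < p ^+ 2 by rewrite exprn_gt0.
rewrite normrM normfV (gtr0_norm p2) ler_pdivrMr// ler_norml.
have sp4 : s <= 4 * p by nra.
have h1 : 0 <= k * p by rewrite mulr_ge0// ltW.
have h2 : k * p <= 48 * p ^+ 2.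
  by rewrite expr2 mulrA ler_wpM2r ?(ltW p0)//; lra.
have h3 : l <= 64 * p ^+ 2.
  by apply: (le_trans ls); rewrite expr2 mulrA ler_wpM2r ?(ltW p0)//; lra.
by apply/andP; split; nra.
Qed.

Lemma apot_bound x y : `|apot x y| <= 112.
Proof.
apply: (@pot_bound (dpot x y + epot x y)); [exact: dpot_epot_ge|exact: ppot_ge|..].
  rewrite /ppotxx; have := (sqr_ge0 x, sqr_ge0 (x - 1), sqr_ge0 y).
  by rewrite /dpot /epot => -[[]] *; apply/andP; split; lra.
rewrite sqr_ge0 /=; have D0 := dpot_ge0 x y; have E0 := epot_ge0 x y.
have h : (x * dpot x y + (x - 1) * epot x y) ^+ 2 <= (x ^+ 2 + (x - 1) ^+ 2) * ppot x y.
  by have := sqr_ge0 (x * epot x y - (x - 1) * dpot x y); rewrite /ppot; nra.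
have h2 : x ^+ 2 + (x - 1) ^+ 2 <= dpot x y + epot x y.
  by rewrite /dpot /epot; have := sqr_ge0 y; lra.
have := ler_wpM2r (ltW (ppot_gt0 x y)) h2; rewrite /ppotx; nra.
Qed.

Lemma bpot_bound x y : `|bpot x y| <= 112.
Proof.
apply: (@pot_bound (dpot x y + epot x y)); [exact: dpot_epot_ge|exact: ppot_ge|..].
  rewrite /ppotyy; have := (sqr_ge0 x, sqr_ge0 (x - 1), sqr_ge0 y).
  by rewrite /dpot /epot => -[[]] *; apply/andP; split; lra.
rewrite sqr_ge0 /=; have s0 := dpot_epot_ge x y; have sp := ppot_ge x y.
have y2 : 2 * y ^+ 2 <= dpot x y + epot x y.
  by rewrite /dpot /epot; have := (sqr_ge0 x, sqr_ge0 (x - 1)) => -[]; lra.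
rewrite /ppoty; move: (dpot x y + epot x y) (ppot x y) s0 sp y2 => s p s0 sp y2.
have h1 := ler_wpM2r (sqr_ge0 s) y2.
have sg0 : 0 <= s by lra.
have h2 := ler_wpM2l sg0 sp.
by rewrite !exprMn; nra.
Qed.

Lemma HD_dpotx (x y : R) : is_derive x 1 (dpot^~ y) (2 * x).
Proof. by apply: (HD_eq (HDD (HDX 2 (HDid x)) (HDc (y ^+ 2) x))); rewrite expr1; ring. Qed.
Lemma HD_epotx (x y : R) : is_derive x 1 (epot^~ y) (2 * (x - 1)).
Proof. by apply: (HD_eq (HDD (HDX 2 (HDB (HDid x) (HDc 1 x))) (HDc (y ^+ 2) x))); rewrite expr1; ring. Qed.
Lemma HD_dpoty (x y : R) : is_derive y 1 (dpot x) (2 * y).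
Proof. by apply: (HD_eq (HDD (HDc (x ^+ 2) y) (HDX 2 (HDid y)))); rewrite expr1; ring. Qed.
Lemma HD_epoty (x y : R) : is_derive y 1 (epot x) (2 * y).
Proof. by apply: (HD_eq (HDD (HDc ((x - 1) ^+ 2) y) (HDX 2 (HDid y)))); rewrite expr1; ring. Qed.

Lemma HD_ppot_x (x y : R) : is_derive x 1 (ppot^~ y) (ppotx x y).
Proof.
apply: (HD_eq (HDD (HDX 2 (HD_dpotx x y)) (HDX 2 (HD_epotx x y)))).
by rewrite /= /ppotx expr1; ring.
Qed.
Lemma HD_ppotx_x (x y : R) : is_derive x 1 (ppotx^~ y) (ppotxx x y).
Proof.
apply: (HD_eq (HDD (HDM (HDZ 4 (HDid x)) (HD_dpotx x y))
  (HDM (HDZ 4 (HDB (HDid x) (HDc 1 x))) (HD_epotx x y)))).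
by rewrite /ppotxx; ring.
Qed.
Lemma HD_ppot_y (x y : R) : is_derive y 1 (ppot x) (ppoty x y).
Proof.
apply: (HD_eq (HDD (HDX 2 (HD_dpoty x y)) (HDX 2 (HD_epoty x y)))).
by rewrite /= /ppoty expr1; ring.
Qed.
Lemma HD_ppoty_y (x y : R) : is_derive y 1 (ppoty x) (ppotyy x y).
Proof.
apply: (HD_eq (HDM (HDZ 4 (HDid y)) (HDD (HD_dpoty x y) (HD_epoty x y)))).
by rewrite /ppotyy; ring.
Qed.

Let Pn x y : ppot x y != 0. Proof. by rewrite gt_eqF// ppot_gt0. Qed.

Lemma HD_potx (x y : R) : is_derive x 1 (fun u => ppotx u y / ppot u y) (apot x y).
Proof.
have H := HDM (HD_ppotx_x x y) (HDV (f := ppot^~ y) (x := x) (Pn x y) (HD_ppot_x x y)).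
by apply: (HD_eq H); rewrite /apot; have := Pn x y; move: (ppot x y) => p p0; field.
Qed.
Lemma HD_poty (x y : R) : is_derive y 1 (fun u => ppoty x u / ppot x u) (bpot x y).
Proof.
have H := HDM (HD_ppoty_y x y) (HDV (Pn x y) (HD_ppot_y x y)).
by apply: (HD_eq H); rewrite /bpot; have := Pn x y; move: (ppot x y) => p p0; field.
Qed.

Lemma apot_cont y : continuous (apot^~ y).
Proof.
move=> x; have cP := HDcont (HD_ppot_x x y); have cPx := HDcont (HD_ppotx_x x y).
have cPxx : {for x, continuous (ppotxx^~ y)}.
  have H := HDD (HDD (HDD (HDZ 4 (HD_dpotx x y)) (HDZ 8 (HDX 2 (HDid x)))) (HDZ 4 (HD_epotx x y)))
    (HDZ 8 (HDX 2 (HDB (HDid x) (HDc 1 x)))).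
  exact: HDcont H.
have P2 : ppot x y ^+ 2 != 0 by rewrite expf_neq0.
exact: (cvgM (cvgB (cvgM cPxx cP) (cvgM cPx cPx)) (cvgV P2 (cvgM cP cP))).
Qed.

Lemma bpot_cont x : continuous (bpot x).
Proof.
move=> y; have cP := HDcont (HD_ppot_y x y); have cPy := HDcont (HD_ppoty_y x y).
have cPyy : {for y, continuous (ppotyy x)}.
  have H := HDD (HDZ 4 (HDD (HD_dpoty x y) (HD_epoty x y))) (HDZ 16 (HDX 2 (HDid y))).
  exact: HDcont H.
have P2 : ppot x y ^+ 2 != 0 by rewrite expf_neq0.
exact: (cvgM (cvgB (cvgM cPyy cP) (cvgM cPy cPy)) (cvgV P2 (cvgM cP cP))).
Qed.

Let mX : measurable_fun setT (fun p : R * R => p.1). Proof. exact: measurable_fst. Qed.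
Let mY : measurable_fun setT (fun p : R * R => p.2). Proof. exact: measurable_snd. Qed.
Let mC (k : R) : measurable_fun setT (fun p : R * R => k). Proof. exact: measurable_cst. Qed.
Let mA := @measurable_funD _ (R * R)%type R setT.
Let mB := @measurable_funB _ (R * R)%type R setT.
Let mM := @measurable_funM _ (R * R)%type R setT.
Let mE (f : R * R -> R) n : measurable_fun setT f -> measurable_fun setT (fun p => f p ^+ n).
Proof. exact: measurable_funX. Qed.

Let mD : measurable_fun setT (fun p : R * R => dpot p.1 p.2).
Proof. exact: mA (mE 2 mX) (mE 2 mY). Qed.
Let mEp : measurable_fun setT (fun p : R * R => epot p.1 p.2).
Proof. exact: mA (mE 2 (mB mX (mC 1))) (mE 2 mY). Qed.
Let mP : measurable_fun setT (fun p : R * R => ppot p.1 p.2).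
Proof. exact: mA (mE 2 mD) (mE 2 mEp). Qed.
Let mPV : measurable_fun setT (fun p : R * R => (ppot p.1 p.2 ^+ 2)^-1).
Proof.
have -> : (fun p : R * R => (ppot p.1 p.2 ^+ 2)^-1) = (fun p => expR (0 - ln (ppot p.1 p.2 ^+ 2))).
  by apply/funext => p; rewrite sub0r expRN lnK// posrE exprn_gt0// ppot_gt0.
apply: measurableT_comp; first exact: measurable_expR.
apply: (mB (mC 0)); apply: measurableT_comp; [exact: measurable_ln | exact: mE].
Qed.

Lemma apot_measurable : measurable_fun setT (fun p : R * R => apot p.1 p.2).
Proof.
apply: mM mPV; apply: mB; last first.
  exact: mE (mA (mM (mM (mC 4) mX) mD) (mM (mM (mC 4) (mB mX (mC 1))) mEp)).
apply: mM mP.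
exact: mA (mA (mA (mM (mC 4) mD) (mM (mC 8) (mE 2 mX))) (mM (mC 4) mEp)) (mM (mC 8) (mE 2 (mB mX (mC 1)))).
Qed.

Lemma bpot_measurable : measurable_fun setT (fun p : R * R => bpot p.1 p.2).
Proof.
apply: mM mPV; apply: mB; last exact: mE (mM (mM (mC 4) mY) (mA mD mEp)).
apply: mM mP; exact: mA (mM (mC 4) (mA mD mEp)) (mM (mC 16) (mE 2 mY)).
Qed.

Lemma hpot_measurable : measurable_fun setT (fun p : R * R => hpot p.1 p.2).
Proof.
have -> : (fun p : R * R => hpot p.1 p.2) = (fun p => apot p.1 p.2 + bpot p.1 p.2).
  by apply/funext => p; exact: hpotE.
exact: mA apot_measurable bpot_measurable.
Qed.

(** The divergence theorem on a rectangle, by Fubini and the fundamental theorem of calculus in each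
    variable. *)
Lemma hpot_square (a b c d : R) : a < b -> c < d ->
  (\int[mu2]_(p in `[a, b] `*` `[c, d]) (hpot p.1 p.2)%:E =
   \int[mu]_(y in `[c, d]) (ppotx b y / ppot b y - ppotx a y / ppot a y)%:E +
   \int[mu]_(x in `[a, b]) (ppoty x d / ppot x d - ppoty x c / ppot x c)%:E)%E.
Proof.
move=> ab cd.
rewrite -(rectangle_int_x (A := apot) c d ab apot_measurable apot_bound apot_cont
  (P := fun u y => ppotx u y / ppot u y) HD_potx).
rewrite -(rectangle_int_y (B := bpot) a b cd bpot_measurable bpot_bound bpot_cont
  (Q := fun x u => ppoty x u / ppot x u) HD_poty).
rewrite -integralD//=; first by apply: eq_integral => p _; rewrite -EFinD hpotE.
- exact: measurableX.
- exact: rectangle_integrable apot_measurable (fun p => apot_bound p.1 p.2).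
- exact: rectangle_integrable bpot_measurable (fun p => bpot_bound p.1 p.2).
Qed.

End Rectangles.

(** * The flux through large squares, and the curvature of the dual metric *)

Section TotalCurvature.
Variable R : realType.
Local Notation mu := (@lebesgue_measure R).
Local Notation mu2 := (mu \x mu)%E.
Local Notation C := R[i].

(** A side of the square of half side N is seen from the center under the angle pi / 2. *)
Lemma atan_integral (m N k : R) : 0 < N ->
  (\int[mu]_(x in `[(m - N)%R, (m + N)%R]) (k * (N / (N ^+ 2 + (x - m) ^+ 2)))%:E = (k * (pi / 2))%:E)%E.
Proof.
move=> N0; have Nn : N != 0 by rewrite gt_eqF.
have dn (x : R) : N ^+ 2 + (x - m) ^+ 2 != 0.
  by rewrite gt_eqF// ltr_pwDl ?sqr_ge0// exprn_gt0.
have dF (x : R) : is_derive x 1 (fun u => k * atan ((u - m) / N)) (k * (N / (N ^+ 2 + (x - m) ^+ 2))).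
  have H := HDcomp (f := @atan R) (g := fun u : R => (u - m) / N) (is_derive1_atan ((x - m) / N))
    (HDM (HDB (HDid x) (HDc m x)) (HDc N^-1 x)).
  apply: (HD_eq (HDZ k H)); congr (_ * _).
  have dn1 : 1 + ((x - m) / N) ^+ 2 != 0 by rewrite gt_eqF// ltr_pwDl ?sqr_ge0.
  have := dn x; move: (x - m) dn1 => y dn1 dn2.
  have -> : 1 + (y / N) ^+ 2 = (N ^+ 2 + y ^+ 2) / N ^+ 2 by field.
  by field; apply/andP.
rewrite (segment_FTC2 (F := fun u => k * atan ((u - m) / N)) _ _ dF).
- by rewrite (addrC m) addrK (addrC _ (- N)) addrK mulNr divff// atanN atan1; congr _%:E; field.
- by rewrite ltrBlDr -addrA ltrDl addr_gt0.
- move=> x; have c2 : {for x, continuous (fun u => N ^+ 2 + (u - m) ^+ 2)}.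
    exact: HDcont (HDD (HDc (N ^+ 2) x) (HDX 2 (HDB (HDid x) (HDc m x)))).
  exact: (cvgM (cvg_cst k) (cvgM (cvg_cst N) (cvgV (dn x) c2))).
Qed.

Lemma flux_bound (F : R -> R) (m N e : R) : 0 < N -> 0 <= e <= 8 -> continuous F ->
  (forall x, (8 - e) * (N / (N ^+ 2 + (x - m) ^+ 2)) <= F x <= (8 + e) * (N / (N ^+ 2 + (x - m) ^+ 2))) ->
  (((8 - e) * (pi / 2))%:E <= \int[mu]_(x in `[(m - N)%R, (m + N)%R]) (F x)%:E <= ((8 + e) * (pi / 2))%:E)%E.
Proof.
move=> N0 /andP[e0 e8] cF bF.
have n0 x : 0 <= N / (N ^+ 2 + (x - m) ^+ 2).
  by rewrite divr_ge0 ?(ltW N0)// addr_ge0 ?sqr_ge0.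
have n8 x (k : R) : 0 <= k -> 0 <= k * (N / (N ^+ 2 + (x - m) ^+ 2)) by move=> k0; rewrite mulr_ge0.
have F0 x : 0 <= F x by have /andP[h _] := bF x; apply: le_trans h; rewrite n8// subr_ge0.
have mk (k : R) : measurable_fun `[(m - N)%R, (m + N)%R] (EFin \o (fun x => k * (N / (N ^+ 2 + (x - m) ^+ 2)))).
  apply: measurable_funTS; apply/measurable_EFinP.
  apply: continuous_measurable_fun => x.
  have c2 : {for x, continuous (fun u => N ^+ 2 + (u - m) ^+ 2)}.
    exact: HDcont (HDD (HDc (N ^+ 2) x) (HDX 2 (HDB (HDid x) (HDc m x)))).
  have dn : N ^+ 2 + (x - m) ^+ 2 != 0 by rewrite gt_eqF// ltr_pwDl ?sqr_ge0// exprn_gt0.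
  exact: (cvgM (cvg_cst k) (cvgM (cvg_cst N) (cvgV dn c2))).
have mF : measurable_fun `[(m - N)%R, (m + N)%R] (EFin \o F).
  apply: measurable_funTS; apply/measurable_EFinP.
  exact: continuous_measurable_fun.
rewrite -!(atan_integral m _ N0); apply/andP; split.
  apply: ge0_le_integral => //.
  - by move=> x _; rewrite lee_fin n8// subr_ge0.
  - exact: mk.
  - by move=> x _; rewrite lee_fin; case/andP: (bF x).
apply: ge0_le_integral => //.
- by move=> x _; rewrite lee_fin.
- exact: mk.
- by move=> x _; rewrite lee_fin; case/andP: (bF x).
Qed.

(* Both fluxes through the sides of a large square are compared with 8 N / r,
   where r is the squared distance to the center 1/2. *)
Lemma flux_compare (N r w v e : R) : 0 < N -> N ^+ 2 <= r -> 0 < w -> e = 10 / N ^+ 2 ->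
  `|v * r - 8 * N * w| <= 10 * w / N ->
  (8 - e) * (N / r) <= v / w <= (8 + e) * (N / r).
Proof.
move=> N0 Nr w0 eE; have r0 : 0 < r by apply: lt_le_trans Nr; rewrite exprn_gt0.
rewrite ler_norml => /andP[h1 h2].
have E : 10 * w / N = e * N * w by rewrite eE; field; rewrite gt_eqF.
have rE (k : R) : k * (N / r) * w * r = k * N * w by field; rewrite gt_eqF.
rewrite E in h1 h2; rewrite ler_pdivlMr// ler_pdivrMr// -(ler_pM2r r0) rE -(ler_pM2r r0 v) rE.
by apply/andP; split; lra.
Qed.

(** On the side x = 1/2 + N the squared distances to 0 and 1 are [sN N y + N] and [sN N y - N]; on
    the sides at height N and - N, with u = x - 1/2, they are [sN N u + u] and [sN N u - u].
    Centering the squares at 1/2 gives this symmetry. *)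
Let sN (N y : R) := N ^+ 2 + y ^+ 2 + 1 / 4.

Lemma flux_x (N y e : R) : 1 <= N -> e = 10 / N ^+ 2 ->
  (8 - e) * (N / (N ^+ 2 + y ^+ 2)) <=
  (8 * N * sN N y + 4 * N) / (sN N y ^+ 2 + N ^+ 2) <= (8 + e) * (N / (N ^+ 2 + y ^+ 2)).
Proof.
move=> N1 eE; have N0 : 0 < N by lra.
have y2 := sqr_ge0 y; have Nn : 1 <= N ^+ 2 by nra.
apply: flux_compare => //; first by rewrite lerDl.
  by rewrite ltr_pwDr ?sqr_ge0// ?exprn_gt0.
rewrite /sN; set r := N ^+ 2 + y ^+ 2.
have rN : N ^+ 2 <= r by rewrite lerDl.
have -> : (8 * N * (r + 1 / 4) + 4 * N) * r - 8 * N * ((r + 1 / 4) ^+ 2 + N ^+ 2) =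
  2 * N * (r - 1 / 4 - 4 * N ^+ 2) by field.
rewrite ler_pdivlMr// -(gtr0_norm N0) -normrM (gtr0_norm N0).
have -> : 2 * N * (r - 1 / 4 - 4 * N ^+ 2) * N = 2 * N ^+ 2 * (r - 1 / 4 - 4 * N ^+ 2) by ring.
rewrite ler_norml; move: (N ^+ 2) r Nn rN => M r Nn rN; apply/andP; split; nra.
Qed.

Lemma flux_y (N u e : R) : 1 <= N -> e = 10 / N ^+ 2 ->
  (8 - e) * (N / (N ^+ 2 + u ^+ 2)) <=
  8 * N * sN N u / (sN N u ^+ 2 + u ^+ 2) <= (8 + e) * (N / (N ^+ 2 + u ^+ 2)).
Proof.
move=> N1 eE; have N0 : 0 < N by lra.
have u2 := sqr_ge0 u; have Nn : 1 <= N ^+ 2 by nra.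
apply: flux_compare => //; first by rewrite lerDl.
  by rewrite ltr_pwDl ?sqr_ge0// exprn_gt0// /sN; lra.
rewrite /sN; set r := N ^+ 2 + u ^+ 2.
have rN : N ^+ 2 <= r by rewrite lerDl.
have -> : 8 * N * (r + 1 / 4) * r - 8 * N * ((r + 1 / 4) ^+ 2 + u ^+ 2) =
  8 * N * (- (r + 1 / 4) / 4 - u ^+ 2) by field.
have ur : u ^+ 2 = r - N ^+ 2 by rewrite /r; ring.
rewrite ler_pdivlMr// -(gtr0_norm N0) -normrM (gtr0_norm N0).
have -> : 8 * N * (- (r + 1 / 4) / 4 - u ^+ 2) * N = 8 * N ^+ 2 * (- (r + 1 / 4) / 4 - u ^+ 2) by ring.
rewrite ur; rewrite ur in u2; clear ur.
rewrite ler_norml; move: (N ^+ 2) r u2 Nn rN => M r u2 Nn rN; apply/andP; split; nra.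
Qed.

Lemma sN_cont (N y : R) : {for y, continuous (sN N)}.
Proof. exact: HDcont (HDD (HDD (HDc (N ^+ 2) y) (HDX 2 (HDid y))) (HDc (1 / 4) y)). Qed.

Lemma sN_gt0 (N y : R) : 0 < sN N y.
Proof. by rewrite /sN; have := (sqr_ge0 N, sqr_ge0 y) => -[]; lra. Qed.

(** The potential grows like 4 ln |z|. Each pair of opposite sides contributes 8 times the angle pi
    / 2, up to the relative error governed by [e]. *)
Lemma hpot_square_bound (N e : R) : 2 <= N -> e = 10 / N ^+ 2 ->
  (((8 - e) * pi)%:E <=
   \int[mu2]_(p in `[(1 / 2 - N)%R, (1 / 2 + N)%R] `*` `[(- N)%R, N]) (hpot p.1 p.2)%:E
   <= ((8 + e) * pi)%:E)%E.
Proof.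
move=> N2 eE; have N0 : 0 < N by lra.
have e8 : 0 <= e <= 8.
  rewrite eE divr_ge0 ?sqr_ge0//= ler_pdivrMr ?exprn_gt0//.
  by nra.
rewrite hpot_square; [|lra|lra].
have N1 : 1 <= N by lra.
have /andP[l1 u1] : (((8 - e) * (pi / 2))%:E <= \int[mu]_(y in `[(- N)%R, N]) (ppotx (1 / 2 + N) y /
    ppot (1 / 2 + N) y - ppotx (1 / 2 - N) y / ppot (1 / 2 - N) y)%:E <= ((8 + e) * (pi / 2))%:E)%E.
  have FE y : ppotx (1 / 2 + N) y / ppot (1 / 2 + N) y - ppotx (1 / 2 - N) y / ppot (1 / 2 - N) y =
      (8 * N * sN N y + 4 * N) / (sN N y ^+ 2 + N ^+ 2).
    have -> : ppot (1 / 2 + N) y = 2 * (sN N y ^+ 2 + N ^+ 2) by rewrite /ppot /dpot /epot /sN; field.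
    have -> : ppot (1 / 2 - N) y = 2 * (sN N y ^+ 2 + N ^+ 2) by rewrite /ppot /dpot /epot /sN; field.
    have -> : ppotx (1 / 2 + N) y = 8 * N * sN N y + 4 * N by rewrite /ppotx /dpot /epot /sN; field.
    have -> : ppotx (1 / 2 - N) y = - (8 * N * sN N y + 4 * N) by rewrite /ppotx /dpot /epot /sN; field.
    have : sN N y ^+ 2 + N ^+ 2 != 0 by rewrite gt_eqF// ltr_pwDl ?sqr_ge0// exprn_gt0// sN_gt0.
    by move: (sN N y ^+ 2 + N ^+ 2) => p p0; field.
  under eq_integral do rewrite FE.
  have := @flux_bound (fun y => (8 * N * sN N y + 4 * N) / (sN N y ^+ 2 + N ^+ 2)) 0 N e N0 e8.
  rewrite sub0r add0r; apply=> y; last by rewrite subr0; exact: flux_x.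
  have c := @sN_cont N y.
  have p0 : sN N y ^+ 2 + N ^+ 2 != 0 by rewrite gt_eqF// ltr_pwDl ?sqr_ge0// exprn_gt0// sN_gt0.
  exact: (cvgM (cvgD (cvgM (cvg_cst (8 * N)) c) (cvg_cst (4 * N))) (cvgV p0 (cvgD (cvgM c c) (cvg_cst (N ^+ 2))))).
have /andP[l2 u2] : (((8 - e) * (pi / 2))%:E <= \int[mu]_(x in `[(1 / 2 - N)%R, (1 / 2 + N)%R]) (ppoty x N /
    ppot x N - ppoty x (- N) / ppot x (- N))%:E <= ((8 + e) * (pi / 2))%:E)%E.
  have FE x : ppoty x N / ppot x N - ppoty x (- N) / ppot x (- N) =
      8 * N * sN N (x - 1 / 2) / (sN N (x - 1 / 2) ^+ 2 + (x - 1 / 2) ^+ 2).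
    have -> : ppot x N = 2 * (sN N (x - 1 / 2) ^+ 2 + (x - 1 / 2) ^+ 2) by rewrite /ppot /dpot /epot /sN; field.
    have -> : ppot x (- N) = 2 * (sN N (x - 1 / 2) ^+ 2 + (x - 1 / 2) ^+ 2) by rewrite /ppot /dpot /epot /sN; field.
    have -> : ppoty x N = 8 * N * sN N (x - 1 / 2) by rewrite /ppoty /dpot /epot /sN; field.
    have -> : ppoty x (- N) = - (8 * N * sN N (x - 1 / 2)) by rewrite /ppoty /dpot /epot /sN; field.
    have : sN N (x - 1 / 2) ^+ 2 + (x - 1 / 2) ^+ 2 != 0.
      by rewrite gt_eqF// ltr_pwDl ?sqr_ge0// exprn_gt0// sN_gt0.
    by move: (_ ^+ 2 + _) => p p0; field.
  under eq_integral do rewrite FE.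
  apply: (@flux_bound (fun x => 8 * N * sN N (x - 1 / 2) / (sN N (x - 1 / 2) ^+ 2 + (x - 1 / 2) ^+ 2)) (1 / 2) N e N0 e8) => x; last exact: flux_y.
  have cx : {for x, continuous (fun t : R => t - 1 / 2)} by exact: HDcont (HDB (HDid x) (HDc (1 / 2) x)).
  have c : {for x, continuous (fun t : R => sN N (t - 1 / 2))}.
    exact: (@continuous_comp _ _ _ (fun t : R => t - 1 / 2) (sN N) x cx (@sN_cont N (x - 1 / 2))).
  have p0 : sN N (x - 1 / 2) ^+ 2 + (x - 1 / 2) ^+ 2 != 0.
    by rewrite gt_eqF// ltr_pwDl ?sqr_ge0// exprn_gt0// sN_gt0.
  exact: (cvgM (cvgM (cvg_cst (8 * N)) c) (cvgV p0 (cvgD (cvgM c c) (cvgM cx cx)))).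
have E (k : R) : (k * pi)%:E = ((k * (pi / 2))%:E + (k * (pi / 2))%:E)%E.
  by rewrite -EFinD; congr _%:E; field.
by rewrite !E !leeD.
Qed.

Lemma hpot_total : (\int[mu2]_p (hpot p.1 p.2)%:E = (8 * pi)%:E :> \bar R)%E.
Proof.
pose S (n : nat) : set (R * R) := `[(1 / 2 - n.+2%:R)%R, (1 / 2 + n.+2%:R)%R] `*` `[(- n.+2%:R)%R, n.+2%:R].
have ST : \bigcup_n S n = setT.
  apply/seteqP; split => // -[x y] _.
  have [n nE] : exists n : nat, `|x| + `|y| + 1 <= n%:R.
    exists (Num.truncn (`|x| + `|y| + 1)).+1; apply/ltW/truncnS_gt.
  exists n => //; have n2 : (n.+2%:R : R) = n%:R + 2 by rewrite -addn2 natrD.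
  have := (ler_norm x, ler_norm (- x), ler_norm y, ler_norm (- y)); rewrite !normrN => -[[[]]] *.
  by split => /=; rewrite in_itv /= n2; apply/andP; split; lra.
have mono : nondecreasing_seq S.
  apply/nondecreasing_seqP => n; rewrite subsetEset /S => -[x y] /= [].
  have n2 : (n.+3%:R : R) = n.+2%:R + 1 by rewrite natr1.
  rewrite /= !in_itv /= n2 => /andP[? ?] /andP[? ?].
  by split; apply/andP; split; lra.
have mS n : measurable (S n) by exact: measurableX.
have mh : measurable_fun setT (fun p : R * R => (hpot p.1 p.2)%:E).
  by apply/measurable_EFinP; exact: hpot_measurable.
have cv : (\int[mu2]_(p in S n) (hpot p.1 p.2)%:E @[n --> \oo] --> \int[mu2]_p (hpot p.1 p.2)%:E)%E.
  rewrite -[X in _ --> integral _ X _]ST; apply: ge0_nondecreasing_set_cvg_integral => //.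
  - by move=> n; exact: measurable_funTS.
  - by move=> n p _; rewrite lee_fin hpot_ge0.
have lim8 (k : R) : (((8 + k * harmonic n) * pi)%:E @[n --> \oo] --> (8 * pi : R)%:E)%E.
  apply: cvg_EFin; first by near=> n.
  have H : (8 + k * harmonic n) * pi @[n --> \oo] --> ((8 + k * 0) * pi : R).
    exact: (cvgM (cvgD (cvg_cst (8 : R)) (cvgM (cvg_cst k) (@cvg_harmonic R))) (cvg_cst pi)).
  by rewrite mulr0 addr0 in H.
apply: (cvg_unique _ cv) => //.
apply: (@squeeze_cvge _ _ _ _ (fun n => ((8 + -10 * harmonic n) * pi)%:E) _ (fun n => ((8 + 10 * harmonic n) * pi)%:E) _ _ (lim8 _) (lim8 _)).
near=> n; have n1 : 1 <= (n.+1%:R : R) by rewrite ler1n.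
have n2 : (n.+2%:R : R) = n.+1%:R + 1 by rewrite natr1.
have N2 : 2 <= (n.+2%:R : R) by rewrite ler_nat.
have /andP[h1 h2] := hpot_square_bound N2 erefl.
(* The error 10 / (n + 2)^2 is replaced by the larger 10 / (n + 1), whose limit is known. *)
have eh : 10 / n.+2%:R ^+ 2 <= 10 * harmonic n :> R.
  rewrite ler_wpM2l// /harmonic lef_pV2 ?posrE ?exprn_gt0 ?ltr0n//.
  by rewrite n2; nra.
have p0 := pi_ge0 R.
apply/andP; split.
  by apply: le_trans h1; rewrite lee_fin ler_wpM2r// mulNr lerD2l lerN2.
by apply: (le_trans h2); rewrite lee_fin ler_wpM2r// lerD2l.
Unshelve. all: by end_near. Qed.

Lemma derive1n2_near (g h k : R -> R) (l : R) : (\forall s \near (0 : R), g s = h s) ->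
  (\forall s \near (0 : R), is_derive (s : R) 1 h (k s)) -> is_derive (0 : R) 1 k l -> derive1n 2 g 0 = l.
Proof.
move=> gh hk kl; rewrite /derive1n /=; apply: HD1.
apply: (HD_near _ kl); near=> s; apply/esym/HD1.
have H : is_derive s 1 h (k s) by near: s.
apply: (HD_near _ H).
have : \forall t \near s, g t = h t by near: s; exact: (near_join gh).
by apply: filterS => t ->.
Unshelve. all: by end_near. Qed.

Lemma near_gt0 (f : R -> R) (x : R) : {for x, continuous f} -> 0 < f x ->
  \forall s \near x, 0 < f s.
Proof. by move=> fc fx; apply: (@cvgr_gt _ _ (nbhs x) _ f (f x) fc). Qed.

(** On horizontal and vertical lines the dual metric has the form c p^2 / d^3, with p = |z|^4 + |z -
    1|^4 and d = |z|^2. *)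
Lemma derive1n2_ln (g p p1 d d1 : R -> R) (c p2 d2 : R) : 0 < c ->
  (\forall s \near (0 : R), g s = c * (p s ^+ 2 / d s ^+ 3)) ->
  (forall s, 0 < p s) -> 0 < d 0 ->
  (forall s : R, is_derive s 1 p (p1 s)) -> (forall s : R, is_derive s 1 d (d1 s)) ->
  is_derive (0 : R) 1 p1 p2 -> is_derive (0 : R) 1 d1 d2 ->
  derive1n 2 (fun s => ln (g s)) 0 =
  2 * ((p2 * p 0 - p1 0 ^+ 2) / p 0 ^+ 2) - 3 * ((d2 * d 0 - d1 0 ^+ 2) / d 0 ^+ 2).
Proof.
move=> c0 gE pp d0 dp dd dp1 dd1.
have dln (f : R -> R) (s f' : R) : 0 < f s -> is_derive s 1 f f' ->
    is_derive s 1 (fun u => ln (f u)) ((f s)^-1 * f').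
  by move=> f0 df; apply: (HDcomp (f := @ln R) _ df); exact: is_derive1_ln.
have dn : \forall s \near (0 : R), 0 < d s by exact: near_gt0 (HDcont (dd 0)) d0.
apply: (@derive1n2_near _ (fun s => ln c + (2 * ln (p s) - 3 * ln (d s)))
   (fun s => 2 * ((p s)^-1 * p1 s) - 3 * ((d s)^-1 * d1 s))).
- apply: filterS2 gE dn => s -> ds.
  have ps2 : 0 < p s ^+ 2 by rewrite exprn_gt0.
  have d3 : 0 < d s ^+ 3 by rewrite exprn_gt0.
  by rewrite lnM ?posrE ?divr_gt0// ln_div ?posrE// !lnXn// !mulr_natl.
- apply: filterS dn => s ds.
  by apply: (HD_eq (HDD (HDc (ln c) s) (HDB (HDZ 2 (dln _ _ _ (pp s) (dp s))) (HDZ 3 (dln _ _ _ ds (dd s)))))); rewrite add0r.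
- have p0 : p 0 != 0 by rewrite gt_eqF.
  have d00 : d 0 != 0 by rewrite gt_eqF.
  apply: (HD_eq (HDB (HDZ 2 (HDM (HDV p0 (dp 0)) dp1)) (HDZ 3 (HDM (HDV d00 (dd 0)) dd1)))).
  by field; apply/andP.
Qed.

Section DualMetric.
Variable th : R.
Hypothesis th0 : th != 0.
Let G (z : C) := Some (gauss0 z).
Let q (z : C) := th%:C * (z - 1) / z ^+ 2.
Let sigma := dual_factor G q.

Lemma nm2_xy (x y : R) : nm (x +i* y) ^+ 2 = dpot x y.
Proof. by rewrite nm2. Qed.

Lemma nm2_xy1 (x y : R) : nm (x +i* y - 1) ^+ 2 = epot x y.
Proof. by rewrite nm2 /= subr0. Qed.

Lemma derive1_gauss0 (z : C) : z != 0 -> derive1 (@aff R \o G) z = 2 * (z - 1) / z ^+ 3.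
Proof.
move=> z0; apply: HD1.
have H := HDX 2 (HDM (HDB (HDid z) (HDc 1 z)) (HDV (f := id) z0 (HDid z))).
by apply: (HD_eq H); rewrite /=; field.
Qed.

(** At the branch point z = 1 of G the quotient Q / dG is evaluated as 0 / 0 = 0. The integrand of
    the total curvature vanishes there, and so does [hpot]. *)
Lemma dual_factor_1 : sigma 1 = 0.
Proof.
by rewrite /sigma /dual_factor /q subrr mulr0 !mul0r normr0 expr0n mulr0.
Qed.

Lemma dual_factorE (x y : R) : 0 < dpot x y -> 0 < epot x y ->
  sigma (x +i* y) = th ^+ 2 / 4 * (ppot x y ^+ 2 / dpot x y ^+ 3).
Proof.
move=> d0 e0; set z := x +i* y.
have z0 : z != 0 by rewrite -nm_eq0 -sqrf_eq0 nm2_xy gt_eqF.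
have z1 : z - 1 != 0 by rewrite -nm_eq0 -sqrf_eq0 nm2_xy1 gt_eqF.
rewrite /sigma /dual_factor derive1_gauss0// -[aff (G z)]/(gauss0 z) !nmE.
have -> : q z / (2 * (z - 1) / z ^+ 3) = th%:C / 2 * z.
  by rewrite /q; field; rewrite z0.
have -> : ((1 + (nm (gauss0 z))%:C ^+ 2) ^+ 2 * (nm (th%:C / 2 * z))%:C ^+ 2) =
  ((1 + nm (gauss0 z) ^+ 2) ^+ 2 * nm (th%:C / 2 * z) ^+ 2)%:C.
  by rewrite rmorphM !rmorphXn rmorphD rmorph1 !rmorphXn.
rewrite /= /gauss0 nmX !nmM !nmV nmR nm_nat.
have -> : (nm (z - 1) / nm z) ^+ 2 = epot x y / dpot x y by rewrite expr_div_n (nm2_xy x y : nm z ^+ 2 = _) (nm2_xy1 x y : nm (z - 1) ^+ 2 = _).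
have -> : (`|th| / 2 * nm z) ^+ 2 = th ^+ 2 / 4 * dpot x y.
  rewrite exprMn (nm2_xy x y : nm z ^+ 2 = _) expr_div_n real_normK ?num_real//.
  by congr (_ / _ * _); ring.
rewrite /ppot; move: (dpot x y) (epot x y) d0 => d e d0; field.
by rewrite gt_eqF.
Qed.

Lemma dual_curvature (x y : R) : 0 < dpot x y ->
  - gauss_curvature sigma (x +i* y) * sigma (x +i* y) = hpot x y.
Proof.
move=> d0; have [e0|] := ltP 0 (epot x y); last first.
  move=> e0; have := le_anti (introT andP (conj e0 (epot_ge0 x y))).
  move=> E; have -> : hpot x y = 0 by rewrite /hpot E mulr0 mul0r.
  move: E => /eqP; rewrite paddr_eq0 ?sqr_ge0// !sqrf_eq0 subr_eq0 => /andP[/eqP -> /eqP ->];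
  have e1 : 1 +i* 0 = 1 :> C by apply/eqP; rewrite eq_complex /= !eqxx.
  by rewrite e1 dual_factor_1 mulr0.
have c0 : 0 < th ^+ 2 / 4 by rewrite divr_gt0// exprn_even_gt0.
have sh (f : R -> R) (t k f' : R) : is_derive (t + k) 1 f f' -> is_derive k 1 (fun s => f (t + s)) f'.
  move=> H; apply: (HD_eq (HDcomp (f := f) (g := fun s => t + s) H (HDD (HDc t k) (HDid k)))).
  by rewrite add0r mulr1.
have sp (f : R -> R) (t f' : R) : is_derive (t + 0) 1 f f' -> 0 < f t ->
    \forall s \near (0 : R), 0 < f (t + s).
  move=> H ft; have c : {for (0 : R), continuous (fun s => f (t + s))} := HDcont (sh f t 0 f' H).
  by apply: (near_gt0 c); rewrite addr0.
have n1 := sp ((@dpot R)^~ y) x _ (HD_dpotx _ _) d0.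
have n2 := sp ((@epot R)^~ y) x _ (HD_epotx _ _) e0.
have n3 := sp (@dpot R x) y _ (HD_dpoty _ _) d0.
have n4 := sp (@epot R x) y _ (HD_epoty _ _) e0.
have L : laplacian (fun u => ln (sigma u)) (x +i* y) = 2 * hpot x y.
  have X : (fun s : R => ln (sigma (x +i* y + s%:C))) = (fun s : R => ln (sigma ((x + s) +i* y))).
    by apply/funext => s; congr (ln (sigma _)); apply/eqP; rewrite eq_complex /= addr0 !eqxx.
  have Y : (fun s : R => ln (sigma (x +i* y + s%:C * (0 +i* 1)))) = (fun s : R => ln (sigma (x +i* (y + s)))).
    apply/funext => s; congr (ln (sigma _)); apply/eqP; rewrite eq_complex /=.
    by apply/andP; split; apply/eqP; ring.
  rewrite (congr2 (fun f g : R -> R => derive1n 2 f 0 + derive1n 2 g 0) X Y : laplacian _ _ = _).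
  have zz : is_derive (0 : R) 1 (fun s : R => 2 * (x + s)) 2.
    by apply: (HD_eq (HDZ 2 (HDD (HDc x (0 : R)) (HDid (0 : R))))); rewrite add0r mulr1.
  have zw : is_derive (0 : R) 1 (fun s : R => 2 * (y + s)) 2.
    by apply: (HD_eq (HDZ 2 (HDD (HDc y (0 : R)) (HDid (0 : R))))); rewrite add0r mulr1.
  have d0x : 0 < dpot (x + 0) y by rewrite addr0.
  have d0y : 0 < dpot x (y + 0) by rewrite addr0.
  have LX := derive1n2_ln c0 (filterS2 _ (fun s h1 h2 => dual_factorE h1 h2) n1 n2)
    (fun s => ppot_gt0 (x + s) y) d0x (fun s => sh ((@ppot R)^~ y) x s _ (HD_ppot_x (x + s) y))
    (fun s => sh ((@dpot R)^~ y) x s _ (HD_dpotx (x + s) y))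
    (sh ((@ppotx R)^~ y) x 0 _ (HD_ppotx_x (x + 0) y)) zz.
  have LY := derive1n2_ln c0 (filterS2 _ (fun s h1 h2 => dual_factorE h1 h2) n3 n4)
    (fun s => ppot_gt0 x (y + s)) d0y (fun s => sh (@ppot R x) y s _ (HD_ppot_y x (y + s)))
    (fun s => sh (@dpot R x) y s _ (HD_dpoty x (y + s)))
    (sh (@ppoty R x) y 0 _ (HD_ppoty_y x (y + 0))) zw.
  rewrite !addr0 in LX LY.
  apply: (etrans (congr2 +%R (LX (nbhs_filter _)) (LY (nbhs_filter _)))).
  rewrite hpotE -/(apot x y) -/(bpot x y).
  (* The logarithm of |z|^2 is harmonic, so the denominator of the metric does not contribute to the
     curvature. *)
  have D : (2 * dpot x y - (2 * x) ^+ 2) / dpot x y ^+ 2 + (2 * dpot x y - (2 * y) ^+ 2) / dpot x y ^+ 2 = 0.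
    have E : 2 * dpot x y - (2 * x) ^+ 2 + (2 * dpot x y - (2 * y) ^+ 2) = 0 by rewrite /dpot; ring.
    by rewrite -mulrDl E mul0r.
  have ar (a b u v : R) : u + v = 0 -> 2 * a - 3 * u + (2 * b - 3 * v) = 2 * (a + b).
    by move=> /eqP; rewrite addr_eq0 => /eqP ->; ring.
  exact: ar D.
rewrite /gauss_curvature L dual_factorE//.
have s0 : th ^+ 2 / 4 * (ppot x y ^+ 2 / dpot x y ^+ 3) != 0.
  by rewrite gt_eqF// mulr_gt0// divr_gt0// exprn_gt0// ppot_gt0.
by move: (_ / 4 * _) s0 => s s0; field.
Qed.

(** The integrand is [hpot] on the punctured plane; extending the integral to the whole plane is
    harmless because [hpot] vanishes at the origin. *)
Theorem dual_TA_gauss0 : dual_TA G q = (8 * pi)%:E.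
Proof.
rewrite /dual_TA -hpot_total integral_mkcond; apply: eq_integral => -[x y] _.
rewrite /patch; case: ifPn => [|].
  rewrite inE /= => z0; rewrite dual_curvature//.
  by rewrite lt_def dpot_ge0 andbT -nm2_xy sqrf_eq0 nm_eq0.
rewrite notin_setE /= => /negP; rewrite negbK => /eqP[-> ->].
by rewrite /hpot /dpot expr0n addr0 mulr0 !mul0r.
Qed.

End DualMetric.

End TotalCurvature.

(** * Uniqueness *)

Section Liouville.
Variable R : realType.
Local Notation C := R[i].
Local Notation M2 := 'M[C]_2.
Local Notation Re := (@complex.Re R).
Local Notation Im := (@complex.Im R).

Lemma bounded_on_disc (f : C -> C) (r : R) : (forall z : C, {for z, continuous f}) ->
  exists2 M : R, 0 <= M & forall z, nm z <= r -> nm (f z) <= M.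
Proof.
move=> fc.
pose g (p : R * R) : R := nm (f (p.1 +i* p.2)).
have sc (a b : R) : compact [set x : R | a <= x <= b].
  have -> : [set x : R | a <= x <= b] = [set` Interval (BLeft a) (BRight b)].
    by apply/seteqP; split => x; rewrite /= in_itv.
  exact: segment_compact.
have gc : continuous g.
  move=> -[x y].
  have c1 : (p.1 : R) @[p --> nbhs (x, y)] --> x by exact: cvg_fst.
  have c2 : (p.2 : R) @[p --> nbhs (x, y)] --> y by exact: cvg_snd.
  have cp : {for (x, y), continuous (fun p : R * R => p.1 +i* p.2)}.
    exact: (cvg_ReIm (FF := nbhs_filter (x, y))).
  have cf := @continuous_comp _ _ _ (fun p : R * R => p.1 +i* p.2) f (x, y) cp (fc _).
  apply/(@cvgrPdistC_lt _ _ _ _ (nbhs_filter (x, y))) => e e0.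
  have := (cvgC_P (FF := nbhs_filter (x, y)) _ _).1 cf e e0.
  apply: filterS => p pe; apply: le_lt_trans pe; rewrite /g ler_norml.
  have := nmB (f (p.1 +i* p.2)) (f (x +i* y)).
  have := nmD (f (p.1 +i* p.2) - f (x +i* y)) (f (x +i* y)).
  have := nmD (f (x +i* y) - f (p.1 +i* p.2)) (f (p.1 +i* p.2)).
  rewrite !subrK (nm_sym (f (x +i* y))) /=; move=> h1 h2 _; apply/andP; split; lra.
have [M [_ HM]] := compact_bounded (continuous_compact (continuous_subspaceT gc)
   (compact_setX (sc (- r) r) (sc (- r) r))).
exists (`|M| + 1); first by rewrite addr_ge0.
move=> z zr; have M1 : M < `|M| + 1 by rewrite ltr_pwDr// ler_norm.
have := HM _ M1 (nm (f z)); rewrite /= ger0_norm ?nm_ge0//; apply.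
exists (Re z, Im z); last by rewrite /g -complexRI.
have := (nm_Re z, nm_Im z) => -[h1 h2].
by split; rewrite /= -ler_norml; [apply: le_trans h1 zr | apply: le_trans h2 zr].
Qed.

Lemma near'_at0 (f g : C -> C) : {for 0, continuous f} -> {for 0, continuous g} ->
  (\forall t \near (0 : C)^', f t = g t) -> f 0 = g 0.
Proof.
move=> /contC_P fc /contC_P gc /near'CP[r r0 fg].
apply/eqP; rewrite -subr_eq0 -nm_eq0 eq_le nm_ge0 andbT.
apply/ler_addgt0Pl => e e0; rewrite addr0.
have e2 : 0 < e / 2 by rewrite divr_gt0.
have [df df0 Hf] := fc _ e2; have [dg dg0 Hg] := gc _ e2.
pose k := Num.min r (Num.min df dg) / 2.
have m0 : 0 < Num.min r (Num.min df dg) by rewrite !lt_min r0 df0.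
have k0 : 0 < k by rewrite divr_gt0.
have kk : k < Num.min r (Num.min df dg) by rewrite ltr_pdivrMr// ltr_pMr// ltr1n.
move: kk; rewrite !lt_min => /and3P[kr kf kg].
have nk : nm (k%:C : C) = k by rewrite nmR ger0_norm// ltW.
have kn0 : (k%:C : C) != 0 by rewrite -nm_eq0 nk gt_eqF.
have E := fg k%:C kn0; rewrite subr0 nk in E; have {}E := E kr.
have h1 := Hf k%:C; rewrite subr0 nk in h1; have {}h1 := h1 kf.
have h2 := Hg k%:C; rewrite subr0 nk in h2; have {}h2 := h2 kg.
have -> : f 0 - g 0 = (g k%:C - g 0) - (f k%:C - f 0) by rewrite E; ring.
by apply: (le_trans (nmB _ _)); rewrite [leRHS](splitr e) ltW// ltrD.
Qed.

(** [h0] fills the puncture; the resulting entire function has linear growth, being bounded on the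
    disc where the growth condition does not apply. *)
Lemma liouville_punctured (h h0 : C -> C) (K r : R) :
  (forall z : C, z != 0 -> derivable h z 1) -> derivable h0 0 1 ->
  (\forall t \near (0 : C)^', h t = h0 t) -> (forall z, r <= nm z -> nm (h z) <= K * nm z) ->
  exists a : C, forall z, z != 0 -> h z = h0 0 + a * z.
Proof.
move=> dh dh0 /near'CP[d d0 hh0] hK.
pose f z := if z == 0 then h0 0 else h z.
have fh z : z != 0 -> f z = h z by rewrite /f => /negbTE ->.
have fd (z : C) : derivable f z 1.
  have [->|z0] := eqVneq z 0.
    apply: cHDd (cHD_near _ (cHDder dh0)); apply/nearCP; exists d => // u ud; rewrite /f.
    by case: eqP => [->//|/eqP u0]; rewrite hh0.
  apply: cHDd (cHD_near _ (cHDder (dh z z0))); apply/nearCP; exists (nm z); first by rewrite nm_gt0.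
  move=> u uz; rewrite /f; case: eqP => // u0.
  by move: uz; rewrite u0 sub0r nmN ltxx.
have [M M0 fM] := bounded_on_disc `|r| (fun z => cHDcont (cHDder (fd z))).
have f1 : forall z, f z = f 0 + derive1 f 0 * z.
  apply: (@liouville_affine R f (M + `|K|) fd) => z; have n0 := nm_ge0 z.
  have [zr|zr] := leP r (nm z); last first.
    apply: (le_trans (fM z (le_trans (ltW zr) (ler_norm r)))).
    by rewrite mulrDr mulr1 -addrA lerDl addr_ge0// mulr_ge0 ?addr_ge0.
  have [z0|z0] := eqVneq z 0.
    apply: (le_trans (fM z _)); last by rewrite mulrDr mulr1 -addrA lerDl addr_ge0// mulr_ge0 ?addr_ge0.
    by rewrite z0 nm0.
  rewrite fh//; apply: (le_trans (hK z zr)).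
  rewrite [leRHS]mulrDr; apply: (le_trans (y := (M + `|K|) * nm z)); last by rewrite lerDr mulr1 addr_ge0.
  by rewrite ler_wpM2r// ler_wpDl// ler_norm.
by exists (derive1 f 0) => u u0; rewrite -fh// f1 /f eqxx.
Qed.

Lemma liouville_bounded (f : C -> C) (K : R) : (forall z : C, derivable f z 1) ->
  (forall z, nm (f z) <= K) -> forall z, f z = f 0.
Proof.
move=> fd fK; have K0 : 0 <= K := le_trans (nm_ge0 _) (fK 0).
have E := liouville_affine (K := K) fd (fun z => le_trans (fK z) _).
have {}E z : f z = f 0 + derive1 f 0 * z.
  by apply: E => u; rewrite mulrDr mulr1 lerDl mulr_ge0// nm_ge0.
suff d0 : derive1 f 0 = 0 by move=> z; rewrite E d0 mul0r addr0.
apply/eqP/negP => /negP d0.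
have := fK (((2 * K + 1)%:C) / derive1 f 0); rewrite E mulrC divfK//.
have := nmD (f 0 + (2 * K + 1)%:C) (- f 0); rewrite addrAC subrr add0r nmN nmR.
rewrite ger0_norm; last by rewrite addr_ge0// mulr_ge0.
by have := fK 0; lra.
Qed.

(** The order -2 at 0 makes z^2 q entire with value [u 0] at 0, and the order -3 at infinity means
    z^2 q = z v(1/z), of linear growth. The coefficients are [v 0] and [u 0], which do not
    vanish. *)
Lemma hopf_form (q : C -> C) : (forall z, z != 0 -> derivable q z 1) -> type_O (-2) (-3) q ->
  exists a b : C, [/\ a != 0, b != 0 & forall z, z != 0 -> q z = (a * z + b) / z ^+ 2].
Proof.
move=> dq [[u [/nearCP[r1 r10 du] u0 qu]] [v [/nearCP[r2 r20 dv] v0 qv]]].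
have du0 : derivable u 0 1 by apply: du; rewrite subrr nm0.
have dv0 : derivable v 0 1 by apply: dv; rewrite subrr nm0.
have /contC_P vc := cHDcont (cHDder dv0); have [d d0 Hd] := vc 1 ltr01.
move: qv => /near'CP[r3 r30 qv].
pose rho := 2 / Num.min d r3.
have m0 : 0 < Num.min d r3 by rewrite lt_min d0.
have rho0 : 0 < rho by rewrite divr_gt0.
have inv z : rho <= nm z -> [/\ z != 0, nm z^-1 < d & nm z^-1 < r3].
  move=> zr; have n0 : 0 < nm z by apply: lt_le_trans zr.
  have : nm z^-1 < Num.min d r3.
    rewrite nmV -[ltRHS]invrK ltf_pV2 ?posrE ?invr_gt0//; apply: lt_le_trans zr.
    by rewrite /rho ltr_pMl ?invr_gt0// ltr1n.
  by rewrite lt_min => /andP[h1 h2]; rewrite -nm_gt0 in n0 *; split.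
have zq z : rho <= nm z -> z ^+ 2 * q z = z * v z^-1.
  move=> /inv[z0 zd zr]; have zv0 : z^-1 != 0 by rewrite invr_eq0.
  have := qv z^-1 zv0; rewrite subr0 invrK => /(_ zr) E.
  have {}E : q z = z^-1 * v z^-1.
    rewrite -[LHS](divfK (expf_neq0 4 zv0)) E -[(z^-1) ^ (-3)]/(((z^-1) ^+ 3)^-1).
    by move: (v _) => x; field.
  by rewrite E; field.
have [a Ha] : exists a : C, forall z, z != 0 -> z ^+ 2 * q z = u 0 + a * z.
  apply: (@liouville_punctured (fun z => z ^+ 2 * q z) u (nm (v 0) + 1) rho).
  - by move=> z z0; exact: cHDd (cHDM (cHDX 2 (cHDid z)) (cHDder (dq z z0))).
  - exact: du0.
  - move: qu => /near'CP[r4 r40 qu]; apply/near'CP; exists r4 => // t t0 tr.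
    rewrite (qu t t0 tr) -[t ^ (-2)]/((t ^+ 2)^-1); move: (u t) => x.
    by field.
  - move=> z zr; rewrite zq// nmM mulrC ler_wpM2r ?nm_ge0//.
    have [z0 zd _] := inv z zr.
    have := Hd z^-1; rewrite subr0 => /(_ zd) h.
    have := nmD (v z^-1 - v 0) (v 0); rewrite subrK; lra.
exists a, (u 0); split => //.
  have <- : v 0 = a; last by [].
  have := @near'_at0 v (fun t => u 0 * t + a) (cHDcont (cHDder dv0)).
  rewrite mulr0 add0r; apply.
    exact: cHDcont (cHDD (cHDZ (u 0) (cHDid (0 : C))) (cHDc a (0 : C))).
  apply/near'CP; exists rho^-1; first by rewrite invr_gt0.
  move=> t t0; rewrite subr0 => tr; have tv0 : t^-1 != 0 by rewrite invr_eq0.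
  have zr : rho <= nm t^-1 by rewrite nmV -[leLHS]invrK lef_pV2 ?posrE ?invr_gt0 ?nm_gt0// ltW.
  have := zq t^-1 zr; rewrite (Ha _ tv0) invrK => E.
  by apply: (mulfI tv0); rewrite -E; field.
by move=> z z0; rewrite addrC -(Ha z z0) mulrAC divff ?mul1r// expf_neq0.
Qed.

Lemma periodic_deck (T : Type) (l : C -> T) : (forall w, l (w + tpi R) = l w) ->
  forall n w, l (deck n w) = l w.
Proof.
move=> lp.
have ln (n : nat) w : l (w + n%:R * tpi R) = l w.
  elim: n w => [|n IH] w; first by rewrite mul0r addr0.
  by rewrite -natr1 mulrDl mul1r addrA lp IH.
move=> [n|n] w; rewrite deckE; first exact: ln.
have -> : (Negz n)%:~R = - n.+1%:R :> C by rewrite NegzE rmorphN.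
by rewrite mulNr -(ln n.+1 (w - _)) subrK.
Qed.

Lemma periodic_descend (l : C -> C) : (forall w, l (w + tpi R) = l w) ->
  exists L : C -> C, forall w, l w = L (cexp w).
Proof.
move=> lp.
pose s z : C := if pselect (z != 0) is left z0 then sval (cid (cexp_surj z0)) else 0.
exists (fun z => l (s z)) => w; rewrite /s.
case: pselect => [z0|]; last by rewrite cexp_neq0.
by case: cid => u /= /cexp_eq[n ->]; rewrite periodic_deck.
Qed.

(** F(w)^(-1) F(w + 2 pi i) is entire in w and unitary, because [F F^*] is periodic. Its entries are
    bounded by 1, hence constant by Liouville's theorem. *)
Lemma lift_monodromy (f F : C -> M2) : entireM F -> (forall w, \det (F w) = 1) ->
  (forall w, f (cexp w) = F w *m adjoint (F w)) ->
  exists M : M2, [/\ \det M = 1, M *m adjoint M = 1 & forall w, F (w + tpi R) = F w *m M].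
Proof.
move=> eF F1 fF.
pose U w := \adj (F w) *m F (w + tpi R).
have UU w : U w *m adjoint (U w) = 1.
  rewrite /U adjointM mulmxA -(mulmxA (\adj (F w))) -fF cexpD cexp_tpi mulr1 fF.
  rewrite (mulmxA (\adj (F w))) mul_adj_mx F1 mul1mx -adjointM mul_adj_mx F1.
  by rewrite one_mx2 adjoint_mx2 rmorph1 rmorph0 -one_mx2.
have dsh i j (w : C) : derivable (fun u => F (u + tpi R) i j) w 1.
  apply: cHDd (cHDcomp (f := fun u => F u i j) (g := fun u : C => u + tpi R) (cHDder (eF _ i j)) (cHDD (cHDid w) (cHDc (tpi R) w))).
have dU i j (w : C) : derivable (fun u => U u i j) w 1.
  have E u : U u = mx2 (F u 1 1 * F (u + tpi R) 0 0 - F u 0 1 * F (u + tpi R) 1 0)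
     (F u 1 1 * F (u + tpi R) 0 1 - F u 0 1 * F (u + tpi R) 1 1)
     (F u 0 0 * F (u + tpi R) 1 0 - F u 1 0 * F (u + tpi R) 0 0)
     (F u 0 0 * F (u + tpi R) 1 1 - F u 1 0 * F (u + tpi R) 0 1).
    rewrite /U [in \adj _](mx2_eta (F u)) (mx2_eta (F (u + tpi R))) !mx2E.
    by rewrite !mx2_ij; congr mx2; ring.
  have H (a b c d : 'I_2) k l k' l' : derivable (fun u => F u a b * F (u + tpi R) k l - F u c d * F (u + tpi R) k' l') w 1.
    exact: cHDd (cHDB (cHDM (cHDder (eF w a b)) (cHDder (dsh k l w))) (cHDM (cHDder (eF w c d)) (cHDder (dsh k' l' w)))).
  have nd (g h : C -> C) : (forall u, g u = h u) -> derivable h w 1 -> derivable g w 1.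
    by move=> gh; have -> : g = h by apply/funext.
  have e00 u := etrans (congr1 (fun M : M2 => M 0 0) (E u)) (mx2_00 _ _ _ _).
  have e01 u := etrans (congr1 (fun M : M2 => M 0 1) (E u)) (mx2_01 _ _ _ _).
  have e10 u := etrans (congr1 (fun M : M2 => M 1 0) (E u)) (mx2_10 _ _ _ _).
  have e11 u := etrans (congr1 (fun M : M2 => M 1 1) (E u)) (mx2_11 _ _ _ _).
  case: (ord2 i) => ->; case: (ord2 j) => ->.
  - exact: nd e00 (H 1 1 0 1 0 0 1 0).
  - exact: nd e01 (H 1 1 0 1 0 1 1 1).
  - exact: nd e10 (H 0 0 1 0 1 0 0 0).
  - exact: nd e11 (H 0 0 1 0 1 1 0 1).
have bU i j w : nm (U w i j) <= 1.
  move: (UU w); move: (U w) => V /(congr1 (fun M : M2 => M i i)).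
  rewrite mul2E !adjointE [RHS]mxE eqxx -!nm2C -rmorphD => /complexI E.
  have : nm (V i j) ^+ 2 <= 1.
    by rewrite -E; case: (ord2 j) => ->; rewrite ?lerDl ?lerDr sqr_ge0.
  by have := nm_ge0 (V i j); nra.
have Uc w : U w = U 0.
  by apply/matrixP => i j; exact: (liouville_bounded (dU i j) (bU i j)).
have FU w : F (w + tpi R) = F w *m U 0.
  by rewrite -(Uc w) /U mulmxA mul_mx_adj F1 mul1mx.
exists (U 0); split => //.
by have := F1 (0 + tpi R); rewrite FU det_mulmx F1 mul1r.
Qed.

End Liouville.

(** * Change of lift by isometries and dilations, and the connection dF F^(-1) *)

Section Gauge.
Variable R : realType.
Local Notation C := R[i].
Local Notation M2 := 'M[C]_2.
Local Notation Re := (@complex.Re R).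
Local Notation Im := (@complex.Im R).

Lemma HD_unique (f : C -> C) (x a b : C) : is_derive x 1 f a -> is_derive x 1 f b -> a = b.
Proof. by move=> /cHD1 <- /cHD1 <-. Qed.

Lemma hyp_gaussP (F : C -> M2) w : \det (dmx F w) = 0 ->
  (exists2 g, hyp_gauss F w = Some g & forall j, dmx F w 0 j = g * dmx F w 1 j) \/
  (hyp_gauss F w = None /\ forall j, dmx F w 1 j = 0).
Proof.
rewrite /hyp_gauss; move: (dmx F w) => D; rewrite det2 => /eqP; rewrite subr_eq0 => /eqP d0.
case: ifPn => [D0|/norP[/negbNE/eqP a0 /negbNE/eqP b0]].
  rewrite /Defs.ratio; case: eqP => [d10|/eqP d10].
    right; split => // j; move: D0; rewrite d10 eqxx orbF => d00.
    case: (ord2 j) => -> //; move: d0; rewrite d10 mulr0 => /eqP.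
    by rewrite mulf_eq0 (negbTE d00) => /eqP.
  left; exists (D 0 0 / D 1 0) => // j; case: (ord2 j) => ->; first by rewrite divfK.
  by rewrite mulrAC d0 mulfK.
rewrite /Defs.ratio; case: eqP => [d11|/eqP d11].
  by right; split => // j; case: (ord2 j) => ->.
left; exists (D 0 1 / D 1 1) => // j; case: (ord2 j) => ->; last by rewrite divfK.
by rewrite a0 b0 mulr0.
Qed.

Lemma gauss_rows (F : C -> M2) w (A : M2) (h : C) : \det (dmx F w) = 0 ->
  mobius A (hyp_gauss F w) = Some h ->
  forall j, (A *m dmx F w) 0 j = h * (A *m dmx F w) 1 j.
Proof.
move=> /hyp_gaussP[[g -> Dg]|[-> D1]]; rewrite /mobius /Defs.ratio; case: eqP => // /eqP k0 [<-] j.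
  by rewrite !mul2E Dg; move: (dmx F w) => D; field; exact: k0.
by rewrite !mul2E D1; move: (dmx F w) => D; field; exact: k0.
Qed.

Lemma dmx_shift (F : C -> M2) (c w : C) : entireM F ->
  dmx (fun u => F (u + c)) w = dmx F (w + c).
Proof.
move=> eF; apply: (@dmxE R _ (fun w => dmx F (w + c))) => i j.
have H := cHDcomp (f := fun u => F u i j) (g := fun u : C => u + c) (entireM_HD (w + c) i j eF) (cHDD (cHDid w) (cHDc c w)).
by apply: (cHD_eq H); rewrite addr0 mulr1.
Qed.

Lemma dmx_mull (A : M2) (F : C -> M2) (w : C) : entireM F ->
  dmx (fun u => A *m F u) w = A *m dmx F w.
Proof.
move=> eF; rewrite (dmx_mul (A := fun=> A) (A' := fun=> 0) _ eF) ?mul0mx ?add0r// => i j.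
by apply: (cHD_eq (cHDc (A i j) w)); rewrite mxE.
Qed.

Lemma dmx_mulr (A : M2) (F : C -> M2) (w : C) : entireM F ->
  dmx (fun u => F u *m A) w = dmx F w *m A.
Proof.
move=> eF; apply: (@dmxE R _ (fun w => dmx F w *m A)) => i j.
have H := cHDD (cHDM (entireM_HD w i 0 eF) (cHDc (A 0 j) w)) (cHDM (entireM_HD w i 1 eF) (cHDc (A 1 j) w)).
apply: (cHD_near _ (cHD_eq H _)); first by apply/nearCP; exists 1 => // u _; rewrite mul2E.
by rewrite mul2E !mulr0 !addr0.
Qed.

Lemma entireM_shift (F : C -> M2) (c : C) : entireM F -> entireM (fun u => F (u + c)).
Proof.
move=> eF w i j.
exact: cHDd (cHDcomp (f := fun u => F u i j) (g := fun u : C => u + c) (entireM_HD (w + c) i j eF) (cHDD (cHDid w) (cHDc c w))).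
Qed.

Lemma entireM_mull (A : M2) (F : C -> M2) : entireM F -> entireM (fun u => A *m F u).
Proof.
move=> eF w i j.
have H := cHDD (cHDZ (A i 0) (entireM_HD w 0 j eF)) (cHDZ (A i 1) (entireM_HD w 1 j eF)).
by apply: cHDd (cHD_near _ H); apply/nearCP; exists 1 => // u _; rewrite mul2E.
Qed.

Lemma invmx_mull (A X Y : M2) : \det A = 1 -> \det X = 1 ->
  invmx (A *m X) *m (A *m Y) = invmx X *m Y.
Proof.
move=> A1 X1; rewrite !invmx_det1 ?det_mulmx ?A1 ?X1 ?mulr1// adjM.
have E : \adj A *m A = 1%:M by rewrite mul_adj_mx A1.
by move: (\adj A) (\adj X) E => A' X' E; rewrite mulmxA -(mulmxA X') E mulmx1.
Qed.

Section GaugeLift.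
Variables (f F : C -> M2) (A : M2) (c : C) (Q : C -> C).
Hypothesis bF : bryant_lift f F.
Hypothesis A1 : \det A = 1.
Let F' w := A *m F (w + c).

Let eF : entireM F. Proof. by case: bF. Qed.

Lemma gauge_dmx w : dmx F' w = A *m dmx F (w + c).
Proof. by rewrite /F' (dmx_mull A w (entireM_shift (c := c) eF)) dmx_shift. Qed.

Lemma gauge_entire : entireM F'.
Proof. exact: entireM_mull (entireM_shift (c := c) eF). Qed.

Lemma gauge_mc w : mc_form F' w = mc_form F (w + c).
Proof.
have [_ F1 _ _] := bF.
by rewrite /mc_form gauge_dmx; exact: invmx_mull.
Qed.

(** The matrix [A] acts as an isometry of hyperbolic space; the translation by [c] on the cover is
    the dilation of z by [cexp c]. *)
Lemma gauge_lift : bryant_lift (fun z => A *m f (cexp c * z) *m adjoint A) F'.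
Proof.
have [_ F1 dF fF] := bF; split.
- exact: gauge_entire.
- by move=> w; rewrite det_mulmx A1 F1 mulr1.
- move=> w; have [D0 N0] := dF (w + c); rewrite gauge_mc gauge_dmx; split; last exact: N0.
  move: D0; move: (dmx F (w + c)) => D; apply: contra_neq => /(congr1 (mulmx (\adj A))).
  by rewrite mulmxA mul_adj_mx A1 mul1mx mulmx0.
- by move=> w; rewrite mulrC -cexpD fF adjointM !mulmxA.
Qed.

Lemma gauge_hopf : hopf_rel F Q -> hopf_rel F' (fun w => Q (w + c)).
Proof.
move=> hQ w; have E : dmx F' = fun w => A *m dmx F (w + c) by apply/funext => u; exact: gauge_dmx.
rewrite E (dmx_mull A w (entireM_shift (c := c) (entireM_dmx eF))) (dmx_shift c w (entireM_dmx eF)).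
rewrite adjM !mulmxA -(mulmxA _ (\adj A) A) mul_adj_mx A1 mulmx1 -!mulmxA.
by rewrite scalemxAr -hQ !mulmxA.
Qed.

Lemma gauge_sec w : sec_gauss F' w = sec_gauss F (w + c).
Proof. by rewrite (sec_gaussE w gauge_lift) (sec_gaussE _ bF) gauge_mc. Qed.

End GaugeLift.

Definition omega (F : C -> M2) w : M2 := dmx F w *m \adj (F w).

Section Omega.
Variables (f F : C -> M2) (Q : C -> C).
Hypothesis bF : bryant_lift f F.
Hypothesis hQ : hopf_rel F Q.
Let eF : entireM F. Proof. by case: bF. Qed.
Let F1 w : \det (F w) = 1. Proof. by case: bF. Qed.
Let Om := omega F.
Definition domega w : M2 := dmx (dmx F) w *m \adj (F w).

Lemma omega_dmx w : dmx F w = Om w *m F w.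
Proof. by rewrite /Om /omega -mulmxA mul_adj_mx F1 mulmx1. Qed.

Lemma omega_neq0 w : Om w != 0.
Proof.
have [_ _ dF _] := bF; have [D0 _] := dF w; apply: contraNneq D0 => O0.
by rewrite omega_dmx O0 mul0mx.
Qed.

Lemma omega_det w : \det (Om w) = 0.
Proof. by rewrite det_mulmx (lift_det bF) mul0r. Qed.

Lemma omega_tr w : Om w 1 1 = - Om w 0 0.
Proof.
have : \tr (Om w) = 0.
  by rewrite /Om /omega mxtrace_mulC -(lift_mc bF) (det1_tr w eF F1).
by rewrite tr2 => /eqP; rewrite addrC addr_eq0 => /eqP.
Qed.

(** As for [HD_mc], the term dF adj(dF) of the product rule is det(dF) times the identity, which is
    0. *)
Lemma HD_omega (w : C) i j : is_derive w 1 (fun u => Om u i j) (domega w i j).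
Proof.
have d0 := lift_det bF w; rewrite det2 in d0.
have dF k l := entireM_HD w k l eF; have dD k l := entireM_HD w k l (entireM_dmx eF).
have H i k l k' l' := cHDB (cHDM (dD i 0) (dF k l)) (cHDM (dD i 1) (dF k' l')).
have E u : Om u = mx2 (dmx F u 0 0 * F u 1 1 - dmx F u 0 1 * F u 1 0)
    (- (dmx F u 0 0 * F u 0 1 - dmx F u 0 1 * F u 0 0))
    (dmx F u 1 0 * F u 1 1 - dmx F u 1 1 * F u 1 0)
    (- (dmx F u 1 0 * F u 0 1 - dmx F u 1 1 * F u 0 0)).
  rewrite /Om /omega; move: (dmx F u) => D; rewrite (mx2_eta D) (mx2_eta (F u)) !mx2E !mx2_ij.
  by congr mx2; ring.
have E' : domega w = mx2 (dmx (dmx F) w 0 0 * F w 1 1 - dmx (dmx F) w 0 1 * F w 1 0)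
    (- (dmx (dmx F) w 0 0 * F w 0 1 - dmx (dmx F) w 0 1 * F w 0 0))
    (dmx (dmx F) w 1 0 * F w 1 1 - dmx (dmx F) w 1 1 * F w 1 0)
    (- (dmx (dmx F) w 1 0 * F w 0 1 - dmx (dmx F) w 1 1 * F w 0 0)).
  rewrite /domega; move: (dmx (dmx F) w) => D; rewrite (mx2_eta D) (mx2_eta (F w)) !mx2E !mx2_ij.
  by congr mx2; ring.
have nd (g h : C -> C) (a b : C) : (forall u, g u = h u) -> is_derive w 1 h a -> a = b -> is_derive w 1 g b.
  by move=> gh; have -> : g = h by [apply/funext]; move=> dh <-.
have e00 u := etrans (congr1 (fun M : M2 => M 0 0) (E u)) (mx2_00 _ _ _ _).
have e01 u := etrans (congr1 (fun M : M2 => M 0 1) (E u)) (mx2_01 _ _ _ _).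
have e10 u := etrans (congr1 (fun M : M2 => M 1 0) (E u)) (mx2_10 _ _ _ _).
have e11 u := etrans (congr1 (fun M : M2 => M 1 1) (E u)) (mx2_11 _ _ _ _).
rewrite E'; clear E E'; move: (dmx (dmx F) w) dD H => DD dD H.
case: (ord2 i) => ->; case: (ord2 j) => ->; rewrite mx2_ij.
- apply: nd e00 (H 0 1 1 1 0) _; move: d0; move: (dmx F w) => D d0.
  by apply/eqP; rewrite -subr_eq0; apply/eqP; rewrite -[RHS]d0; ring.
- apply: nd e01 (cHDN (H 0 0 1 0 0)) _; move: d0; move: (dmx F w) => D d0; ring.
- apply: nd e10 (H 1 1 1 1 0) _; move: d0; move: (dmx F w) => D d0; ring.
- apply: nd e11 (cHDN (H 1 0 1 0 0)) _; move: d0; move: (dmx F w) => D d0.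
  by apply/eqP; rewrite -subr_eq0; apply/eqP; rewrite -[RHS]d0; ring.
Qed.

Lemma omega_hopf w : Om w *m domega w = Q w *: Om w.
Proof. by rewrite /Om /omega /domega scalemxAl -hQ !mulmxA. Qed.

(* If h is the value of the Gauss map after the Moebius transformation E, then
   (E_00 - h E_10, E_01 - h E_11) spans the left kernel of dF F^-1. *)
Lemma omega_formula (E : M2) (h : C -> C) (h' w : C) : \det E != 0 -> is_derive w 1 h h' ->
  (\forall u \near w, forall j, (E *m dmx F u) 0 j = h u * (E *m dmx F u) 1 j) ->
  Om w 1 0 * (h' * \det E) = Q w * (E 0 0 - h w * E 1 0) ^+ 2.
Proof.
move=> E0 dh rows.
pose p u := E 0 0 - h u * E 1 0; pose r u := E 0 1 - h u * E 1 1.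
have pr : \forall u \near w, forall j, p u * Om u 0 j + r u * Om u 1 j = 0.
  apply: filterS rows => u Hu j.
  have EO k : (E *m Om u) k j = (E *m dmx F u) k 0 * \adj (F u) 0 j + (E *m dmx F u) k 1 * \adj (F u) 1 j.
    by rewrite /Om /omega mulmxA mul2E.
  have : (E *m Om u) 0 j = h u * (E *m Om u) 1 j by rewrite !EO !Hu; ring.
  rewrite /p /r; move: (Om u) => O; rewrite !mul2E => H.
  have -> : (E 0 0 - h u * E 1 0) * O 0 j + (E 0 1 - h u * E 1 1) * O 1 j =
     E 0 0 * O 0 j + E 0 1 * O 1 j - h u * (E 1 0 * O 0 j + E 1 1 * O 1 j) by ring.
  by rewrite H subrr.
have prw := nbhs_singleton pr.
have dp : is_derive w 1 p (- (h' * E 1 0)).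
  by apply: (cHD_eq (cHDB (cHDc (E 0 0) w) (cHDM dh (cHDc (E 1 0) w)))); rewrite mulr0 addr0 sub0r.
have dr : is_derive w 1 r (- (h' * E 1 1)).
  by apply: (cHD_eq (cHDB (cHDc (E 0 1) w) (cHDM dh (cHDc (E 1 1) w)))); rewrite mulr0 addr0 sub0r.
(* The first of the two kernel relations, differentiated at [w]. Combined with the Hopf relation, it
   determines the lower left entry of the connection. *)
have dd := HD_unique (cHDD (cHDM dp (HD_omega w 0 0)) (cHDM dr (HD_omega w 1 0)))
  (cHD_near (filterS (fun u Hu => esym (Hu 0)) pr) (cHDc 0 w)).
have t := omega_tr w; have O0 := omega_neq0 w.
have oh : Om w 1 0 * domega w 0 0 + - Om w 0 0 * domega w 1 0 = Q w * Om w 1 0.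
  rewrite -/Om in t; rewrite -t; have := congr1 (fun M : M2 => M 1 0) (omega_hopf w).
  by rewrite -/Om; move: (Om w) (domega w) => A B; rewrite mul2E scale2E.
have := prw 0; have := prw 1; rewrite t; rewrite -/(p w) det2.
have rE : r w * E 1 0 - p w * E 1 1 = - \det E by rewrite det2 /p /r; ring.
rewrite det2 in rE; move: O0 t dd oh rE E0.
rewrite det2; move: (Om w) (domega w) (Q w) => O O' q; move: (p w) (r w) => P S.
move=> O0 t dd oh rE E0 prw1 prw0.
have [P0|P0] := eqVneq P 0.
  have S0 : S != 0.
    by apply: contraNneq E0 => S0; rewrite -oppr_eq0 -rE S0 P0 !mul0r subrr.
  have O10 : O 1 0 = 0.
    by move: prw0; rewrite P0 mul0r add0r => /eqP; rewrite mulf_eq0 (negbTE S0) => /eqP.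
  by rewrite O10 P0 expr0n mulr0 mul0r.
have [l0|l0] := eqVneq (O 1 0) 0.
  have m0 : O 0 0 = 0.
    by move: prw0; rewrite l0 mulr0 addr0 => /eqP; rewrite mulf_eq0 (negbTE P0) => /eqP.
  have n0 : O 0 1 = 0.
    by move: prw1; rewrite m0 oppr0 mulr0 addr0 => /eqP; rewrite mulf_eq0 (negbTE P0) => /eqP.
  by case/negP: O0; apply/eqP; apply: mx2_eq; rewrite ?t ?m0 ?n0 ?l0 ?oppr0 mxE.
apply: (mulfI l0).
have e1 : P * O 0 0 = - (S * O 1 0) by apply/eqP; rewrite -addr_eq0 prw0.
have e2 : P * O' 0 0 = - (- (h' * E 1 0) * O 0 0 - (h' * E 1 1) * O 1 0 + S * O' 1 0).
  apply/eqP; rewrite -subr_eq0 opprK; apply/eqP; rewrite -[RHS]dd; ring.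
have e3 : P ^+ 2 * (O 1 0 * O' 0 0 - O 0 0 * O' 1 0) = P ^+ 2 * (q * O 1 0).
  by rewrite -oh; ring.
have e4 : P ^+ 2 * (O 1 0 * O' 0 0 - O 0 0 * O' 1 0) =
   P * (O 1 0 * (P * O' 0 0) - (P * O 0 0) * O' 1 0) by ring.
rewrite e4 e2 e1 in e3.
have e5 : P * (O 1 0 * - (- (h' * E 1 0) * O 0 0 - h' * E 1 1 * O 1 0 + S * O' 1 0) - - (S * O 1 0) * O' 1 0)
  = O 1 0 * h' * (E 1 0 * (P * O 0 0) + P * E 1 1 * O 1 0) by ring.
rewrite e5 e1 in e3.
have e6 : O 1 0 * h' * (E 1 0 * - (S * O 1 0) + P * E 1 1 * O 1 0) =
  O 1 0 * (O 1 0 * (h' * - (S * E 1 0 - P * E 1 1))) by ring.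
rewrite e6 rE opprK in e3.
by rewrite e3; ring.
Qed.

End Omega.
End Gauge.

(** * The lower left entry of the connection, from the branching of G *)

Section NormalForm.
Variable R : realType.
Local Notation C := R[i].
Local Notation M2 := 'M[C]_2.
Local Notation Re := (@complex.Re R).
Local Notation Im := (@complex.Im R).

Lemma near_nm_lt (h : C -> C) (w : C) (r : R) : {for w, continuous h} -> nm (h w) < r ->
  \forall u \near w, nm (h u) < r.
Proof.
move=> /contC_P hc hr; have e0 : 0 < r - nm (h w) by rewrite subr_gt0.
have [d d0 Hd] := hc _ e0; apply/nearCP; exists d => // u /Hd h1.
by have := nmD (h u - h w) (h w); rewrite subrK; lra.
Qed.

Lemma near_neq0C (h : C -> C) (w : C) : {for w, continuous h} -> h w != 0 ->
  \forall u \near w, h u != 0.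
Proof.
move=> /contC_P hc h0; have n0 : 0 < nm (h w) by rewrite nm_gt0.
have [d d0 Hd] := hc _ n0; apply/nearCP; exists d => // z /Hd.
by apply: contraTneq => ->; rewrite sub0r nmN ltxx.
Qed.

Variables (f F : C -> M2) (G : C -> option C) (a b : C).
Hypothesis bF : bryant_lift f F.
Hypothesis hQ : hopf_rel F (fun w => a * cexp w + b).
Hypothesis a0 : a != 0.
Hypothesis b0 : b != 0.
Hypothesis hG : forall w, hyp_gauss F w = G (cexp w).
Hypothesis br : branching_orders G 1 0.

Let eF : entireM F. Proof. by case: bF. Qed.
Let F1 w : \det (F w) = 1. Proof. by case: bF. Qed.

Section Gauged.
Variable A : M2.
Hypothesis A1 : \det A = 1.
Let FA w := A *m F (w + 0).

Lemma gauged_lift : bryant_lift (fun z => A *m f (cexp 0 * z) *m adjoint A) FA.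
Proof. exact: gauge_lift. Qed.

Lemma gauged_hopf : hopf_rel FA (fun w => a * cexp w + b).
Proof.
have -> : (fun w : C => a * cexp w + b) = (fun w => a * cexp (w + 0) + b).
  by apply/funext => w; rewrite addr0.
exact: (gauge_hopf 0 bF A1 hQ).
Qed.

Lemma gauged_dmx w : dmx FA w = A *m dmx F w.
Proof. by rewrite (gauge_dmx A 0 bF) addr0. Qed.

Lemma gauged_omega w : omega FA w = A *m omega F w *m \adj A.
Proof. by rewrite /omega gauged_dmx /FA addr0 adjM !mulmxA. Qed.

Lemma gauged_formula (B : M2) (h : C -> C) (h' w : C) : \det B != 0 -> is_derive w 1 h h' ->
  (\forall u \near w, mobius B (G (cexp u)) = Some (h u)) ->
  omega FA w 1 0 * (h' * \det B) =
    (a * cexp w + b) * ((B *m \adj A) 0 0 - h w * (B *m \adj A) 1 0) ^+ 2.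
Proof.
move=> B0 dh Bh; pose E := B *m \adj A; rewrite -!/(E); have dE : \det E = \det B.
  by rewrite det_mulmx -[\det (\adj A)]mul1r -{1}A1 -det_mulmx mul_mx_adj A1 det1 mulr1.
rewrite -dE; apply: (omega_formula gauged_lift gauged_hopf); first by rewrite dE.
apply: filterS Bh => u Hu; rewrite gauged_dmx mulmxA /E -(mulmxA B) mul_adj_mx A1 mulmx1.
by apply: gauss_rows; [exact: lift_det bF u | rewrite hG].
Qed.

Lemma gauged_periodic w : omega FA (w + tpi R) = omega FA w.
Proof.
have [_ _ _ fF] := bF.
have [M [M1 _ FM]] := lift_monodromy eF F1 fF.
have D : dmx F (w + tpi R) = dmx F w *m M.
  rewrite -(dmx_shift (tpi R) w eF) -(dmx_mulr M w eF); congr (dmx _ w).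
  by apply/funext.
have E : omega F (w + tpi R) = omega F w.
  rewrite /omega D FM adjM; move: (dmx F w) => X.
  by rewrite mulmxA -(mulmxA X) mul_mx_adj M1 mulmx1.
exact: etrans (gauged_omega _) (etrans (congr1 (fun X => A *m X *m \adj A) E) (esym (gauged_omega w))).
Qed.

End Gauged.

(** At 0 the branching of order 1 makes the entry L vanish to order exactly 2. At infinity G is
    unbranched, so its derivative in w is comparable to 1/z and [gauged_formula] gives L = O(z^2).
    Liouville's theorem is applied to L / z, which has linear growth and the value 0 at 0. *)
Lemma kappa_exists : exists (A : M2) (k : C), [/\ \det A = 1, k != 0 &
  forall w, (A *m omega F w *m \adj A) 1 0 = k * cexp w ^+ 2].
Proof.
case: br => -[B1 [h1 [B10 [u [/nearCP[r1 r10 du] u0 /near'CP[r2 r20 hu]]] /near'CP[r3 r30 G1]]]].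
move=> -[B2 [h2 [B20 [v [/nearCP[r4 r40 dv] v0 /near'CP[r5 r50 hv]]] /near'CP[r6 r60 G2]]]].
pose s := sqrtc (- \det B1).
have s2 : s ^+ 2 = - \det B1 by rewrite sqr_sqrtc.
have s0 : s != 0 by rewrite -sqrf_eq0 s2 oppr_eq0.
pose J : M2 := mx2 0 1 1 0.
have JJ : J *m J = 1%:M by rewrite /J mul_mx2 !mulr0 !mul0r !mulr1 !addr0 !add0r one_mx2.
have dJ : \det J = -1 by rewrite det2 /J !mx2_ij mul0r mul1r sub0r.
(* [B1] sends the value of G at the end 0 to 0, and [J] exchanges 0 and infinity: the transformed
   Gauss map has a double pole at z = 0. Since [J] has determinant -1, normalizing requires s^2 = -
   det B1. *)
pose A : M2 := s^-1 *: (J *m B1).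
have A1 : \det A = 1.
  by rewrite detZ det_mulmx dJ mulN1r -s2 exprVn mulVf// expf_neq0.
have EA : B1 *m \adj A = s *: J.
  have : (s *: J) *m A = B1.
    by rewrite /A -scalemxAl -scalemxAr scalerA divff// scale1r mulmxA JJ mul1mx.
  by move=> <-; rewrite -mulmxA mul_mx_adj A1 mulmx1.
exists A.
have du0 : derivable u 0 1 by apply: du; rewrite subrr nm0.
have dv0 : derivable v 0 1 by apply: dv; rewrite subrr nm0.
have [L LE] := periodic_descend (fun w => congr1 (fun M : M2 => M 1 0) (gauged_periodic A w)).
have bA := gauged_lift A1; have hA := gauged_hopf A1.
set FA := fun w => A *m F (w + 0) in LE bA hA.
have dL z : z != 0 -> derivable L z 1.
  move=> z0; have [w <-] := cexp_surj z0.
  exact: cHDd (HD_descend LE (HD_omega bA w 1 0)).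
pose rho := Num.min r1 (Num.min r2 r3).
have rho0 : 0 < rho by rewrite !lt_min r10 r20.
have near0 z : z != 0 -> nm z < rho ->
    L z * (2 * u z + z * derive1 u z) = - (a * z + b) * (z ^+ 2 * u z ^+ 2).
  move=> z0; have [w wz] := cexp_surj z0; rewrite -wz => zr.
  have dw : derivable u (cexp w) 1.
    by apply: du; rewrite subr0; move: zr; rewrite lt_min => /andP[].
  have dh := cHDM (cHDX 2 (HD_cexp w)) (cHDcomp (cHDder dw) (HD_cexp w)).
  have rows : \forall t \near w, mobius B1 (G (cexp t)) = Some (cexp t ^+ 2 * u (cexp t)).
    apply: filterS (near_nm_lt (cHDcont (HD_cexp w)) zr) => t.
    rewrite /rho !lt_min => /and3P[_ t2 t3]; have t0 := cexp_neq0 t.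
    rewrite G1 ?subr0//; congr Some; by rewrite hu ?subr0.
  have := gauged_formula A1 B10 dh rows.
  have LEw : omega FA w 1 0 = L (cexp w) by exact: LE.
  rewrite [X in X * _ = _]LEw EA !scale2E /J mx2_00 mx2_10 mulr0 mulr1; have e0 := cexp_neq0 w.
  have -> : \det B1 = - s ^+ 2 by rewrite s2 opprK.
  rewrite -[2.-1]/1%N expr1; move: (L (cexp w)) (u (cexp w)) (derive1 u (cexp w)) => l x y.
  move: (cexp w) e0 => e e0 E.
  apply: (mulfI (mulf_neq0 (expf_neq0 2 e0) (expf_neq0 2 s0))).
  apply: (etrans _ (etrans (congr1 -%R E) _)); ring.
have du1 : derivable (derive1 u) 0 1.
  apply: (@holo_derive1 R u 0 (r1 / 2)); first by rewrite divr_gt0.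
  by move=> z zr; apply: du; apply: (le_lt_trans zr); rewrite ltr_pdivrMr// ltr_pMr// ltr1n.
have dv1 : derivable (derive1 v) 0 1.
  apply: (@holo_derive1 R v 0 (r4 / 2)); first by rewrite divr_gt0.
  by move=> z zr; apply: dv; apply: (le_lt_trans zr); rewrite ltr_pdivrMr// ltr_pMr// ltr1n.
pose den z := 2 * u z + z * derive1 u z.
have dden : is_derive (0 : C) 1 den _ := cHDD (cHDZ 2 (cHDder du0)) (cHDM (cHDid (0 : C)) (cHDder du1)).
have den0 : den 0 != 0 by rewrite /den mul0r addr0 mulf_neq0// pnatr_eq0.
(* The extension of L / z^2 across 0. Its value there, - b u(0) / 2, will be the nonzero constant
   [k]. *)
pose g z := - (a * z + b) * u z ^+ 2 / den z.
have dg : derivable g 0 1.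
  exact: cHDd (cHDM (cHDM (cHDN (cHDD (cHDZ a (cHDid (0 : C))) (cHDc b (0 : C)))) (cHDX 2 (cHDder du0))) (cHDV den0 dden)).
have ndn := near_neq0C (cHDcont dden) den0.
have Lg : \forall z \near (0 : C)^', L z / z ^+ 2 = g z.
  move: ndn => /nearCP[d d0 Hd]; apply/near'CP; exists (Num.min d rho); first by rewrite lt_min d0 rho0.
  move=> z z0; rewrite lt_min subr0 => /andP[zd zr].
  have dz : den z != 0 by apply: Hd; rewrite subr0.
  rewrite /g; apply: (canRL (mulfK dz)); rewrite mulrAC; apply: (canLR (mulfK (expf_neq0 2 z0))).
  by rewrite /den near0//; ring.
have [K [r KL]] : exists K r : R, forall z, r <= nm z -> nm (L z / z) <= K * nm z.
  pose den2 t := v t + t * derive1 v t.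
  have dden2 := cHDD (cHDder dv0) (cHDM (cHDid (0 : C)) (cHDder dv1)).
  have /contC_P c1 := cHDcont dden2.
  have /contC_P c2 := cHDcont (cHDM (cHDid (0 : C)) (cHDder dv0)).
  have nv0 : 0 < nm (v 0) by rewrite nm_gt0.
  have [|d1 d10 H1] := c1 (nm (v 0) / 2); first by rewrite divr_gt0.
  have [d2 d20 H2] := c2 1 ltr01.
  pose rho2 := Num.min 1 (Num.min d1 (Num.min d2 (Num.min r4 (Num.min r5 r6)))).
  have rho20 : 0 < rho2 by rewrite !lt_min ltr01 d10 d20 r40 r50 r60.
  pose E := B2 *m \adj A; pose c := nm (E 0 0) + nm (E 1 0).
  have c0 : 0 <= c by rewrite addr_ge0 ?nm_ge0.
  have nB : 0 < nm (\det B2) by rewrite nm_gt0.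
  exists ((nm a + nm b) * c ^+ 2 / (nm (v 0) / 2 * nm (\det B2))), (2 / rho2) => z zr.
  have n0 : 0 < nm z by apply: lt_le_trans zr; rewrite divr_gt0.
  have z0 : z != 0 by rewrite -nm_gt0.
  have [w wz] := cexp_surj z0.
  have tz : cexp (- w) = z^-1 by rewrite cexpN wz.
  have tr : nm (cexp (- w)) < rho2.
    rewrite tz nmV -[ltRHS]invrK ltf_pV2 ?posrE ?invr_gt0//; apply: lt_le_trans zr.
    by rewrite ltr_pMl ?invr_gt0// ltr1n.
  have dN : is_derive w 1 (fun x => cexp (- x)) (cexp (- w) * -1).
    exact: (cHDcomp (f := @cexp R) (g := fun x : C => - x) (HD_cexp (- w)) (cHDN (cHDid w))).
  have [/and5P[tr1 td1 td2 tr4 tr5] tr6] : [&& nm (cexp (- w)) < 1, nm (cexp (- w)) < d1,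
      nm (cexp (- w)) < d2, nm (cexp (- w)) < r4 & nm (cexp (- w)) < r5] /\ nm (cexp (- w)) < r6.
    by move: tr; rewrite /rho2 !lt_min => /and5P[-> -> -> -> /andP[-> ->]].
  have dw : derivable v (cexp (- w)) 1 by apply: dv; rewrite subr0.
  have dh := cHDM dN (cHDcomp (f := v) (g := fun x : C => cexp (- x)) (cHDder dw) dN).
  have rows : \forall t \near w, mobius B2 (G (cexp t)) = Some (cexp (- t) * v (cexp (- t))).
    apply: filterS (near_nm_lt (cHDcont dN) tr) => t.
    rewrite /rho2 !lt_min => /and5P[_ _ _ _ /andP[t5 t6]].
    have t0 := cexp_neq0 (- t); have := G2 _ t0; rewrite subr0 => /(_ t6).
    by rewrite -cexpN opprK => ->; rewrite hv ?subr0.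
  have LEw : omega FA w 1 0 = L z by rewrite -wz; exact: LE.
  have := gauged_formula A1 B20 dh rows.
  rewrite [X in X * _ = _]LEw -/E wz.
  have hv1 := H1 (cexp (- w)); rewrite subr0 mul0r addr0 in hv1; have {}hv1 := hv1 td1.
  have hv2 := H2 (cexp (- w)); rewrite subr0 mul0r subr0 in hv2; have {}hv2 := hv2 td2.
  set x := v (cexp (- w)) in hv1 hv2 *; set y := derive1 v (cexp (- w)) in hv1 *.
  have zt : cexp (- w) * z = 1 by rewrite tz mulVf.
  move: (cexp (- w)) tz zt hv1 hv2 tr1 => t tz zt hv1 hv2 tr1 eq.
  have {}eq : nm (L z) * (nm t * nm (x + t * y) * nm (\det B2)) = nm (a * z + b) * nm (E 0 0 - t * x * E 1 0) ^+ 2.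
    rewrite -nmX -!nmM -eq -[LHS]nmN; congr nm; ring.
  have z1 : 1 <= nm z by rewrite tz nmV invf_lt1// in tr1; exact: ltW.
  have q1 : nm (a * z + b) <= (nm a + nm b) * nm z.
    apply: (le_trans (nmD _ _)); rewrite nmM mulrDl lerD2l.
    by rewrite -[leLHS]mulr1 ler_wpM2l ?nm_ge0.
  have q2 : nm (E 0 0 - t * x * E 1 0) <= c.
    apply: (le_trans (nmB _ _)); rewrite /c lerD2l nmM -[leRHS]mul1r ler_wpM2r ?nm_ge0//.
    exact: ltW hv2.
  have q3 : nm (v 0) / 2 <= nm (x + t * y).
    have := nmB (x + t * y) (x + t * y - v 0); rewrite opprB addrCA subrr addr0 => H.
    rewrite -(lerD2r (nm (v 0) / 2)) -splitr; apply: (le_trans H).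
    by rewrite lerD2l ltW.
  have q4 : nm (E 0 0 - t * x * E 1 0) ^+ 2 <= c ^+ 2 by rewrite lerXn2r ?nnegrE ?nm_ge0.
  have q5 : nm (a * z + b) * nm (E 0 0 - t * x * E 1 0) ^+ 2 <= (nm a + nm b) * nm z * c ^+ 2.
    by rewrite ler_pM ?nm_ge0 ?sqr_ge0.
  have nt : nm t = (nm z)^-1 by rewrite tz nmV.
  rewrite -eq nt in q5; rewrite nmM nmV ler_pdivrMr//.
  have k0 : 0 < nm (v 0) / 2 * nm (\det B2) by rewrite mulr_gt0// divr_gt0.
  rewrite mulrAC -mulrA mulrAC ler_pdivlMr//.
  have q6 : nm (L z) * ((nm z)^-1 * (nm (v 0) / 2) * nm (\det B2)) <= (nm a + nm b) * nm z * c ^+ 2.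
    apply: le_trans q5; rewrite ler_wpM2l ?nm_ge0// ler_wpM2r ?nm_ge0// ler_wpM2l// invr_ge0 nm_ge0//.
  have := ler_wpM2r (nm_ge0 z) q6.
  have -> : nm (L z) * ((nm z)^-1 * (nm (v 0) / 2) * nm (\det B2)) * nm z = nm (L z) * (nm (v 0) / 2 * nm (\det B2)).
    by field; rewrite gt_eqF.
  by move=> /le_trans; apply; rewrite le_eqVlt; apply/orP; left; apply/eqP; ring.
(* Near 0 the function L / z is z g(z), which vanishes at 0, so only the linear term survives. *)
have [k Hk] : exists k : C, forall z, z != 0 -> L z / z = 0 * g 0 + k * z.
  apply: (liouville_punctured (h := fun z => L z / z) (h0 := fun z => z * g z) _ _ _ KL).
  - by move=> z z0; exact: cHDd (cHDM (cHDder (dL z z0)) (cHDV (f := id) z0 (cHDid z))).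
  - exact: cHDd (cHDM (cHDid (0 : C)) (cHDder dg)).
  - move: Lg => /near'CP[d d0 Hd]; apply/near'CP; exists d => // z z0 zd.
    by rewrite -(Hd z z0 zd); field.
have Lk z : z != 0 -> L z = k * z ^+ 2.
  by move=> z0; rewrite -[LHS](divfK z0) Hk// mul0r add0r; ring.
exists k; split => //.
  have gk : g 0 = k.
    apply: (near'_at0 (f := g) (g := fun=> k) (cHDcont (cHDder dg)) (cHDcont (cHDc k (0 : C)))).
    move: Lg => /near'CP[d d0 Hd]; apply/near'CP; exists d => // z z0 zd.
    by rewrite -(Hd z z0 zd) Lk// mulfK// expf_neq0.
  rewrite -gk /g mulr0 add0r mulf_neq0 ?invr_eq0// mulf_neq0 ?oppr_eq0// expf_neq0//.
by move=> w; rewrite -(gauged_omega A w) LE Lk// cexp_neq0.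
Qed.

End NormalForm.

(** * Reduction to the linear system, and its monodromy *)

Section Uniqueness.
Variable R : realType.
Local Notation C := R[i].
Local Notation M2 := 'M[C]_2.
Local Notation Re := (@complex.Re R).
Local Notation Im := (@complex.Im R).

(** With lower left entry k z^2, the Hopf relation is a linear equation for the diagonal entry, and
    det = 0 gives the upper right one. The dilation by - b / a puts the zero of Q at z = 1, so that
    a z + b becomes - b (z - 1). *)
Lemma normal_form (f F : C -> M2) (G : C -> option C) (a b : C) : bryant_lift f F ->
  hopf_rel F (fun w => a * cexp w + b) -> a != 0 -> b != 0 ->
  (forall w, hyp_gauss F w = G (cexp w)) -> branching_orders G 1 0 ->
  exists (A : M2) (c : C), [/\ \det A = 1, cexp c = - b / a &
    conn_system (- b) (fun w => A *m F (w + c))].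
Proof.
move=> bF hQ a0 b0 hG br.
have [A0 [k [A01 k0 lE]]] := kappa_exists bF hQ b0 hG br.
have bA := gauged_lift bF A01; have hA := gauged_hopf bF hQ A01.
have OE := gauged_omega bF A0.
have dO := HD_omega bA; have oh := omega_hopf hA; have tr := omega_tr bA.
have dt := omega_det bA.
move: (domega (fun w => A0 *m F (w + 0))) dO oh => O' dO oh.
have {OE} lE1 w : omega (fun w => A0 *m F (w + 0)) w 1 0 = k * cexp w ^+ 2 by rewrite OE lE.
have OE := gauged_omega bF A0.
move: (omega (fun w => A0 *m F (w + 0))) OE dO oh tr dt lE1 => O OE dO oh tr dt lE1.
have l' w : O' w 1 0 = 2 * k * cexp w ^+ 2.
  have H := cHDZ k (cHDX 2 (HD_cexp w)).
  have nl : \forall u \near w, k * cexp u ^+ 2 = O u 1 0.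
    by apply/nearCP; exists 1 => // u _; rewrite lE1.
  by rewrite (HD_unique (dO w 1 0) (cHD_near nl H)) -[2.-1]/1%N expr1; ring.
have m' w : O' w 0 0 = 2 * O w 0 0 + (a * cexp w + b).
  have := congr1 (fun M : M2 => M 1 0) (oh w); rewrite mul2E scale2E tr lE1 l'.
  move: (O w 0 0) (O' w 0 0) (cexp w) (cexp_neq0 w) => m m1 z z0 H.
  apply: (mulfI (mulf_neq0 k0 (expf_neq0 2 z0))).
  have -> : k * z ^+ 2 * m1 = k * z ^+ 2 * m1 + - m * (2 * k * z ^+ 2) + m * (2 * k * z ^+ 2) by ring.
  by rewrite H; ring.
(* The solutions of m' = 2 m + a z + b are m = k1 z^2 - a z - b / 2; [q] isolates the constant
   k1. *)
pose q (w : C) := (O w 0 0 + a * cexp w + b / 2) / cexp w ^+ 2.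
have qc w : q w = q 0.
  apply: (@holo_const R q) => {}w; have z0 := cexp_neq0 w.
  have H := cHDM (cHDD (cHDD (dO w 0 0) (cHDZ a (HD_cexp w))) (cHDc (b / 2) w))
    (cHDV (f := fun u : C => cexp u ^+ 2) (x := w) (expf_neq0 2 z0) (cHDX 2 (HD_cexp w))).
  apply: (cHD_eq H); rewrite m' -[2.-1]/1%N; move: (O w 0 0) (cexp w) z0 => m z z0; field.
  exact: z0.
set k1 := q 0 in qc.
have mE w : O w 0 0 = k1 * cexp w ^+ 2 - a * cexp w - b / 2.
  by rewrite -(qc w) /q divfK ?expf_neq0 ?cexp_neq0//; ring.
have OO w : O w = mx2 (O w 0 0) (- (O w 0 0 ^+ 2 / (k * cexp w ^+ 2))) (k * cexp w ^+ 2) (- O w 0 0).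
  apply: mx2_eq; rewrite mx2_ij//.
  have := dt w; rewrite det2 tr lE1 => /eqP; rewrite subr_eq0 => /eqP E.
  have l0 : k * cexp w ^+ 2 != 0 by rewrite mulf_neq0 ?expf_neq0 ?cexp_neq0.
  by apply: (mulIf l0); rewrite -E mulNr divfK//; ring.
(* [lam] scales the lower left entry to - b/2 z^2 after the dilation, and the shear by [mu] changes
   the coefficient k1 so that the diagonal entry becomes - b/2 (z - 1)^2. *)
pose lam := - a ^+ 2 / (2 * b * k).
have lam0 : lam != 0.
  by rewrite mulf_neq0 ?oppr_eq0 ?expf_neq0// invr_eq0 !mulf_neq0// pnatr_eq0.
pose s := sqrtc lam; have s2 : s ^+ 2 = lam by rewrite sqr_sqrtc.
have s0 : s != 0 by rewrite -sqrf_eq0 s2.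
pose mu := k1 / k - lam.
pose P : M2 := mx2 s^-1 (- (mu / s)) 0 s.
have P1 : \det P = 1 by rewrite det2 /P !mx2_ij mulr0 subr0 mulVf.
have c0 : - b / a != 0 by rewrite mulf_neq0 ?oppr_eq0 ?invr_eq0.
have [c cE] := cexp_surj c0.
have A1 : \det (P *m A0) = 1 by rewrite det_mulmx P1 A01 mulr1.
exists (P *m A0), c; split => //.
have bG := gauge_lift c bF A1.
split=> [|w|w]; first by case: bG => + _ _ _; apply.
  by case: bG => _ + _ _; apply.
rewrite (omega_dmx bG) [omega _ w]/omega (gauge_dmx (P *m A0) c bF).
congr (_ *m _); rewrite adjM adjM.
have -> : P *m A0 *m dmx F (w + c) *m (\adj (F (w + c)) *m (\adj A0 *m \adj P)) = P *m O (w + c) *m \adj P.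
  by rewrite OE /omega !mulmxA.
rewrite OO mE cexpD cE connE ?cexp_neq0// /P adj_mx2.
have e0 := cexp_neq0 w; move: (cexp w) e0 => z z0.
have cj m n l : mx2 s^-1 (- (mu / s)) 0 s *m mx2 m n l (- m) *m mx2 s (- - (mu / s)) (- 0) s^-1 =
    mx2 (m - mu * l) ((n + 2 * mu * m - mu ^+ 2 * l) / s ^+ 2) (s ^+ 2 * l) (- (m - mu * l)).
  by rewrite !mul_mx2 oppr0 opprK; congr mx2; field.
rewrite cj s2 /mu /lam; clear - a0 b0 k0 z0.
by congr mx2; field; rewrite ?a0 ?b0 ?k0 ?z0.
Qed.

(** With Re nu >= 0 no denominator k + 2 nu is small, so this Frobenius solution exists even in the
    resonant case. F^(-1) applied to it is a constant vector, and comparing both after one period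
    shows that this vector is an eigenvector. *)
Lemma frobenius_eigenvector (th nu : C) (F : C -> M2) (M : M2) : th != 0 -> nu ^+ 2 = 1 + th ->
  0 <= Re nu -> conn_system th F -> (forall w, F (w + tpi R) = F w *m M) ->
  exists x y : C, (x != 0) || (y != 0) /\ M *m mx2 x 0 y 0 = cexp (nu * tpi R) *: mx2 x 0 y 0.
Proof.
move=> th0 nu2 nur [eF F1 dF] FM.
have nud (k : nat) : 1 <= nm (k.+1%:R + 2 * nu).
  apply: le_trans (nm_Re _); apply: le_trans (ler_norm _).
  have -> : Re (k.+1%:R + 2 * nu) = k.+1%:R + 2 * Re nu.
    rewrite ReD -(rmorph_nat (real_complex R)) -[2](rmorph_nat (real_complex R) 2) ReM /=.
    by rewrite mul0r subr0.
  by rewrite -[leLHS]addr0 lerD ?ler1n ?mulr_ge0.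
pose X := frobX th nu; pose Y := frobV th nu.
pose Z w := gauss0 (cexp w) * cexp w ^+ 2 * frobU th nu w.
pose T w := cexp w ^+ 2 * frobU th nu w.
have dY (w : C) : is_derive w 1 Y (Z w) := HD_frobV th0 ltr01 nud nu2 w.
have dX (w : C) : is_derive w 1 X (T w) := HD_frobX th ltr01 nud w.
have cYX w : conn th (cexp w) *m mx2 (Y w) 0 (X w) 0 = mx2 (Z w) 0 (T w) 0.
  exact: frob_conn.
have c11 w : conn th (cexp w) 1 1 = - conn th (cexp w) 0 0.
  by rewrite /conn scale_mx2 !mx2_ij mulrN.
have dFij (w : C) i j : is_derive w 1 (fun u => F u i j) ((conn th (cexp w) *m F w) i j).
  by rewrite -dF; exact: entireM_HD.
(* The components of F^(-1) (Y, X); their derivatives vanish because the connection is traceless. *)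
pose v0 w := F w 1 1 * Y w - F w 0 1 * X w.
pose v1 w := F w 0 0 * X w - F w 1 0 * Y w.
have ZE w : Z w = conn th (cexp w) 0 0 * Y w + conn th (cexp w) 0 1 * X w.
  by have := congr1 (fun M : M2 => M 0 0) (cYX w); rewrite mul2E !mx2_ij.
have TE w : T w = conn th (cexp w) 1 0 * Y w + conn th (cexp w) 1 1 * X w.
  by have := congr1 (fun M : M2 => M 1 0) (cYX w); rewrite mul2E !mx2_ij.
have v0c w w' : v0 w = v0 w'.
  apply: (@holo_const R v0) => u.
  apply: (cHD_eq (cHDB (cHDM (dFij u 1 1) (dY u)) (cHDM (dFij u 0 1) (dX u)))).
  by rewrite ZE TE !mul2E c11; move: (conn _ _) (F u) => N K; ring.
have v1c w w' : v1 w = v1 w'.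
  apply: (@holo_const R v1) => u.
  apply: (cHD_eq (cHDB (cHDM (dFij u 0 0) (dX u)) (cHDM (dFij u 1 0) (dY u)))).
  by rewrite ZE TE !mul2E c11; move: (conn _ _) (F u) => N K; ring.
have YE w : mx2 (Y w) 0 (X w) 0 = F w *m mx2 (v0 0) 0 (v1 0) 0.
  rewrite -(v0c w) -(v1c w) /v0 /v1; have := F1 w; rewrite det2; move: (Y w) (X w) (F w) => y x K K1.
  apply: mx2_eq; rewrite mul2E !mx2_ij ?mulr0 ?addr0//.
  - by rewrite -[LHS]mul1r -K1; ring.
  - by rewrite -[LHS]mul1r -K1; ring.
have d1 w : deck 1 w = w + tpi R by rewrite deckE mul1r.
set lam := cexp (nu * tpi R).
have lY w : Y (w + tpi R) = lam * Y w by rewrite -d1 /Y frobV_deck mul1r.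
have lX w : X (w + tpi R) = lam * X w by rewrite -d1 /X frobX_deck mul1r.
exists (v0 0), (v1 0); split.
  have [w] := frob_nonzero th ltr01 nud; apply: contraNT => /norP[/negbNE/eqP x0 /negbNE/eqP y0].
  have := congr1 (fun A : M2 => A 1 0) (YE w); rewrite x0 y0 mul2E !mx2_ij !mulr0 addr0 => E.
  by apply/eqP.
have E := YE (0 + tpi R); rewrite lY lX FM -mulmxA in E.
have E2 : mx2 (lam * Y 0) 0 (lam * X 0) 0 = lam *: mx2 (Y 0) 0 (X 0) 0.
  by rewrite scale_mx2 mulr0.
rewrite E2 YE scalemxAr in E; have := congr1 (mulmx (\adj (F 0))) E.
by rewrite !mulmxA mul_adj_mx F1 !mul1mx => <-.
Qed.

Lemma sqr1_ge0 (x : R) : 0 <= x -> x ^+ 2 = 1 -> x = 1.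
Proof. by move=> x0 /eqP; rewrite sqrf_eq1 => /orP[/eqP //|/eqP E]; move: x0; rewrite E; lra. Qed.

Lemma unitary_eigenvalue (M V : M2) (lam : C) : M *m adjoint M = 1 -> V != 0 ->
  M *m V = lam *: V -> nm lam = 1.
Proof.
move=> MM V0 MV; have MM' : adjoint M *m M = 1 by exact: mulmx1C.
have E : adjoint (M *m V) *m (M *m V) = adjoint V *m V.
  by rewrite adjointM -mulmxA (mulmxA _ M) MM' mul1mx.
rewrite MV adjointZ -scalemxAl -scalemxAr scalerA mulrC -nm2C in E.
have T (A : M2) : \tr (adjoint A *m A) = (fro A)%:C.
  rewrite tr2 !mul2E !adjointE /fro !rmorphD /= !nm2C; ring.
have := congr1 (fun A : M2 => \tr A) E; rewrite mxtraceZ T -rmorphM => /complexI H.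
have f0 : fro V != 0 by apply: contraNneq V0 => /fro_eq0 ->.
have : nm lam ^+ 2 = 1 by apply: (mulIf f0); rewrite mul1r.
exact: sqr1_ge0 (nm_ge0 _).
Qed.

(** The trace is 2 e because det M = 1 and e = 1 / e. The diagonal entries have modulus at most 1
    and their sum has modulus 2, so both have modulus 1, and the rows of length 1 leave no room off
    the diagonal. *)
Lemma unitary_scalar (M V : M2) (e : C) : M *m adjoint M = 1 -> \det M = 1 -> V != 0 ->
  M *m V = e *: V -> e ^+ 2 = 1 -> M = e%:M.
Proof.
move=> MM M1 V0 MV e2.
have d0 : \det (M - e%:M) = 0.
  apply/eqP; apply: contraNT V0 => dn.
  have U : M - e%:M \in unitmx by rewrite unitmxE unitfE.
  by rewrite -(mulKmx U V) mulmxBl MV mul_scalar_mx subrr mulmx0.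
have {}d0 : M 0 0 + M 1 1 = 2 * e.
  have : \det (M - e%:M) = (M 0 0 - e) * (M 1 1 - e) - M 0 1 * M 1 0.
    by rewrite det2 !mxE /= !mulr1n !mulr0n !subr0.
  rewrite d0; have -> : (M 0 0 - e) * (M 1 1 - e) - M 0 1 * M 1 0 =
    \det M + e ^+ 2 - e * (M 0 0 + M 1 1) by rewrite det2; ring.
  rewrite M1 e2 => /esym/eqP; rewrite subr_eq0 => /eqP H.
  have e0 : e != 0 by rewrite -sqrf_eq0 e2 oner_eq0.
  by apply: (mulfI e0); rewrite -H mulrCA -expr2 e2; ring.
have r0 i : nm (M i 0) ^+ 2 + nm (M i 1) ^+ 2 = 1.
  have := congr1 (fun A : M2 => A i i) MM; rewrite mul2E !adjointE [RHS]mxE eqxx -!nm2C -rmorphD.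
  by move=> /complexI.
have ne : nm e = 1.
  by have := congr1 (@nm R) e2; rewrite nmX nm1; exact: sqr1_ge0 (nm_ge0 _).
have t2 : 2 <= nm (M 0 0) + nm (M 1 1).
  by apply: (le_trans _ (nmD _ _)); rewrite d0 nmM ne mulr1 nm_nat.
have h0 := r0 0; have h1 := r0 1.
have n0 := nm_ge0 (M 0 0); have n1 := nm_ge0 (M 0 1); have n2 := nm_ge0 (M 1 0); have n3 := nm_ge0 (M 1 1).
have a0 : nm (M 0 0) <= 1 by nra.
have a1 : nm (M 1 1) <= 1 by nra.
have z1 : M 0 1 = 0.
  have E : nm (M 0 0) = 1 by lra.
  have sq : nm (M 0 1) ^+ 2 = 0 by rewrite E expr1n in h0; lra.
  by apply/eqP; rewrite -nm_eq0 -sqrf_eq0 sq.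
have z2 : M 1 0 = 0.
  have E : nm (M 1 1) = 1 by lra.
  have sq : nm (M 1 0) ^+ 2 = 0 by rewrite E expr1n in h1; lra.
  by apply/eqP; rewrite -nm_eq0 -sqrf_eq0 sq.
have m0 : M 0 0 = e.
  apply/eqP; rewrite -subr_eq0 -sqrf_eq0; apply/eqP.
  have -> : (M 0 0 - e) ^+ 2 = M 0 0 ^+ 2 - M 0 0 * (2 * e) + e ^+ 2 by ring.
  by rewrite -d0 e2 -M1 det2 z1; ring.
have m1 : M 1 1 = e by apply: (addrI (M 0 0)); rewrite d0 m0; ring.
by apply: mx2_eq; rewrite ?m0 ?m1 ?z1 ?z2 mxE.
Qed.

(** A Moebius transformation fixing a nonconstant g is trivial: its fixed point equation is
    quadratic in g, and differentiating twice kills the coefficients, as g' = Q / l is not 0.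
    Working where Re w > 0, that is |z| > 1, avoids the zero z = 1 of Q. *)
Lemma mobius_fix_scalar (N N' : C -> M2) (th : C) (r : M2) : th != 0 ->
  (forall (w : C) i j, is_derive w 1 (fun u => N u i j) (N' w i j)) ->
  (forall w, N w *m N' w = (th * (cexp w - 1)) *: N w) ->
  (forall w, N w 1 1 = - N w 0 0) -> (forall w, N w 0 0 ^+ 2 + N w 0 1 * N w 1 0 = 0) ->
  (forall w, N w != 0) ->
  (forall w, N w 1 0 != 0 ->
     mobius r (Some (N w 0 0 / N w 1 0)) = Some (N w 0 0 / N w 1 0)) ->
  is_scalar_mx r.
Proof.
move=> th0 dN hN N11 ml N0 fix_rho.
have ent (K L : M2) (q : C) : K *m L = q *: K ->
    K 0 0 * L 0 1 + K 0 1 * L 1 1 = q * K 0 1 /\ K 1 0 * L 0 0 + K 1 1 * L 1 0 = q * K 1 0.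
  by move=> E; split; rewrite -mul2E E scale2E.
have N'11 w : N' w 1 1 = - N' w 0 0.
  have E : (fun u => N u 1 1) = (fun u => - N u 0 0) by apply/funext.
  by have := dN w 1 1; rewrite E => H; exact: HD_unique H (cHDN (dN w 0 0)).
have Q0 w : 0 < Re w -> th * (cexp w - 1) != 0.
  move=> Rw; rewrite mulf_neq0// subr_eq0; apply/eqP => /(congr1 (@nm R)).
  by rewrite nm_cexp nm1 => E; have := expR_gt1 (Re w); rewrite E ltxx Rw.
have nR (w : C) : 0 < Re w -> \forall u \near w, 0 < Re u.
  move=> Rw; apply/nearCP; exists (Re w) => // u uw.
  have := le_lt_trans (nm_Re (u - w)) uw; rewrite ReB ltr_norml => /andP[]; lra.
(* Were g infinite on the whole half-plane, the diagonal of N and its derivative would vanish there,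
   and N N' = Q N would force N = 0. *)
have [w0 Rw0 l0] : exists2 w, 0 < Re w & N w 1 0 != 0.
  apply: contrapT => H.
  have l_0 w : 0 < Re w -> N w 1 0 = 0.
    by move=> Rw; apply/eqP/negP => /negP l0; apply: H; exists w.
  have m_0 w : 0 < Re w -> N w 0 0 = 0.
    by move=> Rw; have /eqP := ml w; rewrite (l_0 w Rw) mulr0 addr0 sqrf_eq0 => /eqP.
  have R1 : 0 < Re (1 : C) by rewrite /= ltr01.
  have m'0 : N' 1 0 0 = 0.
    apply: HD_unique (dN 1 0 0) (cHD_near _ (cHDc 0 (1 : C))).
    by apply: filterS (nR 1 R1) => u /m_0.
  have [h _] := ent _ _ _ (hN 1).
  have n0 : N 1 0 1 = 0.
    by move: h; rewrite (m_0 1 R1) (N'11 1) m'0 oppr0 mulr0 mul0r addr0 => /esym/eqP; rewrite mulf_eq0 (negbTE (Q0 1 R1)) => /eqP.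
  by case/eqP: (N0 1); apply: mx2_eq; rewrite ?N11 ?n0 ?(m_0 1 R1) ?(l_0 1 R1) ?oppr0 mxE.
pose g w := N w 0 0 / N w 1 0.
have S : \forall u \near w0, N u 1 0 != 0 /\ 0 < Re u.
  apply: filterS2 (near_neq0C (cHDcont (dN w0 1 0)) l0) (nR w0 Rw0) => u ? ?; by split.
have dg (u : C) : N u 1 0 != 0 -> is_derive u 1 g (th * (cexp u - 1) / N u 1 0).
  move=> lu; apply: (cHD_eq (cHDM (dN u 0 0) (cHDV lu (dN u 1 0)))).
  have [_] := ent _ _ _ (hN u); rewrite N11.
  move: (N' u) (th * (cexp u - 1)) (N u) lu => K q L lu E.
  have -> : q / L 1 0 = (q * L 1 0) / L 1 0 ^+ 2 by field.
  by rewrite -E; field.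
have e1 : \forall u \near w0, r 1 0 * g u ^+ 2 + (r 1 1 - r 0 0) * g u - r 0 1 = 0.
  apply: filterS S => u [lu _]; have := fix_rho u lu; rewrite /mobius /Defs.ratio -/(g u).
  case: eqP => // /eqP k0 [E].
  have {}E : g u * (r 1 0 * g u + r 1 1) = r 0 0 * g u + r 0 1 by have := divfK k0 (r 0 0 * g u + r 0 1); rewrite E.
  have -> : r 1 0 * g u ^+ 2 + (r 1 1 - r 0 0) * g u - r 0 1 =
     g u * (r 1 0 * g u + r 1 1) - (r 0 0 * g u + r 0 1) by ring.
  by rewrite E subrr.
have e2' : \forall u \near w0, 2 * r 1 0 * g u + (r 1 1 - r 0 0) = 0.
  apply: filterS2 S (near_join e1) => u [lu Ru] eu.
  have H := cHDB (cHDD (cHDZ (r 1 0) (cHDX 2 (dg u lu))) (cHDZ (r 1 1 - r 0 0) (dg u lu))) (cHDc (r 0 1) u).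
  have Z := HD_unique (cHD_near (filterS (fun t => @esym _ _ _) eu) (cHDc 0 u)) H.
  have k0 : th * (cexp u - 1) / N u 1 0 != 0 by rewrite mulf_neq0 ?invr_eq0 ?Q0.
  apply: (mulIf k0); rewrite mul0r [RHS]Z -[2.-1]/1%N expr1; ring.
have r10 : r 1 0 = 0.
  have H := cHDD (cHDZ (2 * r 1 0) (dg w0 l0)) (cHDc (r 1 1 - r 0 0) w0).
  have Z := HD_unique (cHD_near (filterS (fun t => @esym _ _ _) e2') (cHDc 0 w0)) H.
  move: (Z (nbhs_filter w0)) => /esym/eqP.
  have k0 : th * (cexp w0 - 1) / N w0 1 0 != 0 by rewrite mulf_neq0 ?invr_eq0 ?Q0.
  rewrite addr0 mulf_eq0 (negbTE k0) orbF mulf_eq0.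
  by rewrite pnatr_eq0 => /eqP.
have r11 : r 1 1 = r 0 0.
  have := nbhs_singleton e2'; rewrite r10 mulr0 mul0r add0r => /eqP; rewrite subr_eq0 => /eqP //.
have r01 : r 0 1 = 0.
  have := nbhs_singleton e1; rewrite r10 r11 subrr !mul0r !add0r => /eqP; rewrite oppr_eq0 => /eqP //.
apply/is_scalar_mxP; exists (r 0 0).
by apply: mx2_eq; rewrite ?r10 ?r11 ?r01 mxE.
Qed.

(** A scalar monodromy cancels in F^(-1) dF, so g is periodic and every matrix representing rho_g
    fixes it pointwise. *)
Lemma periodic_rho_scalar (f F : C -> M2) (th e : C) (rho : int -> M2) : bryant_lift f F -> th != 0 ->
  hopf_rel F (fun w => th * (cexp w - 1)) -> e ^+ 2 = 1 -> (forall w, F (w + tpi R) = F w *m e%:M) ->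
  represents_rho_g F rho -> H3_reducible rho.
Proof.
move=> bF th0 hQ e2 Fe rep n.
have [eF F1 _ _] := bF.
have De w : dmx F (w + tpi R) = dmx F w *m e%:M.
  rewrite -(dmx_shift (tpi R) w eF) -(dmx_mulr e%:M w eF); congr (dmx _ w); exact/funext.
have mcp w : mc_form F (w + tpi R) = mc_form F w.
  have de : \det (e%:M : M2) = 1 by rewrite det_scalar.
  rewrite (mc_form_right (F1 w) de (Fe w) (De w)) -mulmxA mul_mx_scalar -scalemxAr.
  have -> : e *: (\adj (e%:M : M2) *m mc_form F w) = (e%:M *m \adj (e%:M)) *m mc_form F w.
    by rewrite -mulmxA mul_scalar_mx.
  by rewrite mul_mx_adj de mul1mx.
have sp w : sec_gauss F (deck (- n) w) = sec_gauss F w.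
  by apply: periodic_deck => u; rewrite !(sec_gaussE _ bF) mcp.
have [_ fix_rho] := rep n.
have E w := mc_entries bF w.
apply: (mobius_fix_scalar th0 (HD_mc bF) ((hopf_relE bF _).1 hQ)) => w.
- by have [/(congr1 (fun M : M2 => M 1 1)) H _] := E w; rewrite mx2_ij in H.
- by have [] := E w.
- have := lift_fro bF w; apply: contraTneq => ->.
  by rewrite /fro !mxE nm0 expr0n !addr0 ltxx.
- by move=> l0; have := fix_rho w; rewrite sp (sec_gaussE w bF) ratio_neq0// => <-.
Qed.

End Uniqueness.

(** * Classification of the surfaces, and the theorem *)

Section Classification.
Variable R : realType.
Local Notation C := R[i].
Local Notation M2 := 'M[C]_2.
Local Notation Re := (@complex.Re R).
Local Notation Im := (@complex.Im R).

Lemma real_exponent (th : C) (f F : C -> M2) : th != 0 -> conn_system th F ->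
  (forall w, f (cexp w) = F w *m adjoint (F w)) -> H1_reducible F ->
  exists theta : R, [/\ th = theta%:C, 0 <= 4 + 4 * theta &
    ~ (Num.sqrt (4 + 4 * theta) \is a Num.int)].
Proof.
move=> th0 sF fF [rho [rep _ nH3]].
have bF := system_lift th0 sF fF; have [eF F1 _] := sF.
have [M [M1 MM FM]] := lift_monodromy eF F1 fF.
have [nu [nu2 nur]] : exists nu : C, nu ^+ 2 = 1 + th /\ 0 <= Re nu.
  have s2 := sqr_sqrtc (1 + th).
  (* Of the two square roots, the one with nonnegative real part is kept, as [frobenius_eigenvector]
     requires. *)
  case: (lerP 0 (Re (sqrtc (1 + th)))) => s0; first by exists (sqrtc (1 + th)).
  exists (- sqrtc (1 + th)); rewrite sqrrN; split=> //.
  by rewrite ReN oppr_ge0 ltW.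
have [x [y [xy0 MV]]] := frobenius_eigenvector th0 nu2 nur sF FM.
set V := mx2 x 0 y 0 in MV.
have V0 : V != 0.
  apply: contraTneq xy0 => V0.
  have := (congr1 (fun A : M2 => A 0 0) V0, congr1 (fun A : M2 => A 1 0) V0).
  by rewrite /V !mx2_ij !mxE => -[-> ->]; rewrite eqxx.
have /expR_inj E : expR (Re (nu * tpi R)) = expR 0.
  by rewrite -nm_cexp expR0; exact: unitary_eigenvalue MM V0 MV.
have Inu : Im nu = 0.
  move: E; rewrite ReM /tpi /= mulr0 sub0r => /eqP; rewrite oppr_eq0 !mulf_eq0.
  by rewrite pnatr_eq0 /= (gt_eqF (pi_gt0 R)) orbF => /eqP.
have nuE : nu = (Re nu)%:C by rewrite [LHS]complexRI Inu.
set a := Re nu in nuE nur.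
have thE : th = (a ^+ 2 - 1)%:C.
  by rewrite rmorphB rmorphXn /= -nuE nu2; ring.
exists (a ^+ 2 - 1).
have E4 (t : R) : 4 + 4 * (t ^+ 2 - 1) = (2 * t) ^+ 2 by ring.
rewrite E4 sqrtr_sqr ger0_norm ?mulr_ge0//; split=> //.
move=> /intrP[n an]; apply: nH3.
(* If 2 nu is an integer, the eigenvalue has square 1 and the unitary monodromy is scalar. *)
set lam := cexp (nu * tpi R) in MV.
have l2 : lam ^+ 2 = 1.
  have nE : 2%:R * nu = n%:~R.
    by rewrite nuE -(rmorph_nat (real_complex R) 2) -rmorphM an rmorph_int.
  by rewrite /lam cexpX mulrA nE cexp_int.
apply: (periodic_rho_scalar (e := lam) bF th0 _ l2 _ rep).
  have dq : forall z, (@Cstar R) z -> derivable (fun z : C => th * (z - 1) / z ^+ 2) z 1.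
    by have [] := system_hopf th0 sF fF.
  have H := (hopf_iff bF dq).1 (system_hopf th0 sF fF).
  suff <- : (fun w => th * (cexp w - 1) / cexp w ^+ 2 * cexp w ^+ 2) =
            (fun w => th * (cexp w - 1)) by [].
  by apply/funext => w; rewrite divfK// expf_neq0// cexp_neq0.
by move=> w; rewrite FM (unitary_scalar MM M1 V0 MV l2).
Qed.

Lemma end_coordinate_scale (p1 p2 : option C) (A : M2) (e : C) : e != 0 ->
  end_coordinate p1 p2 A ->
  end_coordinate p1 p2 (A *m mx2 e 0 0 1) /\
  forall z, mobius (A *m mx2 e 0 0 1) (Some z) = mobius A (Some (e * z)).
Proof.
move=> e0 [A0 A1 A2].
have E i : (A *m mx2 e 0 0 1) i 0 = e * A i 0 /\ (A *m mx2 e 0 0 1) i 1 = A i 1.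
  by rewrite !mul2E !mx2_ij; split; ring.
have [[E1 E2] [E3 E4]] := (E 0, E 1).
have H z : mobius (A *m mx2 e 0 0 1) (Some z) = mobius A (Some (e * z)).
  by rewrite /mobius E1 E2 E3 E4; congr (Defs.ratio (_ + _) (_ + _)); ring.
split=> //; split.
- by rewrite det_mulmx mulf_neq0// det2 !mx2_ij mulr1 mulr0 subr0.
- by rewrite H mulr0.
- by rewrite -A2 /mobius E1 E3 ratioM.
Qed.

Lemma gauge_H1_reducible (f F : C -> M2) (A : M2) (c : C) : bryant_lift f F -> \det A = 1 ->
  H1_reducible F -> H1_reducible (fun w => A *m F (w + c)).
Proof.
move=> bF A1 [rho [rep red nH3]]; exists rho; split; [|exact: red|exact: nH3].
move=> n; have [r1 rn] := rep n; split; first exact: r1.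
move=> w; have E : deck (- n) w + c = deck (- n) (w + c) by rewrite !deckE addrAC.
by rewrite (gauge_sec c bF A1) E rn -(gauge_sec c bF A1).
Qed.

Lemma uniqueness (f : C -> M2) (G : C -> option C) (q : C -> C) :
  H1_reducible_cmc1 (-2) (-3) f G q -> branching_orders G 1 0 ->
  exists (theta : R) (c : C) (a : M2),
    [/\ 0 <= 4 + 4 * theta, ~ (Num.sqrt (4 + 4 * theta) \is a Num.int),
      \det a = 1, theta != 0 &
      H1_reducible_cmc1 (-2) (-3) (fun z => a *m f (cexp c * z) *m adjoint a)
        (fun z => Some (gauss0 z)) (fun z => theta%:C * (z - 1) / z ^+ 2)].
Proof.
move=> [F [_ [bF hG hH] rF ty]] br.
have [al [be [al0 be0 qE]]] := hopf_form hH.1 ty.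
have hQ : hopf_rel F (fun w => al * cexp w + be).
  suff <- : (fun w => q (cexp w) * cexp w ^+ 2) = (fun w => al * cexp w + be).
    exact: (hopf_iff bF hH.1).1 hH.
  by apply/funext => w; rewrite qE ?cexp_neq0// divfK// expf_neq0// cexp_neq0.
have [P [c [P1 _ sF]]] := normal_form bF hQ al0 be0 hG br.
have th0 : - be != 0 by rewrite oppr_eq0.
pose f' z := P *m f (cexp c * z) *m adjoint P; pose F' w := P *m F (w + c).
have fF' w : f' (cexp w) = F' w *m adjoint (F' w).
  by have [_ _ _ H] := gauge_lift c bF P1; exact: H.
have rF' := gauge_H1_reducible c bF P1 rF.
have [theta [thE t4 tZ]] := real_exponent th0 sF fF' rF'.
have t0 : theta != 0 by apply: contra_neq th0 => t0; rewrite thE t0.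
exists theta, c, P; split; [exact: t4|exact: tZ|exact: P1|exact: t0|].
rewrite thE in th0 sF.
rewrite -/f'; exists F'; split; [ | | exact: rF' |].
- exact: system_cmc1 th0 sF fF'.
- split; [exact: system_lift th0 sF fF' | | exact: (system_hopf th0 sF fF')].
  by move=> w; rewrite (system_gauss th0 sF).
- by split; [exact: order_at0_Q0_0 | exact: order_at0_Q0_infty].
Qed.

End Classification.

Theorem theorem4p12 (R : realType) :
  let G0 : R[i] -> option R[i] := fun z => Some (((z - 1) / z) ^+ 2) in
  let Q0 : R -> R[i] -> R[i] := fun theta z => theta%:C * (z - 1) / z ^+ 2 in
  (forall theta : R,
     0 <= 4 + 4 * theta -> ~ (Num.sqrt (4 + 4 * theta) \is a Num.int) ->
     exists f : R[i] -> 'M[R[i]]_2,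
       H1_reducible_cmc1 (-2) (-3) f G0 (Q0 theta) /\
       dual_TA G0 (Q0 theta) = (8 * pi)%:E)
  /\
  (forall (p1 p2 : option R[i]) (f : option R[i] -> 'M[R[i]]_2)
     (A : 'M[R[i]]_2) (G : R[i] -> option R[i]) (q : R[i] -> R[i]),
     end_coordinate p1 p2 A ->
     H1_reducible_cmc1 (-2) (-3) (fun z => f (mobius A (Some z))) G q ->
     branching_orders G 1 0 ->
     dual_TA G q = (8 * pi)%:E ->
     exists (theta : R) (B a : 'M[R[i]]_2),
       [/\ 0 <= 4 + 4 * theta,
           ~ (Num.sqrt (4 + 4 * theta) \is a Num.int),
           end_coordinate p1 p2 B,
           \det a = 1 &
           H1_reducible_cmc1 (-2) (-3)
             (fun z => a *m f (mobius B (Some z)) *m adjoint a) G0 (Q0 theta) /\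
           dual_TA G0 (Q0 theta) = (8 * pi)%:E]).
Proof.
split.
  move=> theta t4 tZ.
  (* For theta = 0 the square root would be the integer 2; below, theta = -1 is excluded because it
     would give 0. *)
  have t0 : theta != 0.
    apply/eqP => t0; apply: tZ; rewrite t0 mulr0 addr0 (_ : 4 = 2 ^+ 2); last by ring.
    by rewrite sqrtr_sqr ger0_norm//; apply/intrP; exists 2.
  have t1 : 0 <= 1 + theta by move: t4; lra.
  have sE : Num.sqrt (4 + 4 * theta) = 2 * Num.sqrt (1 + theta).
    have -> : 4 + 4 * theta = 2 ^+ 2 * (1 + theta) by ring.
    by rewrite sqrtrM ?exprn_ge0// sqrtr_sqr ger0_norm.
  rewrite sE in tZ.
  have s0 : 0 < Num.sqrt (1 + theta).
    rewrite lt_def sqrtr_ge0 andbT; apply/eqP => s0; apply: tZ; rewrite s0 mulr0.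
    by apply/intrP; exists 0.
  have [f fH] := existence t0 s0 (sqr_sqrtr t1) tZ.
  by exists f; split; [exact: fH | exact: dual_TA_gauss0].
move=> p1 p2 f A G q pA fH br _.
have [theta [c [a [t4 tZ a1 t0 H]]]] := uniqueness fH br.
have [pB BE] := end_coordinate_scale (cexp_neq0 c) pA.
exists theta, (A *m mx2 (cexp c) 0 0 1), a; split; [exact: t4|exact: tZ|exact: pB|exact: a1|].
split; last exact: dual_TA_gauss0.
suff -> : (fun z => a *m f (mobius (A *m mx2 (cexp c) 0 0 1) (Some z)) *m adjoint a) =
  (fun z => a *m f (mobius A (Some (cexp c * z))) *m adjoint a) by exact: H.
by apply/funext => z; rewrite BE.
Qed.
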